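(* For Lebesgue-almost every real $\alpha>1$, the sequence $(\{\alpha^n\})_{n\ge1}$ of fractional parts of the geometric progression has Poissonian $k$-point correlation for every integer $k\ge2$.
   Context: For a real sequence $\vartheta=(\vartheta_n)_{n\ge1}$, an integer $k\ge2$ and $N\ge1$, let $\mathcal{B}_k=\mathcal{B}_k(N)$ be the set of integer $k$-tuples $\mathbf{x}=(x_1,\dots,x_k)$ with all $x_i\in\{1,\dots,N\}$ and no two components equal. Let $\Delta(\mathbf{x},\vartheta)=(\vartheta_{x_1}-\vartheta_{x_2},\vartheta_{x_2}-\vartheta_{x_3},\dots,\vartheta_{x_{k-1}}-\vartheta_{x_k})\in\mathbb{R}^{k-1}$. For compactly supported $f:\mathbb{R}^{k-1}\to\mathbb{R}$ define the $k$-point correlation sum $R_k(f,\vartheta,N)=\frac1N\sum_{\mathbf{x}\in\mathcal{B}_k}\sum_{\mathbf{m}\in\mathbb{Z}^{k-1}} f\big(N(\Delta(\mathbf{x},\vartheta)-\mathbf{m})\big)$. The $k$-point correlation of $(\{\vartheta_n\})_{n\ge1}$ is called Poissonian if $\lim_{N\to\infty}R_k(f,\vartheta,N)=\int_{\mathbb{R}^{k-1}}f(\mathbf{x})\,d\mathbf{x}$ for every real-valued smooth compactly supported $f$ on $\mathbb{R}^{k-1}$. Here $\{\cdot\}$ denotes the fractional part. *)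

(* Defs.v *)
From HB Require Import structures.
From mathcomp Require Import all_boot all_order all_algebra.
From mathcomp Require Import all_classical all_reals all_analysis.

Set Implicit Arguments.
Unset Strict Implicit.
Unset Printing Implicit Defensive.
Import Order.TTheory GRing.Theory Num.Theory.
Import numFieldNormedType.Exports.

Local Open Scope classical_set_scope.
Local Open Scope ring_scope.

(* Lebesgue measure on R^n, carried by n-tuples with the product sigma-algebra:
   the image of lebesgue_measure \x (Lebesgue measure on R^(n-1)) under cons. *)
Section cons_measure.
Local Open Scope ereal_scope.
Context {R : realType} (n : nat).
Local Notation T := (measurableTypeR R).
Variable mu : {sigma_finite_measure set (n.-tuple T) -> \bar R}.

Definition tuple_cons (p : T * n.-tuple T) : n.+1.-tuple T :=
  [the n.+1.-tuple T of p.1 :: p.2].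

Lemma measurable_tuple_cons : measurable_fun setT tuple_cons.
Proof. exact: measurable_cons. Qed.

Definition cons_measure : set (n.+1.-tuple T) -> \bar R :=
  pushforward (@lebesgue_measure R \x mu) tuple_cons.

Let cons_measure0 : cons_measure set0 = 0.
Proof. by rewrite /cons_measure /pushforward preimage_set0 measure0. Qed.

Let cons_measure_ge0 A : 0 <= cons_measure A.
Proof. by rewrite /cons_measure /pushforward; exact: measure_ge0. Qed.

Let measurable_preimage A :
  measurable A -> measurable (tuple_cons @^-1` A).
Proof. by move=> mA; rewrite -[X in measurable X]setTI; exact: measurable_tuple_cons. Qed.

Let cons_measure_sigma_additive : semi_sigma_additive cons_measure.
Proof.
move=> F mF tF mUF; rewrite /cons_measure /pushforward preimage_bigcup.
apply: measure_semi_sigma_additive.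
- by move=> i; exact: measurable_preimage.
- apply/trivIsetP => /= i j _ _ ij; rewrite -preimage_setI.
  by move/trivIsetP : tF => /(_ _ _ _ _ ij) ->//; rewrite preimage_set0.
- by rewrite -preimage_bigcup; exact: measurable_preimage.
Qed.

HB.instance Definition _ := isMeasure.Build _ _ _ cons_measure
  cons_measure0 cons_measure_ge0 cons_measure_sigma_additive.

Let cons_measure_sigma_finite : sigma_finite setT cons_measure.
Proof.
have /sigma_finiteP[F [FT ndF mF]] := sigma_finiteT (@lebesgue_measure R).
have /sigma_finiteP[G [GT ndG mG]] := sigma_finiteT mu.
pose hd (t : n.+1.-tuple T) : T := thead t.
pose tl (t : n.+1.-tuple T) : n.-tuple T := [tuple of behead t].
exists (fun i => hd @^-1` F i `&` tl @^-1` G i).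
  apply/esym; rewrite -subTset => t _.
  have [i _ Fi] : (\bigcup_i F i) (hd t) by rewrite -FT.
  have [j _ Gj] : (\bigcup_i G i) (tl t) by rewrite -GT.
  exists (maxn i j) => //; split.
  - by have /subsetPset := ndF _ _ (leq_maxl i j); exact.
  - by have /subsetPset := ndG _ _ (leq_maxr i j); exact.
move=> i; have [mFi Fioo] := mF i; have [mGi Gioo] := mG i; split.
  apply: measurableI; rewrite -[X in measurable X]setTI.
  - exact: (@measurable_tnth _ _ _ ord0).
  - exact: measurable_behead.
rewrite /cons_measure /pushforward (_ : _ @^-1` _ = F i `*` G i).
  by rewrite product_measure1E// lte_mul_pinfty// ge0_fin_numE.
apply/seteqP; split=> -[x t] /= [Fx Gt]; split => //=.
- by move: Gt; congr (G i _); exact: val_inj.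
- by rewrite /tl (_ : [tuple of _] = t)//; exact: val_inj.
Qed.

HB.instance Definition _ := Measure_isSigmaFinite.Build _ _ _ cons_measure
  cons_measure_sigma_finite.

End cons_measure.

Fixpoint lebesgue_measure_tuple {R : realType} (n : nat) :
    {sigma_finite_measure set (n.-tuple (measurableTypeR R)) -> \bar R} :=
  match n with
  | 0 => [the {sigma_finite_measure set _ -> \bar R} of \d_[tuple]]
  | n'.+1 => [the {sigma_finite_measure set _ -> \bar R} of
                cons_measure (lebesgue_measure_tuple n')]
  end.

Lemma lebesgue_measure_tuple_box (R : realType) (n : nat)
    (A : 'I_n -> set (measurableTypeR R)) :
  (forall i, measurable (A i)) ->
  lebesgue_measure_tuple n [set t | forall i, A i (tnth t i)] =
  (\prod_(i < n) lebesgue_measure (A i))%E.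
Proof.
elim: n A => [|n IHn] A mA /=.
  by rewrite big_ord0 diracE mem_set//= => -[].
rewrite big_ord_recl -IHn// -product_measure1E//; last first.
  rewrite (_ : [set t | _] =
      \bigcap_(i in [set: 'I_n]) ((@tnth _ _)^~ i @^-1` A (lift ord0 i))).
    apply: fin_bigcap_measurable; first exact: finite_finset.
    move=> i _; rewrite -[X in measurable X]setTI.
    by apply: measurable_tnth => //; exact: measurableT.
  by apply/seteqP; split=> t /= tA i; [move=> _|]; exact: tA.
rewrite /cons_measure /pushforward; congr (product_measure1 _ _ _).
apply/seteqP; split=> -[x t] /= xtA.
  by split=> [|i]; [exact: (xtA ord0)|have := xtA (lift ord0 i); rewrite tnthS].
move=> i; case: (unliftP ord0 i) => [j|] ->; last exact: xtA.1.
by rewrite tnthS; exact: xtA.2.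
Qed.

Section correlation.
Context {R : realType}.

Section smooth.
Context {n : nat}.
Implicit Type f : 'rV[R]_n -> R.

Definition integral_Rn f : R :=
  \int[lebesgue_measure_tuple n]_t f (\row_(i < n) tnth t i).

Definition partial (i : 'I_n) f : 'rV[R]_n -> R := 'D_(delta_mx 0 i) f.

Definition iter_partial (s : seq 'I_n) f : 'rV[R]_n -> R := foldr partial f s.

Definition smooth f := forall s : seq 'I_n,
  continuous (iter_partial s f) /\
  forall (i : 'I_n) (x : 'rV[R]_n),
    derivable (iter_partial s f) x (delta_mx 0 i).

Definition compactly_supported f := compact (closure [set x | f x != 0]).

End smooth.

Definition frac_part (x : R) : R := x - (Num.floor x)%:~R.

(* A sequence (theta_n)_(n >= 1) is a function on nat whose value at 0 is
   never used. *)
Implicit Type theta : nat -> R.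

Definition distinct_tuples (k N : nat) : {set k.-tuple 'I_N.+1} :=
  [set x : k.-tuple 'I_N.+1 | uniq x & all (fun j : 'I_N.+1 => 0 < j)%N x].

Definition Delta (k N : nat) (x : k.-tuple 'I_N.+1) theta : 'rV[R]_k.-1 :=
  \row_(i < k.-1) (theta (nth ord0 x i) - theta (nth ord0 x i.+1)).

(* The sum over m is a finitely supported sum: for a compactly supported f and
   N > 0 only finitely many terms are nonzero. *)
Definition correlation_sum (k : nat) (f : 'rV[R]_k.-1 -> R) theta (N : nat) :
    R :=
  N%:R^-1 * \sum_(x in distinct_tuples k N)
    \sum_(m \in [set: 'rV[int]_k.-1])
      f (N%:R *: (Delta x theta - map_mx intr m)).

Definition poissonian_correlation (k : nat) theta :=
  forall f : 'rV[R]_k.-1 -> R, smooth f -> compactly_supported f ->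
    correlation_sum f theta N @[N --> \oo] --> integral_Rn f.

End correlation.

(* Main.v *)
(* Cut the circle into K = L N' cells, with soft indicators forming a smooth
   partition of unity built from the kernel cos^(2D)(pi t). A product of soft cells
   evaluated at powers of x expands into functions cos(2 pi P(x)) with P a sparse
   polynomial with integer coefficients; on [a, b] with a > 1 the integral of such a
   function is exponentially small in deg P. Hence the powers x^n with n large behave
   in mean like independent uniform points on the circle, and the number of k-tuples
   of distinct indices at most N falling into a prescribed pattern of cells has
   relative variance O(j^-2) along N' = j^(2k+2). These variances are summable, so the
   counts converge to their means almost everywhere along this sparse sequence, and
   for all N because the counts increase with N and consecutive lengths N' are
   asymptotically equivalent. Finally, up to a small error the k-point correlation sum
   of a test function f is a combination of such counts, weighted by the values of f
   on a grid of mesh 1/L, so its limit is a Riemann sum of f. *)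

(* The obstacle is that the coefficients of the phases [P] are as large as a power of the number of
   cells, and that lower terms may spoil the size of [P']. Two facts help: a nonzero integer leading
   coefficient is at least 1 in absolute value, and [P] has boundedly many terms, so that [x P'] is
   comparable to its leading term outside boundedly many short intervals. The factor [a ^- d], with
   [d] at least a small power of the length, then beats every power of the length. The kernel is
   chosen because it is a nonnegative trigonometric polynomial: its expansion is finite, equidistant
   translates sum exactly to a constant, and it decays exponentially off the integers when its
   degree is well above the square of the number of cells. Indices below [j] are not decoupled at
   all but estimated trivially. This costs a factor of order [j] for each of the [2 k] points of a
   pair of tuples, hence a relative variance of order [j ^ (2 k) / N']; this is the origin of the
   exponent [2 k + 2]. *)
Require Import Defs.
From HB Require Import structures.
From mathcomp Require Import all_boot all_order all_algebra.
From mathcomp Require Import all_classical all_reals all_analysis.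
From mathcomp Require Import measurable_realfun.
From mathcomp Require Import ring lra zify.
Set Implicit Arguments.
Unset Strict Implicit.
Unset Printing Implicit Defensive.
Import Order.TTheory GRing.Theory Num.Theory.
Import numFieldNormedType.Exports.
Local Open Scope classical_set_scope.
Local Open Scope ring_scope.

(** * Oscillatory integrals of sparse polynomials *)

Section sparse_polynomials.
Context {R : realType}.
Implicit Types (P : {poly R}) (a b c eta u v x z : R) (d n : nat).

Let euler n P : {poly R} := 'X * P^`() - n%:R *: P.

Let euler_coef n P i : (euler n P)`_i = (i%:R - n%:R) * P`_i.
Proof.
rewrite /euler coefB coefXM coefZ coef_deriv mulrBl.
case: i => [|i] /=; first by rewrite mul0r.
by congr (_ - _); rewrite mulr_natl.
Qed.

(** For [g = P / x ^ n] and [e = d - n], [g' = euler n P / x ^ (n + 1) >= c x ^ (e - 1)]. Hence [g]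
    increases at least as fast as [(c / d) x ^ e]: it changes sign at most once, at [z], and is
    large at distance [eta] from [z]. *)
Let euler_growth n P d c a b eta u v :
  (n < d)%N -> 1 <= a -> 0 < eta -> 0 <= c -> a <= u -> u <= v -> v <= b ->
  (forall x, u <= x <= v -> c * x ^+ d <= (euler n P).[x]) ->
  exists2 z, u <= z <= v & forall x, u <= x <= v -> eta <= `|x - z| ->
    c * (eta / (d%:R * b)) * x ^+ d <= `|P.[x]|.
Proof.
move=> nd a1 eta0 c0 au uv vb cT.
have u0 : 0 < u by lra.
have d0 : (0 < d)%N by exact: leq_ltn_trans nd.
pose e := (d - n)%N.
have e0 : (0 < e)%N by rewrite subn_gt0.
have dE : d = (e + n)%N by rewrite subnK// ltnW.
pose g x := P.[x] * ('X^n : {poly R}).[x]^-1.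
(* [F' >= c (1 - e / d) x ^ (e - 1) >= 0], because [e <= d]. *)
pose F x := g x - c / d%:R * ('X^e : {poly R}).[x].
have gE x : g x = P.[x] / x ^+ n by rewrite /g hornerXn.
have Fmono x y : u <= x -> x <= y -> y <= v -> F x <= F y.
  move=> ux xy yv.
  pose dF z := P^`().[z] * ('X^n : {poly R}).[z]^-1
     + P.[z] * (- ('X^n : {poly R}).[z] ^- 2 * ('X^n : {poly R})^`().[z])
     - c / d%:R * ('X^e : {poly R})^`().[z].
  have dFE z : 0 < z -> is_derive z 1 F (dF z).
    move=> z0.
    have zn0 : ('X^n : {poly R}).[z] != 0 by rewrite hornerXn expf_neq0// gt_eqF.
    have h1 := is_derive_poly ('X^n) z.
    have h2 := is_deriveV zn0 h1.
    have h3 := is_derive_poly P z.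
    have h4 := is_derive_poly ('X^e) z.
    have h5 := is_deriveM h3 h2.
    have h6 := is_deriveB h5 (is_deriveZ (c / d%:R) h4).
    have {}h6 : is_derive z 1 F _ := h6.
    by apply: (is_derive_eq h6); rewrite /dF /= /GRing.scale/=; ring.
  have cF : {within `[x, y], continuous F}.
    apply: derivable_within_continuous => z /[!in_itv]/= /andP[xz zy].
    by apply: ex_derive; apply: dFE; lra.
  have [|z /[!in_itv]/= /andP[xz zy] FE] := @MVT_segment R F dF x y xy _ cF.
    by move=> z /[!in_itv]/= /andP[xz zy]; apply: dFE; lra.
  rewrite -subr_ge0 FE mulr_ge0 ?(subr_ge0 x y)// /dF.
  have z0 : 0 < z by lra.
  have := cT z; rewrite (_ : u <= z <= v); last by lra.
  move=> /(_ isT); rewrite /euler hornerD hornerN hornerZ hornerM hornerX => cTz.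
  rewrite !hornerXn !derivXn !hornerMn !hornerXn.
  have -> : P^`().[z] / z ^+ n + P.[z] * (- z ^+ n ^- 2 * (z ^+ n.-1 *+ n)) -
     c / d%:R * (z ^+ e.-1 *+ e) =
     ((z * P^`().[z] - n%:R * P.[z]) - c * (e%:R / d%:R) * z ^+ d) / z ^+ n.+1.
    have dR : d%:R != 0 :> R by rewrite pnatr_eq0 -lt0n.
    have Zn i : z ^+ i != 0 by rewrite expf_neq0// gt_eqF.
    have -> : z ^+ d = z * z ^+ e.-1 * z ^+ n by rewrite -exprS prednK// -exprD -dE.
    case: (n) => [|n'] /=.
      rewrite !mulr0n !expr0 !mulr0 addr0 expr1 -(mulr_natr (z ^+ e.-1)).
      by move: (e%:R) (d%:R) dR => E D dR; field; rewrite dR gt_eqF.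
    rewrite !(exprS _ n'.+1) !(exprS _ n') -(mulr_natr (z ^+ e.-1)) -(mulr_natr (z ^+ n')).
    move: (e%:R) (d%:R) dR (n'.+1%:R) (z ^+ n') (Zn n') (z ^+ e.-1) => E D dR N Z Z0 Y.
    by field; rewrite dR Z0 gt_eqF.
  rewrite divr_ge0 ?exprn_ge0// ?(ltW z0)// subr_ge0 (le_trans _ cTz)//.
  rewrite ler_wpM2r ?exprn_ge0 ?(ltW z0)// ler_piMr//.
  by rewrite ler_pdivrMr ?ltr0n// mul1r ler_nat dE leq_addr.
have gmono x y : u <= x -> x <= y -> y <= v ->
    c / d%:R * (y ^+ e - x ^+ e) <= g y - g x.
  by move=> ux xy yv; have := Fmono x y ux xy yv; rewrite /F !hornerXn; lra.
(* One factor of [x ^ e] is traded for [b]. Two versions are needed, with the power at either end of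
   the interval, since the point where [P] is estimated lies on either side of [z]. *)
have powB x y : 0 < x -> x <= y -> y <= b -> x ^+ e * (y - x) / b <= y ^+ e - x ^+ e.
  move=> x0 xy yb.
  have -> : y ^+ e = y ^+ e.-1 * y by rewrite -exprSr prednK.
  have xe : x ^+ e = x ^+ e.-1 * x by rewrite -exprSr prednK.
  have le1 : x ^+ e.-1 * y <= y ^+ e.-1 * y.
    by rewrite ler_wpM2r//; [lra | rewrite lerXn2r// nnegrE; lra].
  apply: (@le_trans _ _ (x ^+ e.-1 * (y - x))); last by rewrite xe; lra.
  rewrite xe ler_pdivrMr; last by lra.
  rewrite -!mulrA ler_wpM2l ?exprn_ge0//; first by lra.
  by nra.
have powB' x y : 0 < x -> x <= y -> y <= b -> y ^+ e * (y - x) / b <= y ^+ e - x ^+ e.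
  move=> x0 xy yb.
  have ye : y ^+ e = y ^+ e.-1 * y by rewrite -exprSr prednK.
  have xe : x ^+ e = x ^+ e.-1 * x by rewrite -exprSr prednK.
  have le1 : x ^+ e.-1 * x <= y ^+ e.-1 * x.
    by rewrite ler_wpM2r//; [lra | rewrite lerXn2r// nnegrE; lra].
  apply: (@le_trans _ _ (y ^+ e.-1 * (y - x))); last by rewrite xe ye; lra.
  rewrite ye ler_pdivrMr; last by lra.
  rewrite -!mulrA ler_wpM2l ?exprn_ge0//; first by lra.
  by nra.
have cg : {within `[u, v], continuous g}.
  apply: derivable_within_continuous => z /[!in_itv]/= /andP[xz zy].
  have zn0 : ('X^n : {poly R}).[z] != 0 by rewrite hornerXn expf_neq0// gt_eqF//; lra.
  have h1 := is_derive_poly ('X^n) z.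
  have h2 := is_deriveV zn0 h1.
  have h3 := is_derive_poly P z.
  by apply: ex_derive; exact: (is_deriveM h3 h2).
(* If [g] has constant sign, [z] is the endpoint where [g] is closest to zero, and the condition on
   the outer side is void. *)
have [z zuv [zl zr]] : exists2 z, u <= z <= v &
    (z < v -> 0 <= g z) /\ (u < z -> g z <= 0).
  have [gu|gu] := leP 0 (g u).
    by exists u; [rewrite lexx uv|split => //; rewrite ltxx].
  have [gv|gv] := leP (g v) 0.
    by exists v; [rewrite lexx uv|split => //; rewrite ltxx].
  have [|z zuv gz] := IVT (v := 0) uv cg.
    by rewrite ge_min (ltW gu)/= le_max (ltW gv) orbT.
  by exists z; [move: zuv; rewrite in_itv|rewrite gz lexx].
exists z => // x xuv xz.
have x0 : 0 < x by lra.
have gx : c * (eta / (d%:R * b)) * x ^+ e <= `|g x|.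
  have key t : eta <= t -> c * (eta / (d%:R * b)) * x ^+ e <= c / d%:R * (x ^+ e * t / b).
    move=> et.
    have -> : c * (eta / (d%:R * b)) * x ^+ e = c / d%:R * (x ^+ e * eta / b).
      by field; rewrite ?gt_eqF ?ltr0n//; lra.
    rewrite ler_wpM2l ?divr_ge0 ?ler0n// ler_wpM2r ?invr_ge0//; first by lra.
    by rewrite ler_wpM2l// exprn_ge0// ltW.
  have [zx|xz'] := leP z x.
    rewrite ger0_norm ?subr_ge0// in xz.
    apply: (le_trans (key _ xz)).
    apply: (@le_trans _ _ (c / d%:R * (x ^+ e - z ^+ e))).
      by rewrite ler_wpM2l ?divr_ge0 ?ler0n// powB'//; lra.
    have := gmono z x; case/andP: zuv => uz zv; case/andP: xuv => ux xv.
    move=> /(_ uz zx xv); have := zl; have := ler_norm (g x).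
    have : z < v by lra.
    by move=> zv' ? /(_ zv') ?; lra.
  rewrite ltr0_norm ?subr_lt0// opprB in xz.
  apply: (le_trans (key _ xz)).
  apply: (@le_trans _ _ (c / d%:R * (z ^+ e - x ^+ e))).
    by rewrite ler_wpM2l ?divr_ge0 ?ler0n// powB//; lra.
  have := gmono x z; case/andP: zuv => uz zv; case/andP: xuv => ux xv.
  move=> /(_ ux (ltW xz') zv); have := zr; have := ler_norm (- g x); rewrite normrN.
  have : u < z by lra.
  by move=> zv' ? /(_ zv') ?; lra.
have -> : P.[x] = g x * x ^+ n by rewrite gE mulfVK// expf_neq0// gt_eqF.
rewrite normrM (ger0_norm (exprn_ge0 _ (ltW x0))) dE exprD mulrA ler_wpM2r//.
  by rewrite exprn_ge0// ltW.
by rewrite -dE.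
Qed.

(** The lower bound keeps [euler n P] away from zero, so its sign is constant by the intermediate
    value theorem; the negative case is the positive one for [- P]. *)
Let euler_dichotomy n P d c a b eta u v :
  (n < d)%N -> 1 <= a -> 0 < eta -> 0 < c -> a <= u -> u <= v -> v <= b ->
  (forall x, u <= x <= v -> c * x ^+ d <= `|(euler n P).[x]|) ->
  exists2 z, u <= z <= v & forall x, u <= x <= v -> eta <= `|x - z| ->
    c * (eta / (d%:R * b)) * x ^+ d <= `|P.[x]|.
Proof.
move=> nd a1 eta0 c0 au uv vb cT.
have pos x : u <= x <= v -> 0 < c * x ^+ d.
  by move=> xuv; rewrite mulr_gt0// exprn_gt0//; lra.
have [Tp|] := pselect (forall x, u <= x <= v -> 0 <= (euler n P).[x]).
  apply: (@euler_growth n P d c a b eta u v) => //; first exact: ltW.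
  by move=> x xuv; have := cT x xuv; rewrite ger0_norm// Tp.
move=> /existsNP[y /not_implyP[yuv /negP]]; rewrite -ltNge => Ty.
have Tn x : u <= x <= v -> (euler n P).[x] <= 0.
  move=> xuv; rewrite leNgt; apply/negP => Tx.
  have cont A : {within A, continuous (horner (euler n P))}.
    by apply: continuous_subspaceT; exact: continuous_horner.
  have [z zuv Tz] : exists2 z, u <= z <= v & (euler n P).[z] = 0.
    have [xy|yx] := leP x y.
      have [|z] := IVT (v := 0) xy (cont _).
        by rewrite ge_min (ltW Ty) orbT le_max (ltW Tx).
      by rewrite in_itv/= => ? ?; exists z => //; lra.
    have [|z] := IVT (v := 0) (ltW yx) (cont _).
      by rewrite ge_min (ltW Ty) /= le_max (ltW Tx) orbT.
    by rewrite in_itv/= => ? ?; exists z => //; lra.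
  by have := cT z zuv; rewrite Tz normr0 leNgt pos.
have eulerN : euler n (- P) = - euler n P.
  by rewrite /euler derivN scalerN mulrN opprB opprK addrC.
have [||z zuv Hz] := @euler_growth n (- P) d c a b eta u v nd a1 eta0 _ au uv vb.
- exact: ltW.
- by move=> x xuv; rewrite eulerN hornerN; have := cT x xuv; rewrite ler0_norm// Tn.
by exists z => // x xuv xz; have := Hz x xuv xz; rewrite hornerN normrN.
Qed.

(* Applied with [W u v] the absolute value of an integral over [u, v]: outside a
   set of small length, a sparse polynomial is comparable to its leading term.
   Induction on the number of lower terms: the operator [x P' - n P] kills the
   term of degree [n], and is [x ^ (n + 1)] times the derivative of [P / x ^ n]. *)
Lemma sparse_poly_splitting (W : R -> R -> R) a b eta d :
  1 <= a -> 0 < eta ->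
  (forall u v, a <= u -> u <= v -> v <= b -> W u v <= v - u) ->
  (forall u t v, a <= u -> u <= t -> t <= v -> v <= b -> W u v <= W u t + W t v) ->
  forall (s : seq nat), all (fun n => n < d)%N s ->
  forall P w, 0 <= w -> 1 <= `|P`_d| -> (forall i, P`_i != 0 -> (i == d) || (i \in s)) ->
  forall u v, a <= u -> u <= v -> v <= b ->
  (forall u' v', u <= u' -> u' <= v' -> v' <= v ->
    (forall x, u' <= x <= v' -> (eta / (d%:R * b)) ^+ size s * x ^+ d <= `|P.[x]|) ->
    W u' v' <= w) ->
  W u v <= 2 ^+ size s * w + (2 ^+ size s - 1) * (2 * eta).
Proof.
move=> a1 eta0 Wlen Wadd; elim=> [|n s IH] /= => [_|/andP[nd sd]].
  move=> P w w0 Pd supp u v au uv vb HW.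
  rewrite expr0 mul1r subrr mul0r addr0; apply: HW => // x xuv.
  rewrite expr0 mul1r.
  have -> : P = P`_d *: 'X^d.
    apply/polyP => i; rewrite coefZ coefXn.
    have [->|id] := eqVneq i d; first by rewrite mulr1.
    rewrite mulr0; apply/eqP/negPn/negP => /supp.
    by rewrite (negbTE id) in_nil.
  have xd0 : 0 <= x ^+ d by rewrite exprn_ge0//; lra.
  by rewrite hornerZ hornerXn normrM (ger0_norm xd0) ler_peMl.
move=> P w w0 Pd supp u v au uv vb HW.
have b0 : 0 < b by lra.
have dlt0 : 0 < eta / (d%:R * b).
  by rewrite divr_gt0// mulr_gt0// ltr0n; exact: leq_ltn_trans nd.
(* One more lower term replaces the bound [w] by [2 * w + 2 * eta]: two outer pieces, and a window
   of length at most [2 * eta] around the exceptional point. *)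
have -> : 2 ^+ (size s).+1 * w + (2 ^+ (size s).+1 - 1) * (2 * eta) =
    2 ^+ (size s) * (2 * w + 2 * eta) + (2 ^+ (size s) - 1) * (2 * eta).
  by rewrite exprS; ring.
apply: (IH sd (euler n P)) => //.
- by lra.
- rewrite euler_coef normrM -natrB; last exact: ltnW.
  rewrite (le_trans Pd)// ler_peMl// normr_nat ler1n subn_gt0//.
- move=> i; rewrite euler_coef mulf_eq0 negb_or => /andP[inn /supp].
  rewrite inE; case: (i == d) => //=; case/orP => // /eqP ein.
  by move: inn; rewrite ein subrr eqxx.
move=> u1 v1 uu1 u1v1 v1v H1.
have [||||z zuv Hz] := @euler_dichotomy n P d _ a b eta u1 v1 nd a1 eta0 _ _ _ _ H1.
- by rewrite exprn_gt0.
- by lra.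
- by lra.
- by lra.
pose z1 := Num.max u1 (z - eta); pose z2 := Num.min v1 (z + eta).
have z1u : u1 <= z1 by rewrite le_max lexx.
have z2v : z2 <= v1 by rewrite ge_min lexx.
have z1z : z1 <= z by rewrite ge_max; lra.
have zz2 : z <= z2 by rewrite le_min; lra.
have z12 : z2 - z1 <= 2 * eta.
  have : z - eta <= z1 by rewrite le_max lexx orbT.
  have : z2 <= z + eta by rewrite ge_min lexx orbT.
  by lra.
have Wl : W u1 z1 <= w.
  have [h|h] := leP (z - eta) u1.
    have -> : z1 = u1 by rewrite /z1 max_l.
    by apply: (le_trans (Wlen u1 u1 _ _ _)); lra.
  have z1E : z1 = z - eta by rewrite /z1 max_r// ltW.
  apply: HW; [exact: uu1|exact: z1u|by apply: (le_trans z1z); lra|].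
  move=> x xuv; have := Hz x; rewrite exprSr; apply; first by lra.
  by rewrite ler0_norm; lra.
have Wr : W z2 v1 <= w.
  have [h|h] := leP v1 (z + eta).
    have -> : z2 = v1 by rewrite /z2 min_l.
    by apply: (le_trans (Wlen v1 v1 _ _ _)); lra.
  have z2E : z2 = z + eta by rewrite /z2 min_r// ltW.
  apply: HW; [by apply: le_trans zz2; lra|exact: z2v|exact: v1v|].
  move=> x xuv; have := Hz x; rewrite exprSr; apply; first by lra.
  by rewrite ger0_norm; lra.
have h1 : W u1 v1 <= W u1 z1 + W z1 v1 by apply: Wadd; lra.
have h2 : W z1 v1 <= W z1 z2 + W z2 v1 by apply: Wadd; lra.
have h3 : W z1 z2 <= z2 - z1 by apply: Wlen; lra.
by lra.
Qed.

End sparse_polynomials.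

Section oscillatory_integral.
Context {R : realType}.
Notation mu := (@lebesgue_measure R).
Implicit Types (P Q : {poly R}) (a b c eta u v x z : R) (d n : nat) (f F : R -> R).

Lemma within_continuous_integrable u v f : {within `[u, v], continuous f} ->
  mu.-integrable `[u, v] (EFin \o f).
Proof. by apply: continuous_compact_integrable; exact: segment_compact. Qed.

Lemma continuous_integrable u v f : continuous f ->
  mu.-integrable `[u, v] (EFin \o f).
Proof. by move=> cf; apply: within_continuous_integrable; exact: continuous_subspaceT. Qed.

Lemma fine_lebesgue_itvcc u v : u <= v -> fine (mu `[u, v]) = v - u.
Proof.
rewrite lebesgue_measure_itv/= lte_fin le_eqVlt => /predU1P[->|->//].
by rewrite ltxx subrr.
Qed.

Lemma Rintegral_is_derive u v f F : u <= v ->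
  (forall x, u <= x <= v -> is_derive x 1 F (f x)) ->
  {within `[u, v], continuous f} ->
  \int[mu]_(x in `[u, v]) f x = F v - F u.
Proof.
rewrite le_eqVlt => /predU1P[<- _ _|uv dF cf].
  by rewrite set_itv1 Rintegral_set1 subrr.
have cF : {within `[u, v], continuous F}.
  apply: derivable_within_continuous => x /[!in_itv]/= xuv.
  by apply: ex_derive; apply: dF.
have /(continuous_within_itvP _ uv) [_ cu cv] := cF.
rewrite /Rintegral (@continuous_FTC2 _ f F)//=.
- split=> // x /[!in_itv]/= /andP[ux xv].
  by have := dF x; rewrite !ltW// => /(_ isT) ?; exact: ex_derive.
- move=> x /[!in_itv]/= /andP[ux xv].
  by have := dF x; rewrite !ltW// => /(_ isT) ?; rewrite derive1E derive_val.
Qed.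

Lemma le_norm_Rintegral u v f c : u <= v -> {within `[u, v], continuous f} ->
  (forall x, u <= x <= v -> `|f x| <= c) ->
  `|\int[mu]_(x in `[u, v]) f x| <= c * (v - u).
Proof.
move=> uv cf fc; have intf := within_continuous_integrable cf.
apply: (le_trans (le_normr_Rintegral _ intf)) => //.
have -> : c * (v - u) = \int[mu]_(x in `[u, v]) (cst c x).
  by rewrite Rintegral_cst// fine_lebesgue_itvcc.
apply: le_Rintegral => //=.
- exact: (integrable_norm intf).
- by apply: (@continuous_integrable u v (cst c)) => x; exact: cvg_cst.
Qed.

(* First derivative test, integrating by parts: [cos Q] is the derivative of
   [sin Q / Q'] up to [sin Q * Q'' / Q'^2]. *)
Lemma cos_integral_parts Q u v c1 c2 : u <= v ->
  (forall x, u <= x <= v -> Q^`().[x] != 0) ->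
  (forall x, u <= x <= v -> `|Q^`().[x]|^-1 <= c1) ->
  (forall x, u <= x <= v -> `|Q^`()^`().[x]| / `|Q^`().[x]| ^+ 2 <= c2) ->
  `|\int[mu]_(x in `[u, v]) cos Q.[x]| <= 2 * c1 + c2 * (v - u).
Proof.
move=> uv Q0 Q1 Q2.
pose g x := sin Q.[x] * (Q^`()^`().[x] / Q^`().[x] ^+ 2).
pose f x := cos Q.[x] - g x.
pose F x := sin Q.[x] * Q^`().[x]^-1.
have dV x : u <= x <= v -> is_derive x 1 (fun y => Q^`().[y]^-1)
    (- Q^`().[x] ^- 2 *: Q^`()^`().[x]).
  by move=> xuv; apply: is_deriveV; exact: Q0.
have dsin x : is_derive x 1 (fun y => sin Q.[y]) (cos Q.[x] * Q^`().[x]).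
  by apply: is_derive1_comp.
have dF x : u <= x <= v -> is_derive x 1 F (f x).
  move=> xuv; have h := is_deriveM (dsin x) (dV x xuv).
  have {}h : is_derive x 1 F _ := h.
  apply: (is_derive_eq h); rewrite /f /g /GRing.scale/=.
  by have := Q0 x xuv; move=> ?; field.
have ccos : continuous (fun x => cos Q.[x]).
  by move=> x; apply: continuous_comp; [exact: continuous_horner|exact: continuous_cos].
have csin : continuous (fun x => sin Q.[x]).
  by move=> x; apply: continuous_comp; [exact: continuous_horner|exact: continuous_sin].
have cg : {within `[u, v], continuous g}.
  apply: derivable_within_continuous => x /[!in_itv]/= xuv.
  have h1 := is_deriveM (dV x xuv) (dV x xuv).
  have h2 := is_deriveM (is_derive_poly Q^`()^`() x) h1.
  have h3 := is_deriveM (dsin x) h2.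
  rewrite (_ : g = (fun y => sin Q.[y]) * (horner Q^`()^`() *
     ((fun y => Q^`().[y]^-1) * (fun y => Q^`().[y]^-1)))).
    by apply: ex_derive; exact: h3.
  by apply/funext => y; rewrite /g !fctE expr2 invfM.
have cf : {within `[u, v], continuous f}.
  by move=> x; apply: cvgB; [exact: (continuous_subspaceT ccos)|exact: cg].
have -> : \int[mu]_(x in `[u, v]) cos Q.[x] =
    \int[mu]_(x in `[u, v]) f x + \int[mu]_(x in `[u, v]) g x.
  rewrite -RintegralD//; try exact: within_continuous_integrable.
  by apply: eq_Rintegral => x _; rewrite /f subrK.
rewrite (Rintegral_is_derive uv dF cf).
apply: (le_trans (ler_normD _ _)); apply: lerD.
  have F1 x : u <= x <= v -> `|F x| <= c1.
    move=> xuv; apply: le_trans (Q1 x xuv).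
    by rewrite normrM normfV ler_piMl ?invr_ge0// ler_norml sin_geN1 sin_le1.
  have Fu : `|F u| <= c1 by apply: F1; lra.
  have Fv : `|F v| <= c1 by apply: F1; lra.
  by apply: (le_trans (ler_normB _ _)); lra.
apply: le_norm_Rintegral => // x xuv; apply: le_trans (Q2 x xuv).
rewrite /g normrM normrM normfV normrX ler_piMl//.
by rewrite ler_norml sin_geN1 sin_le1.
Qed.

End oscillatory_integral.

Section sparse_oscillatory_integral.
Context {R : realType}.
Notation mu := (@lebesgue_measure R).
Implicit Types (P Q : {poly R}) (a b c eta u v x z : R) (d n : nat) (f F : R -> R).

Lemma Rintegral_itvcc_split u t v f : continuous f -> u <= t -> t <= v ->
  \int[mu]_(x in `[u, v]) f x =
  \int[mu]_(x in `[u, t]) f x + \int[mu]_(x in `[t, v]) f x.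
Proof.
move=> cf ut tv; have intf := @continuous_integrable R u v f cf.
have := @Rintegral_itvB R f (BLeft u) (BRight v) t intf.
rewrite !bnd_simp => /(_ ut tv) h.
rewrite -(@Rintegral_itv_obnd_cbnd R t (BRight v)); last first.
  apply: integrableS intf => //; apply: subset_itvr; rewrite bnd_simp//.
by rewrite -h addrC subrK.
Qed.

Lemma norm_deriv2_le P d c x : (forall i, `|P`_i| <= c) -> (size P <= d.+1)%N -> 1 <= x ->
  `|P^`()^`().[x]| <= d%:R ^+ 3 * c * x ^+ d.
Proof.
move=> Pc sP x1; have c0 : 0 <= c by apply: le_trans (Pc 0%N).
rewrite horner_coef; apply: (le_trans (ler_norm_sum _ _ _)).
have sP' : (size P^`()^`() <= d)%N.
  have h (p : {poly R}) : (size p^`() <= (size p).-1)%N by exact: size_poly.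
  by have := h P; have := h P^`(); move: sP; lia.
apply: (@le_trans _ _ (\sum_(i < size P^`()^`()) d%:R ^+ 2 * c * x ^+ d)).
  apply: ler_sum => i _; rewrite normrM normrX (ger0_norm (le_trans ler01 x1)).
  have id : (i < d)%N by apply: leq_trans sP'.
  apply: ler_pM; [by []|by rewrite exprn_ge0//; lra| |by rewrite ler_weXn2l// ltnW].
  rewrite !coef_deriv !normrMn -mulrnA.
  have [Pi|Pi] := leqP (size P) i.+2.
    rewrite nth_default// normr0 mul0rn.
    by rewrite mulr_ge0// exprn_ge0.
  rewrite -[leLHS]mulr_natl; apply: ler_pM => //; rewrite expr2 -natrM ler_nat.
  by rewrite leq_mul//; have := leq_trans Pi sP; lia.
rewrite sumr_const card_ord -[X in X <= _]mulr_natl.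
have -> : d%:R ^+ 3 * c * x ^+ d = d%:R * (d%:R ^+ 2 * c * x ^+ d) by rewrite exprS; ring.
rewrite ler_wpM2r ?ler_nat// !mulr_ge0 ?exprn_ge0//.
by lra.
Qed.

(** The splitting is applied to [x P'] instead of [P]: where it is comparable to its leading term,
    the derivative of the phase is bounded below by a multiple of [x ^ (d - 1)], and the first
    derivative test yields the factor [a ^- d]. The summand [2 * eta] pays for the exceptional
    windows. *)
Lemma cos_sparse_poly_integral P a b eta c beta (s : seq nat) d :
  1 <= a -> a <= b -> 0 < eta -> eta <= 1 -> (0 < d)%N ->
  all (fun n => n < d)%N s -> 1 <= `|P`_d| ->
  (forall i, P`_i != 0 -> (i == d) || (i \in s)) -> (forall i, `|P`_i| <= c) ->
  `|\int[mu]_(x in `[a, b]) cos (2 * pi * P.[x] + beta)| <=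
  2 ^+ size s * ((2 * b + (b - a) * (d%:R ^+ 3 * c * b ^+ 2)) *
    (d%:R * b / eta) ^+ (2 * size s) * a ^- d + 2 * eta).
Proof.
move=> a1 ab eta0 eta1 d0 sd Pd supp Pc.
have c0 : 0 <= c by apply: le_trans (Pc 0%N).
pose Q := (2 * pi) *: P + beta%:P.
have QE x : Q.[x] = 2 * pi * P.[x] + beta by rewrite /Q !hornerE.
have dQ : Q^`() = (2 * pi) *: P^`() by rewrite /Q derivD derivZ derivC addr0.
have dQ2 : Q^`()^`() = (2 * pi) *: P^`()^`() by rewrite dQ derivZ.
have ccos : continuous (fun x => cos Q.[x]).
  by move=> x; apply: continuous_comp; [exact: continuous_horner|exact: continuous_cos].
under eq_Rintegral do rewrite -QE.
pose W u v := `|\int[mu]_(x in `[u, v]) cos Q.[x]|.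
pose T : {poly R} := 'X * P^`().
have Tcoef i : T`_i = i%:R * P`_i.
  rewrite /T coefXM coef_deriv; case: i => [|i] /=; first by rewrite mul0r.
  by rewrite mulr_natl.
have Wlen u v : a <= u -> u <= v -> v <= b -> W u v <= v - u.
  move=> au uv vb; rewrite -[leRHS]mul1r; apply: le_norm_Rintegral => //.
    exact: continuous_subspaceT.
  by move=> x _; rewrite ler_norml cos_geN1 cos_le1.
have Wadd u t v : a <= u -> u <= t -> t <= v -> v <= b -> W u v <= W u t + W t v.
  move=> au ut tv vb; rewrite /W (Rintegral_itvcc_split ccos ut tv).
  exact: ler_normD.
have dR0 : 0 < d%:R :> R by rewrite ltr0n.
have dR1 : 1 <= d%:R :> R by rewrite ler1n.
pose q := size s; pose dl := eta / (d%:R * b).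
have dl0 : 0 < dl by rewrite /dl divr_gt0// mulr_gt0//; lra.
have dlV : dl^-1 = d%:R * b / eta by rewrite /dl invf_div.
have dlV1 : 1 <= dl^-1 by rewrite dlV ler_pdivlMr// mul1r; nra.
set w := (_ * _ * _).
have w0 : 0 <= w.
  rewrite /w !mulr_ge0//.
  - apply: addr_ge0; first by lra.
    by rewrite !mulr_ge0// ?exprn_ge0//; lra.
  - by rewrite exprn_ge0// -dlV invr_ge0 ltW.
  - by rewrite invr_ge0 exprn_ge0//; lra.
have := @sparse_poly_splitting R W a b eta d a1 eta0 Wlen Wadd s sd T w w0.
rewrite -/q -/dl => /(_ _ _ a b (lexx a) ab (lexx b)) H.
have {}H : W a b <= 2 ^+ q * w + (2 ^+ q - 1) * (2 * eta); last first.
  apply: (le_trans H); rewrite mulrDr lerD2l ler_wpM2r//; last by lra.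
  by lra.
apply: H.
- by rewrite Tcoef normrM normr_nat -[leLHS]mulr1 ler_pM.
- by move=> i; rewrite Tcoef mulf_eq0 negb_or => /andP[_]; exact: supp.
move=> u v au uv vb good.
have pi1 : 1 <= 2 * pi :> R by have := @pi_ge2 R; lra.
have sP : (size P <= d.+1)%N.
  apply/leq_sizeP => i di; apply/eqP/negPn/negP => /supp/orP[/eqP ei|].
    by rewrite ei ltnn in di.
  by move/(allP sd); rewrite ltnNge ltnW.
have lower x : u <= x <= v -> dl ^+ q * x ^+ d <= x * `|P^`().[x]|.
  move=> xuv; have := good x xuv.
  by rewrite /T hornerM hornerX normrM (ger0_norm (_ : 0 <= x))//; lra.
have dlq0 : 0 < dl ^+ q by rewrite exprn_gt0.
have P'0 x : u <= x <= v -> 0 < `|P^`().[x]|.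
  move=> xuv; have x0 : 0 < x by lra.
  rewrite -(pmulr_rgt0 _ x0); apply: lt_le_trans (lower x xuv).
  by rewrite mulr_gt0// exprn_gt0.
have apow x : u <= x <= v -> x ^- d <= a ^- d.
  move=> xuv; rewrite lef_pV2 ?posrE ?exprn_gt0//; try lra.
  by rewrite lerXn2r// ?nnegrE; lra.
have inv x : u <= x <= v -> `|P^`().[x]|^-1 <= b * dl ^- q * x ^- d.
  move=> xuv; have x0 : 0 < x by lra.
  have := lower x xuv; have := P'0 x xuv; move: `|_| => p p0 low.
  have D0 : 0 < dl ^+ q * x ^+ d by rewrite mulr_gt0// exprn_gt0.
  rewrite -mulrA -invfM; apply: (@le_trans _ _ (x / (dl ^+ q * x ^+ d))).
    by rewrite -[leLHS]mul1r ler_pdivrMr// mulrAC ler_pdivlMr// mul1r.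
  by rewrite ler_wpM2r ?invr_ge0 ?(ltW D0)//; lra.
have invsq x : u <= x <= v -> `|P^`().[x]|^-1 ^+ 2 <= b ^+ 2 * dl ^- (2 * q) * x ^- (2 * d).
  move=> xuv; have h := inv x xuv.
  have -> : b ^+ 2 * dl ^- (2 * q) * x ^- (2 * d) = (b * dl ^- q * x ^- d) ^+ 2.
    by move: (dl) => D; rewrite (mulnC 2%N q) (mulnC 2%N d) !exprM !exprMn !exprVn.
  have h0 : 0 <= `|P^`().[x]|^-1 by rewrite invr_ge0.
  by rewrite lerXn2r// ?nnegrE// (le_trans h0 h).
have dlVq n : 0 <= dl ^- n by rewrite invr_ge0 exprn_ge0// ltW.
have an0 : 0 <= a ^- d by rewrite invr_ge0 exprn_ge0//; lra.
(* The exponent is [2 * q], although [inv] gives [q], so that [c1] and [c2] share the factor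
   [dl ^- (2 * q) * a ^- d] of [w]. *)
pose c1 := b * dl ^- (2 * q) * a ^- d.
pose c2 := d%:R ^+ 3 * c * b ^+ 2 * dl ^- (2 * q) * a ^- d.
have c20 : 0 <= c2.
  by rewrite /c2 !mulr_ge0// ?exprn_ge0//; lra.
have -> : w = 2 * c1 + c2 * (b - a).
  by rewrite /w /c1 /c2 -dlV exprVn; ring.
apply: (@le_trans _ _ (2 * c1 + c2 * (v - u))); last first.
  by rewrite lerD2l ler_wpM2l//; lra.
apply: cos_integral_parts => //.
- move=> x xuv; rewrite dQ hornerZ mulf_neq0//; first by lra.
  by rewrite -normr_gt0 P'0.
- move=> x xuv; rewrite dQ hornerZ normrM invfM (ger0_norm (_ : 0 <= 2 * pi)); last by lra.
  apply: (@le_trans _ _ (`|P^`().[x]|^-1)).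
    by rewrite ler_piMl ?invr_ge0// invf_le1//; lra.
  apply: (le_trans (inv x xuv)); rewrite /c1.
  apply: ler_pM => //; [|by rewrite invr_ge0 exprn_ge0//; lra| |exact: apow].
    by rewrite mulr_ge0//; lra.
  rewrite ler_wpM2l//; first by lra.
  by rewrite -!exprVn ler_weXn2l// leq_pmull.
move=> x xuv; rewrite dQ2 dQ !hornerZ !(normrM (2 * pi)) (ger0_norm (_ : 0 <= 2 * pi)); last by lra.
have -> : 2 * pi * `|P^`()^`().[x]| / (2 * pi * `|P^`().[x]|) ^+ 2 =
   (2 * pi)^-1 * (`|P^`()^`().[x]| * `|P^`().[x]|^-1 ^+ 2).
  have := P'0 x xuv; move: `|P^`().[x]| => p p0; field.
  by rewrite !gt_eqF//; lra.
have xd0 : 0 <= x ^- d by rewrite invr_ge0 exprn_ge0//; lra.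
apply: (@le_trans _ _ (`|P^`()^`().[x]| * `|P^`().[x]|^-1 ^+ 2)).
  by rewrite ler_piMl ?mulr_ge0// ?exprn_ge0 ?invr_ge0// invf_le1//; lra.
have x1 : 1 <= x by lra.
apply: (@le_trans _ _ ((d%:R ^+ 3 * c * x ^+ d) * (b ^+ 2 * dl ^- (2 * q) * x ^- (2 * d)))).
  apply: ler_pM; [by []|by apply: exprn_ge0; rewrite invr_ge0|exact: norm_deriv2_le|exact: invsq].
rewrite (_ : _ * _ = d%:R ^+ 3 * c * b ^+ 2 * dl ^- (2 * q) * x ^- d); last first.
  rewrite (mul2n d) -addnn exprD; have : x ^+ d != 0 by rewrite expf_neq0//; lra.
  have : dl ^+ (2 * q) != 0 by rewrite expf_neq0// gt_eqF.
  by move: (x ^+ d) (dl ^+ _) => X D X0 D0; field; rewrite X0 D0.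
rewrite /c2 ler_wpM2l//; last exact: apow.
by rewrite !mulr_ge0// ?exprn_ge0//; lra.
Qed.

End sparse_oscillatory_integral.

(** * A smooth partition of the circle *)

Section cosine_bump.
Context {R : realType}.
Implicit Types (x y t u : R) (D n j K H : nat).

Definition bump_coef n j : R := 'C(n, j)%:R / 2 ^+ n.

Lemma bump_coef_ge0 n j : 0 <= bump_coef n j.
Proof. by rewrite divr_ge0// exprn_ge0. Qed.

Lemma sum_bump_coef n : \sum_(j < n.+1) bump_coef n j = 1.
Proof.
rewrite -mulr_suml -natr_sum.
have -> : (\sum_(j < n.+1) 'C(n, j) = 2 ^ n)%N.
  rewrite -[2%N]/((1 + 1)%N) expnDn; apply: eq_bigr => i _.
  by rewrite !exp1n !muln1.
by rewrite natrX divff// expf_neq0.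
Qed.

(** Iterates [cos x cos z = (cos (z + x) + cos (z - x)) / 2]; the coefficients follow Pascal's rule.
    The factor [cos y] carries the phase collected from other bumps. *)
Lemma cosX_cos_expansion n x y :
  cos x ^+ n * cos y =
  \sum_(j < n.+1) bump_coef n j * cos (y + (j.*2%:R - n%:R) * x).
Proof.
elim: n => [|n IH].
  by rewrite big_ord1 /bump_coef bin0 expr0 invr1 subrr mul0r addr0 mulr1.
have step (c z : R) : cos x * (c * cos z) = c / 2 * cos (z + x) + c / 2 * cos (z - x).
  by rewrite cosB cosD; field.
rewrite exprS -mulrA IH big_distrr /=.
under eq_bigr do rewrite step.
rewrite big_split /= [RHS]big_ord_recl.
have c0 : bump_coef n.+1 0 = bump_coef n 0 / 2.
  by rewrite /bump_coef !bin0 exprS invfM; ring.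
have cS j : bump_coef n.+1 j.+1 = bump_coef n j / 2 + bump_coef n j.+1 / 2.
  by rewrite /bump_coef binS natrD exprS invfM; ring.
under [in RHS]eq_bigr do rewrite cS mulrDl.
rewrite big_split /= addrCA; congr (_ + _).
  apply: eq_bigr => i _; congr (_ * cos _).
  by rewrite /bump /= doubleS -(addn2 i.*2) natrD -(natr1 n); ring.
rewrite [LHS]big_ord_recl [in RHS]big_ord_recr /=.
have -> : bump_coef n n.+1 = 0 by rewrite /bump_coef bin_small// mul0r.
rewrite !mul0r addr0 c0; congr (_ + _).
  by congr (_ * cos _); rewrite -(natr1 n); ring.
apply: eq_bigr => i _; congr (_ * cos _).
by rewrite /bump /= doubleS -(addn2 i.*2) natrD -(natr1 n); ring.
Qed.

(** The even exponent makes the function nonnegative and of period 1, with integer frequencies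
    between [- D] and [D]. *)
Definition cos_bump D t : R := cos (pi * t) ^+ D.*2.

Lemma cos_bump_ge0 D t : 0 <= cos_bump D t.
Proof. by rewrite /cos_bump -mul2n exprM exprn_ge0// sqr_ge0. Qed.

Lemma cos_bump0 D : cos_bump D 0 = 1.
Proof. by rewrite /cos_bump mulr0 cos0 expr1n. Qed.

Lemma continuous_cos_bump D : continuous (cos_bump D).
Proof.
move=> t.
apply: (@continuous_comp _ _ _ (fun t => cos (pi * t)) (fun x => x ^+ D.*2)).
  apply: (@continuous_comp _ _ _ (fun t => pi * t) cos); last exact: continuous_cos.
  exact: mulrl_continuous.
exact: exprn_continuous.
Qed.

Lemma cos_bumpDnat D t n : cos_bump D (t + n%:R) = cos_bump D t.
Proof.
elim: n => [|n IH]; first by rewrite addr0.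
rewrite -IH -natr1 addrA /cos_bump mulrDr mulr1 cosDpi -[in LHS]mul2n exprM.
by rewrite sqrrN -exprM mul2n.
Qed.

Lemma cos_bumpDint D t (z : int) : cos_bump D (t + z%:~R) = cos_bump D t.
Proof.
case: z => n; first exact: cos_bumpDnat.
by rewrite NegzE mulrNz -[in RHS](subrK n.+1%:R t) cos_bumpDnat.
Qed.

Lemma cos_bump_expansion D t y :
  cos_bump D t * cos y =
  \sum_(j < D.*2.+1) bump_coef D.*2 j * cos (y + 2 * pi * ((j%:R - D%:R) * t)).
Proof.
rewrite /cos_bump cosX_cos_expansion; apply: eq_bigr => j _.
have dbl n : n.*2%:R = 2 * n%:R :> R by rewrite -mul2n natrM.
by congr (_ * cos (_ + _)); rewrite !dbl; ring.
Qed.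

(** Telescopes by [2 sin (h / 2) cos y = sin (y + h / 2) - sin (y - h / 2)]. *)
Lemma sum_cos_arithmetic x h n :
  2 * sin (h / 2) * (\sum_(c < n) cos (x - c%:R * h)) =
  sin (x + h / 2) - sin (x + h / 2 - n%:R * h).
Proof.
elim: n => [|n IH]; first by rewrite big_ord0 mulr0 mul0r subr0 subrr.
rewrite big_ord_recr /= mulrDr IH.
have -> : x + h / 2 - n.+1%:R * h = (x - n%:R * h) - h / 2.
  by rewrite -natr1; field.
have -> : x + h / 2 - n%:R * h = (x - n%:R * h) + h / 2 by ring.
by rewrite (sinB (x - n%:R * h)) (sinD (x - n%:R * h)); ring.
Qed.

Lemma sin_periodZ x (z : int) : sin (x + 2 * pi * z%:~R) = sin x.
Proof.
have nat_case y n : sin (y + 2 * pi * n%:R) = sin y.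
  by rewrite mulr_natr -mulr_natl mulr_natl mulr_natl periodicn//; exact: sinD2pi.
case: z => n; first exact: nat_case.
by rewrite NegzE mulrNz -[in RHS](subrK (2 * pi * n.+1%:R) x) nat_case mulrN.
Qed.

(** With step [h = 2 pi z / K] the two ends of the telescoped sum differ by [z] full periods;
    [0 < |z| < K] keeps [sin (h / 2)] away from zero. *)
Lemma sum_cos_equidistant (z : int) K y t : z != 0 -> (`|z| < K)%N ->
  \sum_(c < K) cos (y + 2 * pi * (z%:~R * (t - c%:R / K%:R))) = 0.
Proof.
move=> z0 zK; have K0 : 0 < K%:R :> R by rewrite ltr0n (leq_ltn_trans _ zK).
pose h : R := 2 * pi * z%:~R / K%:R.
have zR : `|z%:~R : R| = `|z|%:R by rewrite -intr_norm -natr_absz.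
have sin0 : sin (h / 2) != 0.
  have -> : h / 2 = pi * (z%:~R / K%:R) by rewrite /h; field; rewrite gt_eqF.
  rewrite -normr_eq0.
  have -> : `|sin (pi * (z%:~R / K%:R))| = `|sin (pi * (`|z|%:R / K%:R)) : R|.
    rewrite -zR; case/orP: (le_total 0 (z%:~R : R)) => z1; first by rewrite (ger0_norm z1).
    by rewrite (ler0_norm z1) mulNr mulrN sinN normrN.
  rewrite gt_eqF// normr_gt0 gt_eqF// sin_gt0_pi//.
  have p0 : 0 < `|z|%:R / K%:R :> R.
    by rewrite divr_gt0// ltr0n absz_gt0.
  have p1 : `|z|%:R / K%:R < 1 :> R by rewrite ltr_pdivrMr// mul1r ltr_nat.
  by have := @pi_gt0 R; nra.
have := sum_cos_arithmetic (y + 2 * pi * (z%:~R * t)) h K.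
have -> : forall x, x - K%:R * h = x + 2 * pi * (- z)%:~R.
  by move=> x; rewrite /h mulrNz; field; rewrite gt_eqF.
rewrite sin_periodZ subrr => /eqP; rewrite !mulf_eq0 (negbTE sin0) orbF.
rewrite pnatr_eq0 /= => /eqP; congr (_ = _); apply: eq_bigr => c _; congr (cos _).
by rewrite /h; ring.
Qed.

(** The coefficient of frequency zero, that is, the integral of [cos_bump D] over one period. *)
Definition bump_mean D : R := bump_coef D.*2 D.

(** Averages over [K] equidistant nodes are exact for trigonometric polynomials of degree below [K].
    This is why the soft cells sum to 1 without error. *)
Lemma sum_cos_bump_equidistant D K t : (D < K)%N ->
  \sum_(c < K) cos_bump D (t - c%:R / K%:R) = K%:R * bump_mean D.
Proof.
move=> DK.
have e c : cos_bump D (t - c%:R / K%:R) = cos_bump D (t - c%:R / K%:R) * cos 0.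
  by rewrite cos0 mulr1.
under eq_bigr do rewrite e cos_bump_expansion.
rewrite exchange_big /=.
have jD : (D < D.*2.+1)%N by lia.
rewrite (bigD1 (Ordinal jD)) //= [X in _ + X]big1 ?addr0.
  under eq_bigr do rewrite subrr mul0r mulr0 addr0 cos0 mulr1.
  by rewrite sumr_const card_ord mulr_natl.
move=> j jneq; rewrite -big_distrr /=.
have zE : j%:R - D%:R = (j%:Z - D%:Z)%:~R :> R by rewrite rmorphB.
under eq_bigr do rewrite zE.
rewrite sum_cos_equidistant ?mulr0//.
  rewrite subr_eq0; apply: contraNneq jneq => -[jE].
  by apply/eqP/val_inj.
by have := ltn_ord j; lia.
Qed.

(** At [t = 0] one of the [K] nonnegative summands equals 1. *)
Lemma bump_mean_lb D K : (D < K)%N -> 1 <= K%:R * bump_mean D.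
Proof.
move=> DK; rewrite -(sum_cos_bump_equidistant 0 DK).
have K0 : (0 < K)%N by exact: leq_ltn_trans DK.
rewrite (bigD1 (Ordinal K0)) //= mul0r subr0 cos_bump0 lerDl.
by apply: sumr_ge0 => i _; exact: cos_bump_ge0.
Qed.

(** Take [m = n] in [|sin (m y)| <= m |sin y|] with [y = pi / (2 n)], where the left side is 1. *)
Lemma sin_pihalf_div n : (0 < n)%N -> n%:R^-1 <= sin (pi / 2 / n%:R) :> R.
Proof.
move=> n0; pose y : R := pi / 2 / n%:R.
have sub m : `|sin (m%:R * y)| <= m%:R * `|sin y|.
  elim: m => [|m IH]; first by rewrite !mul0r sin0 normr0.
  rewrite -natr1 !mulrDl !mul1r sinD (le_trans (ler_normD _ _))// lerD//.
    by rewrite normrM (le_trans _ IH)// ler_piMr// cos_max.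
  by rewrite normrM ler_piMl// cos_max.
have nR : 0 < n%:R :> R by rewrite ltr0n.
have nR1 : 1 <= n%:R :> R by rewrite ler1n.
have := sub n.
have -> : n%:R * y = pi / 2 by rewrite /y; field; rewrite gt_eqF.
have pi0 := @pi_gt0 R.
have y0 : 0 < y by rewrite !divr_gt0.
have ypi : y < pi.
  have : y <= pi / 2 by rewrite /y ler_pdivrMr// ler_peMr// divr_ge0// ltW.
  by lra.
rewrite sin_pihalf normr1 ger0_norm; last by rewrite ltW// sin_gt0_pi// y0 ypi.
by rewrite -ler_pdivrMl// mulr1.
Qed.

(** [cos ^ 2 = 1 - sin ^ 2 <= 1 - K ^- 2 <= exp (- K ^- 2)], raised to the power [D]. *)
Lemma cos_bump_tail D K t : (0 < K)%N ->
  (forall z : int, K%:R^-1 <= `|t - z%:~R|) ->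
  cos_bump D t <= expR (- (D%:R / K%:R ^+ 2)).
Proof.
move=> K0 far; pose z := Num.floor (t + 2^-1); pose s := t - z%:~R.
have /andP[z1 z2] := floor_itv (t + 2^-1).
have KR : 0 < K%:R :> R by rewrite ltr0n.
have s12 : `|s| <= 2^-1 by rewrite ler_norml /s; move: z1 z2; rewrite -/z intrD; lra.
have sK : K%:R^-1 <= `|s| by exact: far.
have -> : cos_bump D t = cos_bump D s by rewrite -(cos_bumpDint D s z) subrK.
have sinlb : K%:R^-1 <= sin (pi * `|s|).
  apply: (le_trans (sin_pihalf_div K0)).
  have pi0 := @pi_gt0 R.
  have Kinv : 0 < K%:R^-1 :> R by rewrite invr_gt0.
  have [->//|ne] := eqVneq (pi / 2 / K%:R) (pi * `|s|).
  have lt : pi / 2 / K%:R < pi * `|s|.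
    by rewrite lt_neqAle ne/=; nra.
  apply/ltW; rewrite ltr_sin// in_itv/=.
    by apply/andP; split; nra.
  by apply/andP; split; nra.
have -> : cos_bump D s = (1 - sin (pi * `|s|) ^+ 2) ^+ D.
  rewrite /cos_bump -mul2n exprM cos2sin2; congr ((1 - _) ^+ _).
  case/orP: (le_total 0 s) => s0; first by rewrite (ger0_norm s0).
  by rewrite (ler0_norm s0) mulrN sinN sqrrN.
rewrite (_ : - (D%:R / K%:R ^+ 2) = D%:R * (- K%:R ^- 2)); last by rewrite mulrN.
have h0 : 0 <= 1 - sin (pi * `|s|) ^+ 2 by rewrite -cos2sin2 sqr_ge0.
rewrite expRM_natl lerXn2r ?nnegrE ?expR_ge0//.
apply: (@le_trans _ _ (1 + - K%:R ^- 2)); last exact: expR_ge1Dx.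
by rewrite lerD2l lerN2 -exprVn lerXn2r// nnegrE ?invr_ge0// (le_trans _ sinlb)// invr_ge0.
Qed.

End cosine_bump.

Section soft_cells.
Context {R : realType}.
Notation mu := (@lebesgue_measure R).
Implicit Types (x y t u : R) (D n j K H : nat).

(* The bump averaged over a cell of width [1/K] (discretized into [K ^ 3] points);
   the exponent [2 K ^ 3] makes the tail of the bump at distance [1/K] at most
   [exp (- K)]. *)
Definition soft_cell K t : R :=
  (K%:R * (K ^ 3)%:R * bump_mean (K ^ 3))^-1 *
  \sum_(h < K ^ 3) cos_bump (K ^ 3) (t - h%:R / (K * K ^ 3)%:R).

Let mean_gt0 D : 0 < bump_mean D :> R.
Proof. by rewrite /bump_mean divr_gt0 ?exprn_gt0// ltr0n bin_gt0; lia. Qed.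

Let lt_grid K : (1 < K)%N -> (K ^ 3 < K * K ^ 3)%N.
Proof. by move=> K1; rewrite ltn_Pmull// expn_gt0; lia. Qed.

Lemma soft_cell_ge0 K t : 0 <= soft_cell K t.
Proof.
apply: mulr_ge0; last by apply: sumr_ge0 => i _; exact: cos_bump_ge0.
by rewrite invr_ge0 !mulr_ge0// ltW.
Qed.

Lemma soft_cellDint K t (z : int) : soft_cell K (t + z%:~R) = soft_cell K t.
Proof.
congr (_ * _); apply: eq_bigr => h _.
by rewrite addrAC cos_bumpDint.
Qed.

Lemma continuous_soft_cell K : continuous (soft_cell K).
Proof.
move=> t; apply: cvgM; first exact: cvg_cst.
apply: cvg_big => [|h _]; first exact: add_continuous.
apply: (@continuous_comp _ _ _ (fun t => t - h%:R / (K * K ^ 3)%:R) (cos_bump (K ^ 3))).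
  by apply: cvgB; [exact: cvg_id|exact: cvg_cst].
exact: continuous_cos_bump.
Qed.

(** The [K] cells with their [K ^ 3] points each fill a grid of [K ^ 4] equidistant points, more
    than the degree [K ^ 3] of the bump. *)
Lemma sum_soft_cell K t : (1 < K)%N ->
  \sum_(c < K) soft_cell K (t - c%:R / K%:R) = 1.
Proof.
move=> K1; rewrite -big_distrr /=.
have K0 : (0 < K ^ 3)%N by rewrite expn_gt0; lia.
have := sum_cos_bump_equidistant t (lt_grid K1).
rewrite -(big_mkord xpredT (fun i => cos_bump (K ^ 3) (t - i%:R / (K * K ^ 3)%:R))).
rewrite big_nat_mul big_mkord => E.
have -> : \sum_(i < K) \sum_(h < K ^ 3)
    cos_bump (K ^ 3) (t - i%:R / K%:R - h%:R / (K * K ^ 3)%:R) =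
    (K * K ^ 3)%:R * bump_mean (K ^ 3) :> R.
  rewrite -E; apply: eq_bigr => c _.
  rewrite mulSn -[X in \big[_/_]_(X <= _ < _) _]add0n big_addn addnK big_mkord.
  apply: eq_bigr => h _; congr cos_bump.
  rewrite natrD !natrM; field.
  by rewrite pnatr_eq0 -lt0n ltnW.
rewrite (natrM _ K (K ^ 3)) mulVf// gt_eqF//.
apply: mulr_gt0; last exact: mean_gt0.
by apply: mulr_gt0; rewrite ltr0n// ltnW.
Qed.

Lemma soft_cell_le1 K t : (1 < K)%N -> soft_cell K t <= 1.
Proof.
move=> K1; rewrite -(sum_soft_cell t K1) (bigD1 (Ordinal (ltnW K1))) //=.
rewrite mul0r subr0 lerDl; apply: sumr_ge0 => i _; exact: soft_cell_ge0.
Qed.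

Lemma soft_cell_mean_inv K : (1 < K)%N -> (bump_mean (K ^ 3))^-1 <= (K * K ^ 3)%:R :> R.
Proof.
move=> K1; rewrite -[leLHS]mul1r ler_pdivrMr ?mean_gt0//.
exact: bump_mean_lb (lt_grid K1).
Qed.

(** The points inside a cell shift the argument by less than [1 / K], so half of the distance
    [2 / K] remains for the tail of the bump. The factor [K ^ 4] bounds the inverse of the mean in
    the normalization. *)
Lemma soft_cell_tail K t : (1 < K)%N ->
  (forall z : int, 2 / K%:R <= `|t - z%:~R|) ->
  soft_cell K t <= (K * K ^ 3)%:R * expR (- K%:R).
Proof.
move=> K1 far; have K0 : 0 < K%:R :> R by rewrite ltr0n ltnW.
have K30 : 0 < (K ^ 3)%:R :> R by rewrite ltr0n expn_gt0 ltnW.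
have tail (h : 'I_(K ^ 3)) :
    cos_bump (K ^ 3) (t - h%:R / (K * K ^ 3)%:R) <= expR (- K%:R).
  apply: (le_trans (@cos_bump_tail R (K ^ 3) K _ (ltnW K1) _)).
    move=> z; have := far z.
    have h0 : 0 <= h%:R / (K * K ^ 3)%:R :> R by rewrite divr_ge0.
    have h1 : h%:R / (K * K ^ 3)%:R <= K%:R^-1 :> R.
      rewrite (natrM _ K (K ^ 3)) invfM mulrCA ler_piMr ?invr_ge0 ?ltW//.
      by rewrite ltr_pdivrMr// mul1r ltr_nat.
    move: (h%:R / _) h0 h1 => y y0 y1 fz.
    have -> : t - y - z%:~R = (t - z%:~R) - y by ring.
    have := lerB_dist (t - z%:~R) y; rewrite (ger0_norm y0); lra.
  rewrite ler_expR lerN2 natrX.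
  by rewrite le_eqVlt; apply/orP; left; apply/eqP; field; rewrite gt_eqF.
rewrite /soft_cell; apply: (@le_trans _ _ ((K%:R * (K ^ 3)%:R * bump_mean (K ^ 3))^-1 *
    (expR (- K%:R) *+ (K ^ 3)))).
  rewrite ler_wpM2l ?invr_ge0 ?mulr_ge0 ?(ltW (mean_gt0 _))//.
  have -> : expR (- K%:R) *+ (K ^ 3) = \sum_(h < K ^ 3) expR (- K%:R) :> R.
    by rewrite sumr_const card_ord.
  by apply: ler_sum => h _; exact: tail.
rewrite -[X in _ * X <= _]mulr_natl mulrA ler_wpM2r ?expR_ge0//.
have -> : (K%:R * (K ^ 3)%:R * bump_mean (K ^ 3))^-1 * (K ^ 3)%:R =
    K%:R^-1 * (bump_mean (K ^ 3))^-1 :> R.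
  by have := mean_gt0 (K ^ 3) => ?; field; rewrite !gt_eqF.
apply: (le_trans _ (soft_cell_mean_inv K1)).
by rewrite ler_piMl ?invr_ge0 ?(ltW (mean_gt0 _))// invf_le1// ler1n ltnW.
Qed.

End soft_cells.

Section decoupling.
Context {R : realType}.
Notation mu := (@lebesgue_measure R).
Implicit Types (x y t u : R) (n j K : nat) (P : {poly R}).

(** Makes the preceding bound uniform over all degrees between [M] and [N]. Integrality of the
    coefficients enters through the leading one, which is nonzero and hence at least 1 in absolute
    value. *)
Lemma phase_integral_le a b eta c (M Q N : nat) (s : seq nat) P beta :
  1 <= a -> a <= b -> 0 < eta -> eta <= 1 -> (0 < M)%N -> (size s <= Q)%N ->
  {in s, forall n, n <= N}%N -> (forall i, P`_i != 0 -> i \in s) ->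
  (forall i, P`_i \is a Num.int) -> (forall i, `|P`_i| <= c) ->
  (exists2 n, (M <= n)%N & P`_n != 0) ->
  `|\int[mu]_(x in `[a, b]) cos (2 * pi * P.[x] + beta)| <=
  2 ^+ Q * ((2 * b + (b - a) * (N%:R ^+ 3 * c * b ^+ 2)) *
    (N%:R * b / eta) ^+ (2 * Q) * a ^- M + 2 * eta).
Proof.
move=> a1 ab eta0 eta1 M0 sQ sN supp Pint Pc [n Mn Pn].
have c0 : 0 <= c by apply: le_trans (Pc 0%N).
have P0 : P != 0 by apply: contraNneq Pn => ->; rewrite coef0.
pose d := (size P).-1; pose s' := [seq i <- s | (i < d)%N].
have lead : P`_d != 0 by rewrite -lead_coefE lead_coef_eq0.
have nd : (n <= d)%N.
  by rewrite leqNgt; apply: contra Pn => dn; rewrite nth_default//; exact: leq_trans (leqSpred _) dn.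
have d0 : (0 < d)%N by lia.
have dN : (d <= N)%N by apply: sN; exact: supp.
have s'Q : (size s' <= Q)%N by rewrite size_filter (leq_trans (count_size _ _)).
have := @cos_sparse_poly_integral R P a b eta c beta s' d a1 ab eta0 eta1 d0.
move=> /(_ _ _ _ Pc) H.
apply: (le_trans (H _ _ _)).
- by apply/allP => i; rewrite mem_filter => /andP[].
- have /intrP [z Pz] := Pint d.
  by rewrite Pz -intr_norm ler1z -gtz0_ge1 normr_gt0; move: lead; rewrite Pz intr_eq0.
- move=> i Pi; case: (ltngtP i d) => [id|id|//] /=.
    by rewrite mem_filter id supp.
  by move: Pi; rewrite nth_default ?eqxx//; exact: leq_trans (leqSpred _) id.
have b1 : 1 <= b by lra.
have dNR : d%:R <= N%:R :> R by rewrite ler_nat.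
have d1R : 1 <= d%:R :> R by rewrite ler1n.
have x1 : 1 <= d%:R * b / eta by rewrite ler_pdivlMr// mul1r; nra.
have xy : d%:R * b / eta <= N%:R * b / eta.
  by rewrite ler_wpM2r ?invr_ge0 ?(ltW eta0)// ler_wpM2r//; lra.
have apos n' : 0 < a ^+ n' by rewrite exprn_gt0//; lra.
apply: ler_pM.
- by rewrite exprn_ge0.
- apply: addr_ge0; last by lra.
  rewrite !mulr_ge0// ?exprn_ge0 ?invr_ge0 ?(ltW (apos _))//; last by lra.
  by apply: addr_ge0; [lra|rewrite !mulr_ge0// ?exprn_ge0//; lra].
- by rewrite ler_weXn2l//; lra.
rewrite lerD2r; apply: ler_pM.
- rewrite !mulr_ge0// ?exprn_ge0//; last by lra.
  by apply: addr_ge0; [lra|rewrite !mulr_ge0// ?exprn_ge0//; lra].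
- by rewrite invr_ge0 ltW.
- apply: ler_pM.
  + by apply: addr_ge0; [lra|rewrite !mulr_ge0// ?exprn_ge0//; lra].
  + by rewrite exprn_ge0//; lra.
  + rewrite lerD2l ler_wpM2l//; first by lra.
    rewrite ler_wpM2r ?sqr_ge0// ler_wpM2r//.
    by rewrite lerXn2r// nnegrE; lra.
  + apply: (@le_trans _ _ ((d%:R * b / eta) ^+ (2 * Q))).
      by rewrite ler_weXn2l// leq_mul2l s'Q orbT.
    by rewrite lerXn2r// nnegrE; lra.
rewrite lef_pV2 ?posrE ?apos//.
by rewrite ler_weXn2l// (leq_trans Mn nd).
Qed.

End decoupling.

(** * Asymptotic independence of powers and moments of cell counts *)

Section continuous_integrals.
Context {R : realType}.
Notation mu := (@lebesgue_measure R).
Implicit Types (a b : R) (f g : R -> R).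

Lemma continuous_sum (I : Type) (r : seq I) (P : pred I) (F : I -> R -> R) :
  (forall i, continuous (F i)) -> continuous (fun x => \sum_(i <- r | P i) F i x).
Proof.
move=> cF x; apply: cvg_big => [|i _]; first exact: add_continuous.
exact: cF.
Qed.

Lemma continuous_prod (I : Type) (r : seq I) (F : I -> R -> R) :
  (forall i, continuous (F i)) -> continuous (fun x => \prod_(i <- r) F i x).
Proof.
move=> cF; elim: r => [|i r IH].
  rewrite (_ : (fun x => _) = cst 1); first exact: cst_continuous.
  by apply/funext => x; rewrite big_nil.
rewrite (_ : (fun x => _) = (fun x => F i x * \prod_(i <- r) F i x)).
  by move=> x; apply: cvgM; [exact: cF|exact: IH].
by apply/funext => x; rewrite big_cons.
Qed.

Lemma Rintegral_itvD a b f g : continuous f -> continuous g ->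
  \int[mu]_(x in `[a, b]) (f x + g x) =
  \int[mu]_(x in `[a, b]) f x + \int[mu]_(x in `[a, b]) g x.
Proof. by move=> cf cg; rewrite RintegralD//; exact: continuous_integrable. Qed.

Lemma Rintegral_itvZ a b (c : R) f : continuous f ->
  \int[mu]_(x in `[a, b]) (c * f x) = c * \int[mu]_(x in `[a, b]) f x.
Proof. by move=> cf; rewrite RintegralZl//; exact: continuous_integrable. Qed.

Lemma Rintegral_itv_sum a b (I : Type) (r : seq I) (P : pred I) (F : I -> R -> R) :
  (forall i, continuous (F i)) ->
  \int[mu]_(x in `[a, b]) (\sum_(i <- r | P i) F i x) =
  \sum_(i <- r | P i) \int[mu]_(x in `[a, b]) F i x.
Proof.
move=> cF; elim: r => [|i r IH].
  rewrite big_nil; under eq_Rintegral do rewrite big_nil.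
  by rewrite Rintegral_cst// mul0r.
rewrite big_cons; under eq_Rintegral do rewrite big_cons.
case: (P i); last exact: IH.
by rewrite -IH -Rintegral_itvD//; exact: continuous_sum.
Qed.

Lemma le_Rintegral_itv a b f g : continuous f -> continuous g ->
  (forall x, a <= x <= b -> f x <= g x) ->
  \int[mu]_(x in `[a, b]) f x <= \int[mu]_(x in `[a, b]) g x.
Proof.
move=> cf cg fg; apply: le_Rintegral; [by []|exact: continuous_integrable|exact: continuous_integrable|].
by move=> x; rewrite /= in_itv/=; exact: fg.
Qed.

End continuous_integrals.

Section decoupling.
Context {R : realType}.
Notation mu := (@lebesgue_measure R).
Implicit Types (x y t u : R) (n j K D : nat) (P : {poly R}).

Definition bump_prod D (B : seq (nat * R)) x : R :=
  \prod_(p <- B) cos_bump D (x ^+ p.1 - p.2).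

Lemma continuous_pow_sub (g : R -> R) n u : continuous g ->
  continuous (fun x => g (x ^+ n - u)).
Proof.
move=> cg x; apply: (@continuous_comp _ _ _ (fun x => x ^+ n - u) g); last exact: cg.
by apply: cvgB; [exact: exprn_continuous|exact: cvg_cst].
Qed.

Lemma continuous_bump_prod D (B : seq (nat * R)) : continuous (bump_prod D B).
Proof.
by apply: continuous_prod => p; apply: continuous_pow_sub; exact: continuous_cos_bump.
Qed.

Lemma continuous_cos_poly P u : continuous (fun x => cos (2 * pi * P.[x] + u)).
Proof.
move=> x; apply: (@continuous_comp _ _ _ (fun x => 2 * pi * P.[x] + u) cos).
  apply: cvgD; last exact: cvg_cst.
  by apply: cvgM; [exact: cvg_cst|exact: continuous_horner].
exact: continuous_cos.
Qed.

Variables (a b W c : R) (D M : nat) (s : seq nat).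
Hypothesis W0 : 0 <= W.
Hypothesis HW : forall P beta, (forall i, P`_i != 0 -> i \in s) ->
  (forall i, P`_i \is a Num.int) -> (forall i, `|P`_i| <= c) ->
  (exists2 n, (M <= n)%N & P`_n != 0) ->
  `|\int[mu]_(x in `[a, b]) cos (2 * pi * P.[x] + beta)| <= W.

Let mono (j n : nat) : {poly R} := (j%:R - D%:R) *: 'X^n.

Let bump_cos_poly P beta n u x j :
  cos (2 * pi * P.[x] + beta + 2 * pi * ((j%:R - D%:R) * (x ^+ n - u))) =
  cos (2 * pi * (P + mono j n).[x] + (beta - 2 * pi * ((j%:R - D%:R) * u))).
Proof. by congr cos; rewrite hornerD /mono hornerZ hornerXn; ring. Qed.

(** Expanding the bumps adds to the phase only monomials whose degrees occur in [B], so the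
    coefficient at a degree outside [B] survives and [HW] applies in the end. The weights of each
    expansion sum to 1, so [W] does not grow. *)
Lemma bump_prod_cos_integral (B : seq (nat * R)) P beta :
  {subset map fst B <= s} -> (forall i, P`_i != 0 -> i \in s) ->
  (forall i, P`_i \is a Num.int) ->
  (forall i, `|P`_i| + (D * size B)%:R <= c) ->
  (exists n, [/\ (M <= n)%N, P`_n != 0 & n \notin map fst B]) ->
  `|\int[mu]_(x in `[a, b]) (bump_prod D B x * cos (2 * pi * P.[x] + beta))| <= W.
Proof.
elim: B P beta => [|[n u] B IH] P beta sB supp Pint Pc [n0 [Mn0 Pn0 n0B]].
  under eq_Rintegral do rewrite /bump_prod big_nil mul1r.
  apply: HW => //; last by exists n0.
  by move=> i; have := Pc i; rewrite muln0 addr0.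
have E x : bump_prod D ((n, u) :: B) x * cos (2 * pi * P.[x] + beta) =
    \sum_(j < D.*2.+1) bump_coef D.*2 j * (bump_prod D B x *
      cos (2 * pi * (P + mono j n).[x] + (beta - 2 * pi * ((j%:R - D%:R) * u)))).
  rewrite {1}/bump_prod big_cons /= -/(bump_prod D B x).
  transitivity (bump_prod D B x *
    (cos_bump D (x ^+ n - u) * cos (2 * pi * P.[x] + beta))); first by ring.
  rewrite cos_bump_expansion.
  rewrite big_distrr /=; apply: eq_bigr => j _.
  by rewrite bump_cos_poly; ring.
under eq_Rintegral do rewrite E.
rewrite Rintegral_itv_sum; last first.
  move=> j x; apply: cvgM; first exact: cvg_cst.
  by apply: cvgM; [exact: continuous_bump_prod|exact: continuous_cos_poly].
have -> : W = \sum_(j < D.*2.+1) bump_coef D.*2 j * W.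
  by rewrite -mulr_suml sum_bump_coef mul1r.
apply: (le_trans (ler_norm_sum _ _ _)); apply: ler_sum => j _.
rewrite Rintegral_itvZ; last first.
  by move=> x; apply: cvgM; [exact: continuous_bump_prod|exact: continuous_cos_poly].
rewrite normrM ger0_norm ?bump_coef_ge0// ler_wpM2l ?bump_coef_ge0//.
move: n0B sB; rewrite /= in_cons negb_or => /andP[n0n n0B] sB.
have mc i : (mono j n)`_i = (j%:R - D%:R) * (i == n)%:R by rewrite /mono coefZ coefXn.
apply: IH.
- by move=> i iB; apply: sB; rewrite in_cons iB orbT.
- move=> i; have [->|/negbTE ni] := eqVneq i n; first by move=> _; apply: sB; rewrite mem_head.
  by rewrite coefD mc ni mulr0 addr0; exact: supp.
- move=> i; rewrite coefD mc rpredD// rpredM// ?rpredB//; apply: natr_int.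
- move=> i; rewrite coefD mc; have := Pc i; rewrite mulnS natrD => Pci.
  apply: le_trans Pci; rewrite addrA lerD2r (le_trans (ler_normD _ _))// lerD2l.
  rewrite normrM; case: (i == n); rewrite ?normr0 ?mulr0// normr1 mulr1.
  have : (j <= D + D)%N by rewrite addnn -ltnS.
  rewrite -(ler_nat R) natrD => jD; have j0 : 0 <= j%:R :> R by [].
  by rewrite ler_norml; lra.
by exists n0; split => //; rewrite coefD mc (negbTE n0n) mulr0 addr0.
Qed.

(** Frequency zero of the bump at [x ^ n] is the main term. Any other frequency puts a nonzero
    integer coefficient at degree [n], which the bumps of [B] cannot cancel because [n] is not among
    their exponents. *)
Lemma bump_decoupling n u (B : seq (nat * R)) :
  n \in s -> (M <= n)%N -> n \notin map fst B -> {subset map fst B <= s} ->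
  (D * (size B).+1)%:R <= c ->
  `|\int[mu]_(x in `[a, b]) (cos_bump D (x ^+ n - u) * bump_prod D B x) -
    bump_mean D * \int[mu]_(x in `[a, b]) bump_prod D B x| <= W.
Proof.
move=> ns Mn nB sB Bc.
have E x : cos_bump D (x ^+ n - u) * bump_prod D B x =
    \sum_(j < D.*2.+1) bump_coef D.*2 j * (bump_prod D B x *
      cos (2 * pi * (0 + mono j n).[x] + (0 - 2 * pi * ((j%:R - D%:R) * u)))).
  have := cos_bump_expansion D (x ^+ n - u) 0; rewrite cos0 mulr1 => ->.
  rewrite big_distrl /=; apply: eq_bigr => j _.
  rewrite -bump_cos_poly hornerC mulr0 addr0; ring.
under eq_Rintegral do rewrite E.
rewrite Rintegral_itv_sum; last first.
  move=> j x; apply: cvgM; first exact: cvg_cst.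
  by apply: cvgM; [exact: continuous_bump_prod|exact: continuous_cos_poly].
have jD : (D < D.*2.+1)%N by lia.
rewrite (bigD1 (Ordinal jD)) //= -Rintegral_itvZ; last exact: continuous_bump_prod.
have -> : \int[mu]_(x in `[a, b]) (bump_coef D.*2 D * (bump_prod D B x *
      cos (2 * pi * (0 + mono D n).[x] + (0 - 2 * pi * ((D%:R - D%:R) * u))))) =
   \int[mu]_(x in `[a, b]) (bump_mean D * bump_prod D B x).
  apply: eq_Rintegral => x _.
  by rewrite /mono subrr scale0r addr0 hornerC mul0r mulr0 subr0 addr0 cos0 mulr1.
rewrite addrAC subrr add0r; apply: (le_trans (ler_norm_sum _ _ _)).
apply: (@le_trans _ _ (\sum_(j < D.*2.+1) bump_coef D.*2 j * W)); last first.
  by rewrite -mulr_suml sum_bump_coef mul1r.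
rewrite [leRHS](bigD1 (Ordinal jD)) //= ler_wpDl ?mulr_ge0 ?bump_coef_ge0//.
apply: ler_sum => j jneD.
rewrite Rintegral_itvZ; last first.
  by move=> x; apply: cvgM; [exact: continuous_bump_prod|exact: continuous_cos_poly].
rewrite normrM ger0_norm ?bump_coef_ge0// ler_wpM2l ?bump_coef_ge0//.
have mc i : (0 + mono j n)`_i = (j%:R - D%:R) * (i == n)%:R.
  by rewrite add0r /mono coefZ coefXn.
apply: bump_prod_cos_integral => //.
- by move=> i; rewrite mc; have [->//|] := eqVneq i n; rewrite mulr0 eqxx.
- by move=> i; rewrite mc rpredM// ?rpredB//; apply: natr_int.
- move=> i; rewrite mc; apply: le_trans Bc; rewrite mulnS natrD lerD2r.
  rewrite normrM; case: (i == n); rewrite ?normr0 ?mulr0// normr1 mulr1.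
  have : (j <= D + D)%N by rewrite addnn -ltnS.
  rewrite -(ler_nat R) natrD => jD2; have j0 : 0 <= j%:R :> R by [].
  by rewrite ler_norml; lra.
exists n; split => //; rewrite mc eqxx mulr1 subr_eq0 eqr_nat.
by apply: contraNneq jneD => jE; apply/eqP/val_inj.
Qed.

End decoupling.

Section cell_decoupling.
Context {R : realType}.
Notation mu := (@lebesgue_measure R).
Implicit Types (x y t u : R) (n j K D : nat) (P : {poly R}).

Definition cell_prod K (B : seq (nat * R)) x : R :=
  \prod_(p <- B) soft_cell K (x ^+ p.1 - p.2).

Lemma continuous_cell_prod K (B : seq (nat * R)) : continuous (cell_prod K B).
Proof.
by apply: continuous_prod => p; apply: continuous_pow_sub; exact: continuous_soft_cell.
Qed.

Variables (a b W c : R) (K M : nat) (s : seq nat).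
Hypothesis K1 : (1 < K)%N.
Hypothesis W0 : 0 <= W.
Hypothesis HW : forall P beta, (forall i, P`_i != 0 -> i \in s) ->
  (forall i, P`_i \is a Num.int) -> (forall i, `|P`_i| <= c) ->
  (exists2 n, (M <= n)%N & P`_n != 0) ->
  `|\int[mu]_(x in `[a, b]) cos (2 * pi * P.[x] + beta)| <= W.

Let D := (K ^ 3)%N.
Let KD : R := (K * D)%:R.

Let cellE t : soft_cell K t = \sum_(h < D) (KD * bump_mean D)^-1 * cos_bump D (t - h%:R / KD).
Proof. by rewrite /soft_cell /KD (natrM _ K D) big_distrr. Qed.

Let sum_weights : \sum_(h < D) (KD * bump_mean D)^-1 = K%:R^-1 * (bump_mean D)^-1.
Proof.
have m0 : 0 < bump_mean D :> R by rewrite /bump_mean divr_gt0 ?exprn_gt0// ltr0n bin_gt0; lia.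
rewrite sumr_const card_ord /KD (natrM _ K D) -[LHS]mulr_natr; field.
by rewrite (gt_eqF m0) !pnatr_eq0 -!lt0n /D expn_gt0 ltnW.
Qed.

Let weight_ge0 : 0 <= (KD * bump_mean D)^-1.
Proof.
have m0 : 0 < bump_mean D :> R by rewrite /bump_mean divr_gt0 ?exprn_gt0// ltr0n bin_gt0; lia.
by rewrite invr_ge0 mulr_ge0// ltW.
Qed.

Let inv_mean_ge0 : 0 <= (bump_mean D)^-1 :> R.
Proof. by rewrite invr_ge0 /bump_mean bump_coef_ge0. Qed.

Let sum_weights_le : \sum_(h < D) (KD * bump_mean D)^-1 <= (bump_mean D)^-1.
Proof. by rewrite sum_weights ler_piMl// invf_le1 ?ltr0n ?ler1n ltnW. Qed.

(** Cells become bumps one at a time: [B1] lists the factors still to be expanded, [B2] the bumps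
    obtained so far. Each expansion multiplies the error by the total weight of a cell, at most
    [(bump_mean D)^-1]. *)
Let mixed_decoupling n u (B1 B2 : seq (nat * R)) :
  n \in s -> (M <= n)%N -> n \notin map fst (B1 ++ B2) -> {subset map fst (B1 ++ B2) <= s} ->
  (D * (size (B1 ++ B2)).+1)%:R <= c ->
  `|\int[mu]_(x in `[a, b]) (cos_bump D (x ^+ n - u) * (cell_prod K B1 x * bump_prod D B2 x)) -
    bump_mean D * \int[mu]_(x in `[a, b]) (cell_prod K B1 x * bump_prod D B2 x)| <=
  W * (bump_mean D)^-1 ^+ size B1.
Proof.
move=> ns Mn; elim: B1 B2 => [|[n1 u1] B1 IH] B2 nB sB Bc.
  rewrite expr0 mulr1 (_ : (fun x => _ * (cell_prod K [::] x * _)) =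
    (fun x => cos_bump D (x ^+ n - u) * bump_prod D B2 x)); last first.
    by apply/funext => x; rewrite /cell_prod big_nil mul1r.
  rewrite (_ : (fun x => cell_prod K [::] x * _) = bump_prod D B2); last first.
    by apply/funext => x; rewrite /cell_prod big_nil mul1r.
  exact: (bump_decoupling W0 HW).
have ccb m v : continuous (fun x => cos_bump D (x ^+ m - v)).
  by apply: continuous_pow_sub; exact: continuous_cos_bump.
pose G h x := cell_prod K B1 x * bump_prod D ((n1, u1 + h%:R / KD) :: B2) x.
have cG h : continuous (G h).
  by move=> x; apply: cvgM; [exact: continuous_cell_prod|exact: continuous_bump_prod].
have E x : cell_prod K ((n1, u1) :: B1) x * bump_prod D B2 x =
    \sum_(h < D) (KD * bump_mean D)^-1 * G h x.
  rewrite /cell_prod big_cons cellE !big_distrl /=; apply: eq_bigr => h _.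
  by rewrite /G /bump_prod big_cons /= /cell_prod opprD addrA; ring.
have E2 x : cos_bump D (x ^+ n - u) * (cell_prod K ((n1, u1) :: B1) x * bump_prod D B2 x) =
    \sum_(h < D) (KD * bump_mean D)^-1 * (cos_bump D (x ^+ n - u) * G h x).
  by rewrite E big_distrr /=; apply: eq_bigr => h _; ring.
under eq_Rintegral do rewrite E2.
rewrite Rintegral_itv_sum; last first.
  move=> h x; apply: cvgM; first exact: cvg_cst.
  by apply: cvgM; [exact: ccb|exact: cG].
under [X in _ - _ * X]eq_Rintegral do rewrite E.
rewrite [X in _ - _ * X]Rintegral_itv_sum; last first.
  by move=> h x; apply: cvgM; [exact: cvg_cst|exact: cG].
rewrite big_distrr -sumrB /=; apply: (le_trans (ler_norm_sum _ _ _)).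
apply: (@le_trans _ _ (\sum_(h < D) (KD * bump_mean D)^-1 * (W * (bump_mean D)^-1 ^+ size B1))).
  apply: ler_sum => h _.
  rewrite !Rintegral_itvZ; [|exact: cG|]; last first.
    by move=> x; apply: cvgM; [exact: ccb|exact: cG].
  rewrite (mulrCA (bump_mean D)) -mulrBr normrM (ger0_norm weight_ge0) ler_wpM2l//.
  have mE : map fst (B1 ++ (n1, u1 + h%:R / KD) :: B2) =i map fst ((n1, u1) :: B1 ++ B2).
    move=> i; rewrite /= !map_cat mem_cat /= !in_cons mem_cat.
    by rewrite orbCA.
  apply: IH.
  - by rewrite mE.
  - by move=> i; rewrite mE; exact: sB.
  - by rewrite size_cat /= addnS -size_cat.
rewrite -mulr_suml exprS mulrCA ler_wpM2l//.
by rewrite ler_wpM2r// exprn_ge0.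
Qed.

(** The total weight of a cell times the mean of a bump is exactly [1 / K], which makes the main
    term exact. All powers of the inverse mean are absorbed into powers of [K ^ 4]. *)
Lemma cell_decoupling n u (B : seq (nat * R)) :
  n \in s -> (M <= n)%N -> n \notin map fst B -> {subset map fst B <= s} ->
  (K ^ 3 * (size B).+1)%:R <= c ->
  `|\int[mu]_(x in `[a, b]) (soft_cell K (x ^+ n - u) * cell_prod K B x) -
    K%:R^-1 * \int[mu]_(x in `[a, b]) cell_prod K B x| <=
  W * (K * K ^ 3)%:R ^+ (size B).+1.
Proof.
move=> ns Mn nB sB Bc.
have ccb v : continuous (fun x => cos_bump D (x ^+ n - v)).
  by apply: continuous_pow_sub; exact: continuous_cos_bump.
have E x : soft_cell K (x ^+ n - u) * cell_prod K B x =
    \sum_(h < D) (KD * bump_mean D)^-1 *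
      (cos_bump D (x ^+ n - (u + h%:R / KD)) * cell_prod K B x).
  by rewrite cellE big_distrl /=; apply: eq_bigr => h _; rewrite (opprD u) (addrA (x ^+ n)) -mulrA.
under eq_Rintegral do rewrite E.
rewrite Rintegral_itv_sum; last first.
  move=> h x; apply: cvgM; first exact: cvg_cst.
  by apply: cvgM; [exact: ccb|exact: continuous_cell_prod].
have m0 : 0 < bump_mean D :> R by rewrite /bump_mean divr_gt0 ?exprn_gt0// ltr0n bin_gt0; lia.
have -> : K%:R^-1 * \int[mu]_(x in `[a, b]) cell_prod K B x =
   \sum_(h < D) (KD * bump_mean D)^-1 *
     (bump_mean D * \int[mu]_(x in `[a, b]) cell_prod K B x).
  by rewrite -mulr_suml sum_weights -[RHS]mulrA mulKf// (gt_eqF m0).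
rewrite -sumrB; apply: (le_trans (ler_norm_sum _ _ _)).
apply: (@le_trans _ _ (\sum_(h < D) (KD * bump_mean D)^-1 * (W * (bump_mean D)^-1 ^+ size B))).
  apply: ler_sum => h _; rewrite Rintegral_itvZ; last first.
    by move=> x; apply: cvgM; [exact: ccb|exact: continuous_cell_prod].
  rewrite -mulrBr normrM (ger0_norm weight_ge0) ler_wpM2l//.
  have := @mixed_decoupling n (u + h%:R / KD) B [::] ns Mn.
  rewrite cats0 => /(_ nB sB Bc).
  have e1 x : cell_prod K B x * bump_prod D [::] x = cell_prod K B x.
    by rewrite /bump_prod big_nil mulr1.
  under eq_Rintegral do rewrite e1.
  by under [X in _ - _ * X]eq_Rintegral do rewrite e1.
rewrite -mulr_suml mulrCA ler_wpM2l//.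
apply: (@le_trans _ _ ((bump_mean D)^-1 ^+ (size B).+1)).
  by rewrite exprS ler_wpM2r// exprn_ge0.
by rewrite lerXn2r// ?nnegrE//; exact: soft_cell_mean_inv.
Qed.

End cell_decoupling.

Lemma sum_mem_le n (s : seq nat) :
  (\sum_(i < n) (nat_of_ord i \in s) <= size s)%N.
Proof.
elim: s => [|m s IH]; first by rewrite big1.
have h (i : 'I_n) :
    ((nat_of_ord i \in m :: s) <= (nat_of_ord i == m) + (nat_of_ord i \in s))%N.
  by rewrite in_cons; case: (_ == _); case: (_ \in _).
apply: (leq_trans (leq_sum _ (fun i _ => h i))).
rewrite big_split /= -[leqRHS]add1n leq_add//.
have [mn|mn] := ltnP m n; last first.
  by rewrite big1// => i _; rewrite ltn_eqF// (leq_trans (ltn_ord i)).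
rewrite (bigD1 (Ordinal mn)) //= eqxx big1 ?addn0// => i ine.
by case: eqP => // im; case/eqP: ine; apply/val_inj.
Qed.

Lemma sum_ltn_le n m : (\sum_(i < n) (i < m)%N <= m)%N.
Proof.
apply: (leq_trans _ (leq_trans (sum_mem_le n (iota 0 m)) _)); last by rewrite size_iota.
by apply: leq_sum => i _; rewrite mem_iota.
Qed.

Section list_moments.
Context {R : realType}.
Notation mu := (@lebesgue_measure R).
Implicit Types (x y t u : R) (n j : nat) (B : seq (nat * R)).

Variables (a b w Cm : R) (K N M q : nat).
Hypothesis ab : a <= b.
Hypothesis K1 : (1 < K)%N.
Hypothesis w0 : 0 <= w.
Hypothesis Cm1 : 1 <= Cm.
Hypothesis CmE : N.+1%:R / K%:R + M%:R + q%:R <= Cm.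
Hypothesis dec : forall n u B, (M <= n)%N -> (n <= N)%N -> n \notin map fst B ->
  all (fun m => m <= N)%N (map fst B) -> (size B < q)%N ->
  `|\int[mu]_(x in `[a, b]) (soft_cell K (x ^+ n - u) * cell_prod K B x) -
    K%:R^-1 * \int[mu]_(x in `[a, b]) cell_prod K B x| <= w.

Let K0 : 0 < K%:R :> R. Proof. by rewrite ltr0n ltnW. Qed.
Let KV1 : K%:R^-1 <= 1 :> R. Proof. by rewrite invf_le1// ler1n ltnW. Qed.

Definition cell_count K N u x : R := \sum_(n < N.+1) soft_cell K (x ^+ n - u).

Lemma continuous_cell_count K' N' u : continuous (cell_count K' N' u).
Proof.
apply: continuous_sum => n; apply: continuous_pow_sub; exact: continuous_soft_cell.
Qed.

Lemma cell_prod_ge0 K' B x : 0 <= cell_prod K' B x.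
Proof. by apply: prodr_ge0 => i _; exact: soft_cell_ge0. Qed.

Lemma cell_prod_cons K' n u B x :
  cell_prod K' ((n, u) :: B) x = soft_cell K' (x ^+ n - u) * cell_prod K' B x.
Proof. by rewrite /cell_prod big_cons. Qed.

(** Removing one power multiplies the integral by [1 / K] up to an error [w], and errors made on the
    remaining factors are only shrunk by [1 / K]. *)
Lemma Rintegral_cell_prod_separated B : uniq (map fst B) -> (size B <= q)%N ->
  all (fun m => M <= m <= N)%N (map fst B) ->
  `|\int[mu]_(x in `[a, b]) cell_prod K B x - (b - a) * K%:R ^- size B| <= (size B)%:R * w.
Proof.
elim: B => [|[n u] B IH] /=.
  move=> _ _ _; under eq_Rintegral do rewrite /cell_prod big_nil.
  rewrite Rintegral_cst// fine_lebesgue_itvcc//.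
  by rewrite expr0 invr1 mul1r mulr1 subrr normr0 mul0r.
move=> /andP[nB uB] sB /andP[/andP[Mn nN] aB].
under eq_Rintegral do rewrite cell_prod_cons.
have h1 := IH uB (ltnW sB) aB.
have h2 : all (fun m => m <= N)%N (map fst B) by apply: sub_all aB => m /andP[].
have {}h2 := dec u Mn nN nB h2 sB.
rewrite exprS invfM (_ : (size B).+1%:R * w = (size B)%:R * w + w); last first.
  by rewrite -natr1 mulrDl mul1r.
move: h1 h2; move: (\int[mu]_(x in _) _) (\int[mu]_(x in _) _) => I2 I1 h1 h2.
have -> : I2 - (b - a) * (K%:R^-1 * K%:R ^- size B) =
  (I2 - K%:R^-1 * I1) + K%:R^-1 * (I1 - (b - a) * K%:R ^- size B) by ring.
apply: (le_trans (ler_normD _ _)); rewrite addrC lerD//.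
rewrite normrM (ger0_norm (_ : 0 <= K%:R^-1)) ?invr_ge0//.
by apply: le_trans h1; rewrite ler_piMl.
Qed.

Let err m : R := m%:R * (N.+1%:R * Cm) ^+ m * w.

(** A fresh index contributes [1 / K] times the integral, up to [w]. An index below [M] or already
    in [B] is bounded by the whole integral, and there are at most [M + q] of these; this is the
    origin of [Cm]. *)
Let cell_count_step u B : (size B < q)%N -> all (fun m => m <= N)%N (map fst B) ->
  \int[mu]_(x in `[a, b]) (cell_prod K B x * cell_count K N u x) <=
  Cm * \int[mu]_(x in `[a, b]) cell_prod K B x + N.+1%:R * w.
Proof.
move=> sB aB; set I := \int[mu]_(x in _) cell_prod K B x.
have I0 : 0 <= I by apply: Rintegral_ge0 => x _; exact: cell_prod_ge0.
have E x : cell_prod K B x * cell_count K N u x =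
  \sum_(n < N.+1) soft_cell K (x ^+ n - u) * cell_prod K B x.
  by rewrite /cell_count big_distrr /=; apply: eq_bigr => n _; rewrite mulrC.
under eq_Rintegral do rewrite E.
have cc n : continuous (fun x => soft_cell K (x ^+ n - u) * cell_prod K B x).
  move=> x; apply: cvgM; last exact: continuous_cell_prod.
  by apply: continuous_pow_sub; exact: continuous_soft_cell.
rewrite Rintegral_itv_sum//.
pose old (n : nat) := (n < M)%N || (n \in map fst B).
apply: (@le_trans _ _ (\sum_(n < N.+1) (K%:R^-1 * I + w + (old n)%:R * I))).
  apply: ler_sum => n _.
  have [on|] := boolP (old n).
    rewrite mul1r -[leLHS]add0r lerD//.
      by rewrite addr_ge0// mulr_ge0// invr_ge0.
    apply: le_Rintegral_itv => //; first exact: continuous_cell_prod.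
    by move=> x _; rewrite ler_piMl ?cell_prod_ge0// soft_cell_le1.
  rewrite /old negb_or -leqNgt => /andP[Mn nB].
  rewrite mul0r addr0.
  have := dec u Mn _ nB aB sB; rewrite -ltnS ltn_ord => /(_ isT).
  by rewrite -/I ler_distl => /andP[_].
rewrite big_split /= sumr_const card_ord -[X in X + _]mulr_natl.
have -> : \sum_(n < N.+1) (old n)%:R * I = (\sum_(n < N.+1) (old n)%:R) * I.
  by rewrite mulr_suml.
have cnt : \sum_(n < N.+1) (old n)%:R <= M%:R + q%:R :> R.
  rewrite -natrD -natr_sum ler_nat.
  have h (n : 'I_N.+1) : (old n <= (n < M) + (nat_of_ord n \in map fst B))%N.
    by rewrite /old; case: (_ < _)%N; case: (_ \in _).
  have h2 : (\sum_(n < N.+1) old n <= \sum_(n < N.+1) ((n < M) + (nat_of_ord n \in map fst B)))%N.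
    by apply: leq_sum => n _; exact: h.
  apply: (leq_trans h2).
  rewrite big_split /= leq_add ?sum_ltn_le//.
  by apply: (leq_trans (sum_mem_le _ _)); rewrite size_map ltnW.
rewrite mulrDr addrAC mulrA lerD2r -mulrDl ler_wpM2r//.
by apply: le_trans CmE; rewrite -addrA lerD2l.
Qed.

(** For an upper bound, repeated indices and indices below [M] are harmless. [B] is generalized
    because expanding the first count moves its index into [B]; after the induction hypothesis the
    count is reassembled and removed by [cell_count_step]. *)
Lemma Rintegral_cell_counts (us : seq R) B : (size B + size us <= q)%N ->
  all (fun m => m <= N)%N (map fst B) ->
  \int[mu]_(x in `[a, b]) (cell_prod K B x * \prod_(u <- us) cell_count K N u x) <=
  Cm ^+ size us * \int[mu]_(x in `[a, b]) cell_prod K B x +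
  (size us)%:R * (N.+1%:R * Cm) ^+ size us * w.
Proof.
elim: us B => [|u us IH] B sB aB.
  under eq_Rintegral do rewrite big_nil mulr1.
  by rewrite expr0 mul1r !mul0r addr0.
have cP B' (vs : seq R) : continuous (fun x => cell_prod K B' x * \prod_(u <- vs) cell_count K N u x).
  move=> x; apply: cvgM; first exact: continuous_cell_prod.
  by apply: continuous_prod => v; exact: continuous_cell_count.
have E x : cell_prod K B x * \prod_(u <- u :: us) cell_count K N u x =
    \sum_(n < N.+1) (cell_prod K ((n : nat, u) :: B) x * \prod_(u <- us) cell_count K N u x).
  rewrite big_cons {1}/cell_count mulrA -big_distrl /=; congr (_ * _).
  rewrite big_distrr /=; apply: eq_bigr => n _; by rewrite cell_prod_cons mulrC.
under eq_Rintegral do rewrite E.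
rewrite Rintegral_itv_sum//.
pose I n := \int[mu]_(x in `[a, b]) cell_prod K ((n, u) :: B) x.
apply: (@le_trans _ _ (\sum_(n < N.+1) (Cm ^+ size us * I n + err (size us)))).
  apply: ler_sum => n _; apply: IH; first by rewrite /= addSn -addnS.
  by rewrite /= aB andbT -ltnS.
rewrite big_split /= sumr_const card_ord -big_distrr /=.
have -> : \sum_(n < N.+1) I n = \int[mu]_(x in `[a, b]) (cell_prod K B x * cell_count K N u x).
  rewrite /I -Rintegral_itv_sum; last by move=> n; exact: continuous_cell_prod.
  apply: eq_Rintegral => x _; rewrite /cell_count big_distrr /=.
  by apply: eq_bigr => n _; rewrite cell_prod_cons mulrC.
have sB' : (size B < q)%N by move: sB => /=; lia.
have Cm0 : 0 <= Cm by apply: le_trans Cm1.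
have Cmp m : 0 <= Cm ^+ m by rewrite exprn_ge0.
have := ler_wpM2l (Cmp (size us)) (cell_count_step u sB' aB).
move: (\int[mu]_(x in _) _) (\int[mu]_(x in _) _) => I2 I1 h.
apply: (@le_trans _ _ (Cm ^+ size us * (Cm * I2 + N.+1%:R * w) + err (size us) *+ N.+1)).
  by rewrite lerD2r.
have NR1 : 1 <= N.+1%:R :> R by rewrite ler1n.
rewrite /err /= !exprS -[X in _ + X <= _]mulr_natl -(natr1 (size us)).
have YX : Cm ^+ size us <= (N.+1%:R * Cm) ^+ size us.
  rewrite exprMn ler_peMl//; exact: exprn_ege1.
have s0 : 0 <= (size us)%:R :> R by [].
have := Cmp (size us); move: (Cm ^+ size us) ((N.+1%:R * Cm) ^+ size us) YX => Y X YX Y0.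
have z0 : 0 <= N.+1%:R * w by rewrite mulr_ge0.
have X0 : 0 <= X by apply: le_trans YX.
have CX : X <= Cm * X by rewrite ler_peMl.
move: (size us)%:R s0 => s s0.
apply: (@le_trans _ _ (Cm * Y * I2 +
    (Cm * X * (N.+1%:R * w) + s * (Cm * X) * (N.+1%:R * w)))); last first.
  by rewrite le_eqVlt; apply/orP; left; apply/eqP; ring.
rewrite mulrDr mulrA (mulrC Y) -addrA lerD2l lerD//.
  by rewrite ler_wpM2r//; exact: (le_trans YX).
rewrite [leLHS](_ : _ = s * X * (N.+1%:R * w)); last by ring.
by rewrite ler_wpM2r// ler_wpM2l.
Qed.

End list_moments.

Section counting.
Context {R : realType}.

Lemma sum_prod_cond k n (p : pred 'I_n) (i : 'I_k) (F : 'I_k -> 'I_n -> R) :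
  \sum_(z : {ffun 'I_k -> 'I_n} | p (z i)) \prod_l F l (z l) =
  (\sum_(m | p m) F i m) * \prod_(l | l != i) \sum_m F l m.
Proof.
transitivity (\prod_l \sum_(m | (l == i) ==> p m) F l m); last first.
  rewrite (bigD1 i) //=; congr (_ * _).
    by apply: eq_bigl => m; rewrite eqxx.
  by apply: eq_bigr => l li; apply: eq_bigl => m; rewrite (negbTE li).
rewrite (bigA_distr_big_dep (fun (l : 'I_k) (m : 'I_n) => (l == i) ==> p m)).
apply: eq_bigl => z; apply/idP/familyP => [pz l|/(_ i)].
  by rewrite unfold_in; case: eqP => [->|].
by rewrite unfold_in eqxx.
Qed.

Lemma sum_weights (I Z : finType) (A p : Z -> Z -> R) (B : I -> Z -> Z -> R)
    (C : I -> I -> Z -> Z -> R) :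
  \sum_z \sum_z' (A z z' + \sum_i B i z z' + \sum_i \sum_j C i j z z') * p z z' =
  \sum_z \sum_z' A z z' * p z z' + \sum_i \sum_z \sum_z' B i z z' * p z z' +
  \sum_i \sum_j \sum_z \sum_z' C i j z z' * p z z'.
Proof.
have swap J (F : J -> Z -> Z -> R) (r : seq J) :
    \sum_z \sum_z' \sum_(i <- r) F i z z' = \sum_(i <- r) \sum_z \sum_z' F i z z'.
  transitivity (\sum_z \sum_(i <- r) \sum_z' F i z z'); last exact: exchange_big.
  by apply: eq_bigr => z _; exact: exchange_big.
transitivity (\sum_z \sum_z' (A z z' * p z z' + \sum_i B i z z' * p z z' +
    \sum_i \sum_j C i j z z' * p z z')).
  apply: eq_bigr => z _; apply: eq_bigr => z' _; rewrite !mulrDl !mulr_suml.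
  by congr (_ + _); apply: eq_bigr => i _; rewrite mulr_suml.
transitivity (\sum_z (\sum_z' A z z' * p z z' + \sum_z' \sum_i B i z z' * p z z' +
    \sum_z' \sum_i \sum_j C i j z z' * p z z')).
  by apply: eq_bigr => z _; rewrite !big_split.
rewrite !big_split /= !swap; congr (_ + _).
by apply: eq_bigr => i _; rewrite swap.
Qed.

(** With [M = 1] these are the tuples of the correlation sum; with a larger cutoff they are the
    tuples to which decoupling applies. *)
Definition good_maps k N M : {set {ffun 'I_k -> 'I_N.+1}} :=
  [set z : {ffun 'I_k -> 'I_N.+1} in ffun_on [pred n : 'I_N.+1 | (M <= n)%N] | injectiveb z].

Lemma good_mapsP k N M (z : {ffun 'I_k -> 'I_N.+1}) :
  reflect ((forall i, M <= z i)%N /\ injective z) (z \in good_maps k N M).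
Proof.
rewrite inE; apply: (iffP andP) => -[h1 /injectiveP h2]; split => //.
  by move=> i; move/ffun_onP : h1 => /(_ i).
by apply/ffun_onP => i; rewrite inE.
Qed.

Lemma card_good_maps k N M : #|good_maps k N M| = ((N.+1 - M) ^_ k)%N.
Proof.
rewrite card_inj_ffuns_on card_ord; congr (_ ^_ _).
rewrite -sum1_card (eq_bigl (fun n : 'I_N.+1 => (M <= n)%N)) //.
transitivity (\sum_(M <= i < N.+1) 1)%N; last by rewrite sum_nat_const_nat muln1.
by rewrite (big_nat_widenl M 0)//= big_mkord.
Qed.

Lemma ffact_le_expn n k : (n ^_ k <= n ^ k)%N.
Proof.
rewrite ffact_prod -[X in (_ <= _ ^ X)%N]card_ord -prod_nat_const.
by apply: leq_prod => i _; exact: leq_subr.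
Qed.

(** Excluding [e] indices and repetitions loses only a term of lower order [N ^ (k - 1)]. *)
Lemma expn_le_ffact N e k : (N ^ k <= (N - e) ^_ k + k * ((e + k) * N ^ k.-1))%N.
Proof.
elim: k => [|k IH]; first by rewrite ffactn0.
rewrite ffactnSr /= mulSn addnA.
case: k IH => [|k] IH; first by rewrite !expn0 ffactn0 mul1n mul0n !muln1; lia.
have h1 : ((N - e) ^_ k.+1 <= N ^ k.+1)%N.
  by apply: (leq_trans (ffact_le_expn _ _)); rewrite leq_exp2r// leq_subr.
have h2 : (N <= (N - e - k.+1) + (e + k.+2))%N by lia.
rewrite /= in IH h1 *; rewrite !expnS in IH h1 *.
set F := ((N - e) ^_ k.+1)%N in IH h1 *; set g := (N - e - k.+1)%N in h2 *.
set Y := (N ^ k)%N in IH h1 *.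
have p1 := leq_mul (leqnn N) IH.
have p2 := leq_mul h2 (leqnn F).
have p3 := leq_mul (leqnn (e + k.+2)) h1.
move: p1 p2 p3; clearbody F g Y => p1 p2 p3; clear -p1 p2 p3.
nia.
Qed.

End counting.

Lemma eq_ler (R : realFieldType) (x y : R) : x = y -> x <= y.
Proof. by move=> ->. Qed.

(** Here [I1] and [I2] are the first two moments, [n = N ^ k], [kap = K ^- k], [y = N ^ (k - 1)],
    [g] counts the good maps and [d] is the length of the interval. When the square is expanded, the
    terms of order [K ^ 2] cancel up to a multiple of [n - g], which is at most [k (M + k) y]. *)
Lemma variance_arith (R : realFieldType)
    (K N M k C d w I1 I2 n kap g y Cp c1 c2 er1 er2 E : R) :
  1 <= k -> 2 <= K -> 0 <= M -> 0 <= N -> N <= 2 * K -> M + 2 * k <= C ->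
  0 <= d -> 0 <= w -> 0 <= kap -> 0 <= n -> 0 <= g -> g <= n -> n * kap <= 1 ->
  K * kap * y <= 1 -> 0 <= y -> n <= g + k * ((M + k) * y) -> 0 <= Cp -> C <= Cp ->
  M * c1 <= Cp -> c2 <= Cp -> er1 <= 2 * k * E * w -> er2 <= 2 * k * E * w ->
  n <= E -> n ^+ 2 <= E ->
  K * (g * (d * kap - k * w)) <= I1 ->
  I2 <= K ^+ 2 * (n ^+ 2 * (d * kap ^+ 2 + 2 * k * w)) +
    2 * k * (K * (M * (c1 * d + K * er1))) + k ^+ 2 * (N * (c2 * d + K ^+ 2 * er2)) ->
  I2 + (- (2 * (K * (n * kap))) * I1 + (K * (n * kap)) ^+ 2 * d) <=
  8 * k ^+ 2 * d * K * Cp + 12 * k ^+ 3 * (E * (8 * K ^+ 3 * C ^+ 3)) * w.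
Proof.
move=> k1 K2 M0 N0 NK MC d0 w0 kap0 n0 g0 gn nk1 Ky1 y0 ngy Cp0 CCp Mc1 c2Cp e1 e2 nE n2E hI1 hI2.
have k0 : 0 <= k by exact: le_trans k1.
have K0 : 0 <= K by apply: le_trans K2.
have E0 : 0 <= E by exact: le_trans nE.
have C1 : 1 <= C by apply: le_trans MC; clear -M0 k1; lra.
have nk0 : 0 <= n * kap by rewrite mulr_ge0.
have main : 2 * K ^+ 2 * kap ^+ 2 * n * d * (n - g) <= 2 * k * d * K * Cp.
  apply: (@le_trans _ _ (2 * K ^+ 2 * kap ^+ 2 * n * d * (k * ((M + k) * y)))).
    by rewrite ler_wpM2l ?mulr_ge0 ?sqr_ge0//; clear -ngy; lra.
  rewrite (_ : _ * _ = 2 * k * d * K * (M + k) * ((n * kap) * (K * kap * y))); last by ring.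
  have Mk0 : 0 <= M + k by rewrite addr_ge0.
  apply: (@le_trans _ _ (2 * k * d * K * (M + k) * 1)).
    rewrite ler_wpM2l ?mulr_ge0//; apply: mulr_ile1 => //.
    by rewrite !mulr_ge0.
  rewrite mulr1 ler_wpM2l ?mulr_ge0//; apply: le_trans CCp; apply: le_trans MC.
  by rewrite lerD2l; clear -k0; lra.
have second : 2 * k * (K * (M * (c1 * d))) <= 2 * k * d * K * Cp.
  rewrite (_ : _ * _ = 2 * k * d * K * (M * c1)); last by ring.
  by rewrite ler_wpM2l ?mulr_ge0.
have third : k ^+ 2 * (N * (c2 * d)) <= 2 * k ^+ 2 * d * K * Cp.
  apply: (@le_trans _ _ (k ^+ 2 * ((2 * K) * (Cp * d)))); last by apply: eq_ler; ring.
  rewrite ler_wpM2l ?sqr_ge0//; apply: (@le_trans _ _ (N * (Cp * d))).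
    by rewrite ler_wpM2l// ler_wpM2r.
  by rewrite ler_wpM2r ?mulr_ge0.
have kk2 : k <= k ^+ 2 by rewrite expr2 ler_peMl.
have k2k3 : k ^+ 2 <= k ^+ 3 by rewrite [leRHS]exprS ler_peMl ?sqr_ge0.
have Dsum : 2 * k * d * K * Cp + 2 * k * d * K * Cp + 2 * k ^+ 2 * d * K * Cp <=
    8 * k ^+ 2 * d * K * Cp.
  have X0 : 0 <= d * K * Cp by rewrite !mulr_ge0.
  have h : k * (d * K * Cp) <= k ^+ 2 * (d * K * Cp) by rewrite ler_wpM2r.
  have h2 : 0 <= k ^+ 2 * (d * K * Cp) by rewrite mulr_ge0 ?sqr_ge0.
  by move: h h2; clear => *; lra.
(* A common unit for the contributions of the decoupling error [w]: each of the four is at most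
   [2 * q] or [4 * q]. *)
pose q := k ^+ 3 * (E * (K ^+ 3 * C ^+ 3)) * w.
have C3 : 1 <= C ^+ 3 by exact: exprn_ege1.
have CC3 : C <= C ^+ 3 by rewrite -[leLHS]expr1 ler_weXn2l.
have K1 : 1 <= K by apply: le_trans K2; clear; lra.
have K23 : K ^+ 2 <= K ^+ 3 by rewrite ler_weXn2l.
have kk3 : k <= k ^+ 3 by exact: le_trans k2k3.
have mono k' K' C' : 0 <= k' -> k' <= k ^+ 3 -> 0 <= K' -> K' <= K ^+ 3 ->
    0 <= C' -> C' <= C ^+ 3 -> k' * (E * (K' * C')) * w <= q.
  move=> *; rewrite /q ler_wpM2r//; apply: ler_pM => //; first by rewrite !mulr_ge0.
  by rewrite ler_wpM2l//; apply: ler_pM.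
have w1 : 2 * k * w * K ^+ 2 * n ^+ 2 <= 2 * q.
  apply: (@le_trans _ _ (2 * (k * (E * (K ^+ 2 * 1)) * w))).
    rewrite (_ : _ * n ^+ 2 = 2 * (k * (n ^+ 2 * (K ^+ 2 * 1)) * w)); last by ring.
    rewrite ler_wpM2l// ler_wpM2r// ler_wpM2l// ler_wpM2r//.
    by rewrite mulr1 sqr_ge0.
  by rewrite ler_wpM2l// mono ?sqr_ge0.
have w2 : 2 * K ^+ 2 * (n * kap) * g * k * w <= 2 * q.
  apply: (@le_trans _ _ (2 * (k * (E * (K ^+ 2 * 1)) * w))); last first.
    by rewrite ler_wpM2l// mono ?sqr_ge0.
  rewrite (_ : _ * w = 2 * (k * ((n * kap * g) * (K ^+ 2 * 1)) * w)); last by ring.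
  rewrite ler_wpM2l// ler_wpM2r// ler_wpM2l// ler_wpM2r ?mulr1 ?sqr_ge0//.
  by apply: le_trans nE; apply: le_trans gn; rewrite ler_piMl.
have w3 : 2 * k * (K * (M * (K * er1))) <= 4 * q.
  apply: (@le_trans _ _ (4 * (k ^+ 2 * (E * (K ^+ 2 * M)) * w))); last first.
    rewrite ler_wpM2l// mono ?sqr_ge0//; apply: le_trans CC3; apply: le_trans MC.
    by rewrite lerDl mulr_ge0.
  rewrite (_ : 4 * _ = 2 * k * (K * (M * (K * (2 * k * E * w))))); last by ring.
  by rewrite !ler_wpM2l ?mulr_ge0.
have w4 : k ^+ 2 * (N * (K ^+ 2 * er2)) <= 4 * q.
  apply: (@le_trans _ _ (4 * (k ^+ 3 * (E * (K ^+ 3 * 1)) * w))); last first.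
    by rewrite ler_wpM2l// mono ?exprn_ge0.
  rewrite (_ : 4 * _ = k ^+ 2 * ((2 * K) * (K ^+ 2 * (2 * k * E * w)))); last by ring.
  rewrite ler_wpM2l ?sqr_ge0//; apply: (@le_trans _ _ (N * (K ^+ 2 * (2 * k * E * w)))).
    by rewrite ler_wpM2l// ler_wpM2l ?sqr_ge0.
  by rewrite ler_wpM2r// !mulr_ge0 ?sqr_ge0.
have q0 : 0 <= q by rewrite !mulr_ge0 ?exprn_ge0//; apply: le_trans C1.
have h1 : 2 * (K * (n * kap)) * (K * (g * (d * kap - k * w))) <= 2 * (K * (n * kap)) * I1.
  by rewrite ler_wpM2l ?mulr_ge0.
have -> : 12 * k ^+ 3 * (E * (8 * K ^+ 3 * C ^+ 3)) * w = 96 * q by rewrite /q; ring.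
apply: (@le_trans _ _ ((2 * K ^+ 2 * kap ^+ 2 * n * d * (n - g) + 2 * k * (K * (M * (c1 * d)))
   + k ^+ 2 * (N * (c2 * d))) + (2 * k * w * K ^+ 2 * n ^+ 2
   + 2 * K ^+ 2 * (n * kap) * g * k * w + 2 * k * (K * (M * (K * er1)))
   + k ^+ 2 * (N * (K ^+ 2 * er2))))).
  apply: (@le_trans _ _ ((K ^+ 2 * (n ^+ 2 * (d * kap ^+ 2 + 2 * k * w)) +
    2 * k * (K * (M * (c1 * d + K * er1))) + k ^+ 2 * (N * (c2 * d + K ^+ 2 * er2))) +
    (- (2 * (K * (n * kap)) * (K * (g * (d * kap - k * w)))) + (K * (n * kap)) ^+ 2 * d))).
    by rewrite lerD// lerD2r mulNr lerN2.
  by apply: eq_ler; ring.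
apply: lerD.
  by apply: le_trans Dsum; rewrite lerD// lerD.
move: w1 w2 w3 w4 q0; clear.
by move=> *; lra.
Qed.

(** * Variance of the smoothed number of tuples in a pattern of cells *)

Section correlation_variance.
Context {R : realType}.
Notation mu := (@lebesgue_measure R).
Implicit Types (x y t u : R) (n : nat) (B : seq (nat * R)).

Definition hit K k (v : 'I_k -> R) N (z : {ffun 'I_k -> 'I_N.+1}) t x : R :=
  \prod_(i < k) soft_cell K (x ^+ z i - (t + v i)).

(** A smoothed number of tuples of distinct positive indices whose points form the pattern [v]; the
    sum over [c] slides the pattern around the circle. *)
Definition cell_corr K k (v : 'I_k -> R) N x : R :=
  \sum_(c < K) \sum_(z in good_maps k N 1) hit K v z (c%:R / K%:R) x.

Lemma hitE K k (v : 'I_k -> R) N (z : {ffun 'I_k -> 'I_N.+1}) t x :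
  hit K v z t x = cell_prod K [seq (nat_of_ord (z i), t + v i) | i <- enum 'I_k] x.
Proof. by rewrite /cell_prod big_map big_enum. Qed.

Lemma hit_ge0 K k (v : 'I_k -> R) N (z : {ffun 'I_k -> 'I_N.+1}) t x : 0 <= hit K v z t x.
Proof. by rewrite hitE cell_prod_ge0. Qed.

Lemma continuous_hit K k (v : 'I_k -> R) N (z : {ffun 'I_k -> 'I_N.+1}) t :
  continuous (hit K v z t).
Proof.
rewrite (_ : hit K v z t = cell_prod K [seq (nat_of_ord (z i), t + v i) | i <- enum 'I_k]).
  exact: continuous_cell_prod.
by apply/funext => x; rewrite hitE.
Qed.

Lemma continuous_cell_corr K k (v : 'I_k -> R) N : continuous (cell_corr K v N).
Proof.
apply: continuous_sum => c; apply: continuous_sum => z; exact: continuous_hit.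
Qed.

Variables (a b w Cm : R) (K N M k : nat) (v : 'I_k -> R).
Hypothesis ab : a <= b.
Hypothesis K1 : (1 < K)%N.
Hypothesis M0 : (0 < M)%N.
Hypothesis w0 : 0 <= w.
Hypothesis Cm1 : 1 <= Cm.
Hypothesis CmE : N.+1%:R / K%:R + M%:R + (k + k)%:R <= Cm.
Hypothesis dec : forall n u B, (M <= n)%N -> (n <= N)%N -> n \notin map fst B ->
  all (fun m => m <= N)%N (map fst B) -> (size B < k + k)%N ->
  `|\int[mu]_(x in `[a, b]) (soft_cell K (x ^+ n - u) * cell_prod K B x) -
    K%:R^-1 * \int[mu]_(x in `[a, b]) cell_prod K B x| <= w.

Let K0 : 0 < K%:R :> R. Proof. by rewrite ltr0n ltnW. Qed.

Let hitK := @hit K k v N.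

Lemma Rintegral_hit z t : z \in good_maps k N M ->
  `|\int[mu]_(x in `[a, b]) hitK z t x - (b - a) * K%:R ^- k| <= k%:R * w.
Proof.
move=> /good_mapsP[zM zinj].
under eq_Rintegral do rewrite /hitK hitE.
have := Rintegral_cell_prod_separated ab K1 dec.
move=> /(_ [seq (nat_of_ord (z i), t + v i) | i <- enum 'I_k]).
rewrite size_map size_enum_ord; apply.
- rewrite -map_comp map_inj_uniq ?enum_uniq// => i j /= /val_inj; exact: zinj.
- by rewrite leq_addr.
- by apply/allP => n; rewrite -map_comp => /mapP[i _ ->] /=; rewrite zM -ltnS ltn_ord.
Qed.

(** The pairs whose combined indices satisfy [Rintegral_cell_prod_separated]; any other pair of
    tuples has an index below [M] or a common index. *)
Definition good_pair (z z' : {ffun 'I_k -> 'I_N.+1}) :=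
  [&& z \in good_maps k N M, z' \in good_maps k N M & [forall i, forall j, z i != z' j]].

Lemma Rintegral_hit_pair z z' t t' : good_pair z z' ->
  `|\int[mu]_(x in `[a, b]) (hitK z t x * hitK z' t' x) - (b - a) * K%:R ^- (k + k)| <=
  (k + k)%:R * w.
Proof.
move=> /and3P[/good_mapsP[zM zinj] /good_mapsP[zM' zinj'] /forallP zz'].
pose B := [seq (nat_of_ord (z i), t + v i) | i <- enum 'I_k] ++
   [seq (nat_of_ord (z' i), t' + v i) | i <- enum 'I_k].
have E x : hitK z t x * hitK z' t' x = cell_prod K B x.
  by rewrite /hitK !hitE /cell_prod big_cat.
under eq_Rintegral do rewrite E.
have := Rintegral_cell_prod_separated ab K1 dec (B := B).
have sz (f : 'I_k -> nat * R) : size [seq f i | i <- enum 'I_k] = k.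
  by rewrite size_map size_enum_ord.
have fstE (y : {ffun 'I_k -> 'I_N.+1}) s :
  map fst [seq (nat_of_ord (y i), s + v i) | i <- enum 'I_k] = [seq nat_of_ord (y i) | i <- enum 'I_k].
  by rewrite -map_comp.
rewrite /B size_cat !sz map_cat !fstE; apply => //.
- rewrite cat_uniq; apply/and3P; split.
  + by rewrite map_inj_uniq ?enum_uniq// => i j /= /val_inj; exact: zinj.
  + apply/hasPn => n /mapP[j _ ->] /=; apply/negP => /mapP[i _ /val_inj].
    by move/eqP; apply/negP; rewrite eq_sym; move/forallP: (zz' i).
  + by rewrite map_inj_uniq ?enum_uniq// => i j /= /val_inj; exact: zinj'.
- apply/allP => n; rewrite mem_cat.
  by case/orP => /mapP[i _ ->] /=; rewrite ?zM ?zM' -ltnS ltn_ord.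
Qed.

Let err m : R := m%:R * (N.+1%:R * Cm) ^+ m * w.
Let T n u x : R := soft_cell K (x ^+ n - u).
Let X u x : R := cell_count K N u x.
Let center (c : 'I_K) : R := c%:R / K%:R.

(** The source of the saving in the variance: a sum over base cells that meets such a factor costs 1
    and not [K]. *)
Let sum_T_center n y x : \sum_(c < K) T n (center c + y) x = 1.
Proof.
rewrite -[RHS](sum_soft_cell (x ^+ n - y) K1); apply: eq_bigr => c _.
by rewrite /T /center; congr soft_cell; ring.
Qed.

Let continuous_T n u : continuous (T n u).
Proof. by apply: continuous_pow_sub; exact: continuous_soft_cell. Qed.

Let rest (i : 'I_k) t x : R := \prod_(l | l != i) X (t + v l) x.
Let full t x : R := \prod_l X (t + v l) x.

Let sum_hit t x : \sum_(z : {ffun 'I_k -> 'I_N.+1}) hitK z t x = full t x.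
Proof. by rewrite /full /X /cell_count bigA_distr_bigA. Qed.

Let sum_hit_cond (p : pred 'I_N.+1) (i : 'I_k) t x :
  \sum_(z : {ffun 'I_k -> 'I_N.+1} | p (z i)) hitK z t x =
  (\sum_(n < N.+1 | p n) T n (t + v i) x) * rest i t x.
Proof. by rewrite /hitK /hit (sum_prod_cond p i (fun l (n : 'I_N.+1) => T n (t + v l) x)). Qed.

Let sum_pair_eq (i j : 'I_k) t t' x :
  \sum_(z : {ffun 'I_k -> 'I_N.+1}) \sum_(z' : {ffun 'I_k -> 'I_N.+1} | z' j == z i) (hitK z t x * hitK z' t' x) =
  \sum_(n < N.+1) T n (t + v i) x * T n (t' + v j) x * (rest i t x * rest j t' x).
Proof.
rewrite (partition_big (fun z : {ffun 'I_k -> 'I_N.+1} => z i) (@predT 'I_N.+1)) //=.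
apply: eq_bigr => n _.
transitivity (\sum_(z : {ffun 'I_k -> 'I_N.+1} | z i == n) hitK z t x *
    \sum_(z' : {ffun 'I_k -> 'I_N.+1} | z' j == n) hitK z' t' x).
  by apply: eq_bigr => z /eqP ->; rewrite big_distrr.
rewrite -big_distrl /= (sum_hit_cond (pred1 n)) (sum_hit_cond (pred1 n)) !big_pred1_eq.
by ring.
Qed.

Let continuous_rest i t : continuous (rest i t).
Proof.
rewrite (_ : rest i t = fun x => \prod_(u <- [seq t + v l | l <- enum 'I_k & l != i]) X u x).
  by apply: continuous_prod => u; exact: continuous_cell_count.
by apply/funext => x; rewrite big_map big_filter big_enum_cond.
Qed.

Let continuous_full t : continuous (full t).
Proof. by apply: continuous_prod => u; exact: continuous_cell_count. Qed.

Let restE i t x :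
  \prod_(u <- [seq t + v l | l <- enum 'I_k & l != i]) cell_count K N u x = rest i t x.
Proof. by rewrite big_map big_filter big_enum_cond. Qed.

Let fullE t x : \prod_(u <- [seq t + v l | l <- enum 'I_k]) cell_count K N u x = full t x.
Proof. by rewrite big_map big_enum. Qed.

Let size_rest i t : size [seq t + v l | l <- enum 'I_k & l != i] = k.-1.
Proof.
rewrite size_map size_filter -sum1_count big_enum_cond /=.
rewrite sum1_card (eq_card (B := predC1 i)) ?cardC1 ?card_ord//.
Qed.

Let k0 (i : 'I_k) : (0 < k)%N. Proof. exact: leq_ltn_trans (ltn_ord i). Qed.

(** The exceptional index is kept as the one-element list [B]; the other [2 k - 1] places are full
    counts, each paid for by [Cm]. *)
Let small_sum (i : 'I_k) t t' :
  \int[mu]_(x in `[a, b]) ((\sum_(n < N.+1 | (n < M)%N) T n (t + v i) x) * (rest i t x * full t' x)) <=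
  \sum_(n < N.+1 | (n < M)%N) (Cm ^+ (k + k).-1 * \int[mu]_(x in `[a, b]) T n (t + v i) x + err (k + k).-1).
Proof.
have E x : (\sum_(n < N.+1 | (n < M)%N) T n (t + v i) x) * (rest i t x * full t' x) =
   \sum_(n < N.+1) (n < M)%:R * (T n (t + v i) x * (rest i t x * full t' x)).
  rewrite big_distrl /= big_mkcond /=; apply: eq_bigr => n _.
  by case: (_ < _)%N; rewrite ?mul1r ?mul0r.
under eq_Rintegral do rewrite E.
have cc n : continuous (fun x => T n (t + v i) x * (rest i t x * full t' x)).
  move=> x; apply: cvgM; first exact: continuous_T.
  by apply: cvgM; [exact: continuous_rest|exact: continuous_full].
rewrite Rintegral_itv_sum; last first.
  by move=> n x; apply: cvgM; [exact: cvg_cst|exact: cc].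
rewrite [leRHS]big_mkcond /=; apply: ler_sum => n _.
rewrite Rintegral_itvZ//; case: (_ < _)%N; rewrite ?mul0r// mul1r.
pose us := [seq t + v l | l <- enum 'I_k & l != i] ++ [seq t' + v l | l <- enum 'I_k].
have sus : size us = (k + k).-1.
  by rewrite size_cat size_rest size_map size_enum_ord; have := k0 i; lia.
have := Rintegral_cell_counts ab K1 w0 Cm1 CmE dec (us := us) (B := [:: (nat_of_ord n, t + v i)]).
rewrite sus /=.
have cp x : cell_prod K [:: (nat_of_ord n, t + v i)] x = T n (t + v i) x.
  by rewrite /cell_prod big_seq1.
under eq_Rintegral do rewrite cp.
under [X in _ -> _ -> _ <= _ * X + _]eq_Rintegral do rewrite cp.
move=> H; apply: (le_trans _ (H _ _)).
- rewrite le_eqVlt; apply/orP; left; apply/eqP; apply: eq_Rintegral => x _.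
  by rewrite /us big_cat /= restE fullE.
- by have := k0 i; lia.
- by rewrite andbT -ltnS.
Qed.

(** The two places with a common index form a list [B] with a repeated exponent, which
    [Rintegral_cell_counts] admits; [2 k - 2] counts remain. *)
Let equal_sum (i j : 'I_k) t t' :
  \int[mu]_(x in `[a, b]) (\sum_(n < N.+1) T n (t + v i) x * T n (t' + v j) x * (rest i t x * rest j t' x)) <=
  \sum_(n < N.+1) (Cm ^+ (k + k).-2 * \int[mu]_(x in `[a, b]) (T n (t + v i) x * T n (t' + v j) x) + err (k + k).-2).
Proof.
have cc n : continuous (fun x => T n (t + v i) x * T n (t' + v j) x * (rest i t x * rest j t' x)).
  move=> x; apply: cvgM; first by apply: cvgM; exact: continuous_T.
  by apply: cvgM; exact: continuous_rest.
rewrite Rintegral_itv_sum//; apply: ler_sum => n _.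
pose us := [seq t + v l | l <- enum 'I_k & l != i] ++ [seq t' + v l | l <- enum 'I_k & l != j].
have sus : size us = (k + k).-2.
  by rewrite size_cat !size_rest; have := k0 i; lia.
pose B := [:: (nat_of_ord n, t + v i); (nat_of_ord n, t' + v j)].
have := Rintegral_cell_counts ab K1 w0 Cm1 CmE dec (us := us) (B := B).
rewrite sus /=.
have cp x : cell_prod K B x = T n (t + v i) x * T n (t' + v j) x.
  by rewrite /cell_prod /B big_cons big_seq1.
under eq_Rintegral do rewrite cp.
under [X in _ -> _ -> _ <= _ * X + _]eq_Rintegral do rewrite cp.
move=> H; apply: (le_trans _ (H _ _)).
- rewrite le_eqVlt; apply/orP; left; apply/eqP; apply: eq_Rintegral => x _.
  by rewrite /us big_cat /= !restE.
- by have := k0 i; lia.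
- by rewrite andbT -ltnS ltn_ord.
Qed.

Let small_weight (i : 'I_k) t t' x :
  \sum_(z : {ffun 'I_k -> 'I_N.+1}) \sum_(z' : {ffun 'I_k -> 'I_N.+1})
     (z i < M)%:R * (hitK z t x * hitK z' t' x) =
  (\sum_(n < N.+1 | (n < M)%N) T n (t + v i) x) * (rest i t x * full t' x).
Proof.
rewrite mulrA -sum_hit -(sum_hit_cond (fun n : 'I_N.+1 => (n < M)%N)) big_distrl /= [RHS]big_mkcond /=.
apply: eq_bigr => z _; case: (z i < M)%N.
  by rewrite big_distrr; apply: eq_bigr => z' _; rewrite mul1r.
by rewrite big1// => z' _; rewrite mul0r.
Qed.

Let small_weight' (i : 'I_k) t t' x :
  \sum_(z : {ffun 'I_k -> 'I_N.+1}) \sum_(z' : {ffun 'I_k -> 'I_N.+1})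
     (z' i < M)%:R * (hitK z t x * hitK z' t' x) =
  (\sum_(n < N.+1 | (n < M)%N) T n (t' + v i) x) * (rest i t' x * full t x).
Proof.
rewrite -small_weight exchange_big; apply: eq_bigr => z _; apply: eq_bigr => z' _.
by congr (_ * _); rewrite mulrC.
Qed.

Let equal_weight (i j : 'I_k) t t' x :
  \sum_(z : {ffun 'I_k -> 'I_N.+1}) \sum_(z' : {ffun 'I_k -> 'I_N.+1})
     (z' j == z i)%:R * (hitK z t x * hitK z' t' x) =
  \sum_(n < N.+1) T n (t + v i) x * T n (t' + v j) x * (rest i t x * rest j t' x).
Proof.
rewrite -sum_pair_eq; apply: eq_bigr => z _; rewrite [RHS]big_mkcond /=.
by apply: eq_bigr => z' _; case: eqP; rewrite ?mul1r ?mul0r.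
Qed.

Let good_part t t' x : R :=
  \sum_(z : {ffun 'I_k -> 'I_N.+1}) \sum_(z' : {ffun 'I_k -> 'I_N.+1})
     (good_pair z z')%:R * (hitK z t x * hitK z' t' x).

Let small_part (i : 'I_k) t t' x : R :=
  (\sum_(n < N.+1 | (n < M)%N) T n (t + v i) x) * (rest i t x * full t' x).

Let equal_part (i j : 'I_k) t t' x : R :=
  \sum_(n < N.+1) T n (t + v i) x * T n (t' + v j) x * (rest i t x * rest j t' x).

Let weights z z' : z \in good_maps k N 1 -> z' \in good_maps k N 1 ->
  1 <= (good_pair z z')%:R + \sum_(i < k) ((z i < M)%:R + (z' i < M)%:R)
    + \sum_(i < k) \sum_(j < k) (z' j == z i)%:R :> R.
Proof.
move=> /good_mapsP[_ zi] /good_mapsP[_ zi'].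
have s1 : 0 <= \sum_(i < k) ((z i < M)%:R + (z' i < M)%:R) :> R.
  by apply: sumr_ge0 => i _; rewrite addr_ge0.
have s2 : 0 <= \sum_(i < k) \sum_(j < k) (z' j == z i)%:R :> R.
  by apply: sumr_ge0 => i _; apply: sumr_ge0.
have [_|] := boolP (good_pair z z'); first by rewrite -addrA lerDl addr_ge0.
rewrite /good_pair !negb_and add0r.
have small i : ((z i < M)%N || (z' i < M)%N) ->
    1 <= \sum_(i < k) ((z i < M)%:R + (z' i < M)%:R) :> R.
  move=> h; rewrite (bigD1 i) //= -[leLHS]addr0 lerD//; last first.
    by apply: sumr_ge0 => l _; rewrite addr_ge0.
  by case/orP: h => ->; rewrite ?lerDl ?lerDr.
case/or3P => [zM|zM|].
- have [i zi_lt] : exists i, (z i < M)%N.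
    apply/existsP; apply: contraNT zM => /existsPn h; apply/good_mapsP; split => // i.
    by rewrite leqNgt h.
  by rewrite -[leLHS]addr0 lerD// (small i) ?zi_lt.
- have [i zi_lt] : exists i, (z' i < M)%N.
    apply/existsP; apply: contraNT zM => /existsPn h; apply/good_mapsP; split => // i.
    by rewrite leqNgt h.
  by rewrite -[leLHS]addr0 lerD// (small i) ?zi_lt ?orbT.
move=> /forallPn[i /forallPn[j]]; rewrite negbK => /eqP zij.
rewrite -[leLHS]add0r lerD// (bigD1 i) //= (bigD1 j) //= zij eqxx.
rewrite -addrA lerDl addr_ge0//; first by apply: sumr_ge0.
by apply: sumr_ge0 => l _; apply: sumr_ge0.
Qed.

Let U := @cell_corr K k v N.

(** The weights are extended from good maps to all maps. Without the injectivity condition, the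
    parts with a small or a common index factor into products of cell counts. *)
Let sqr_corr_le x : U x ^+ 2 <= \sum_(c < K) \sum_(c' < K)
  (good_part (center c) (center c') x +
   \sum_(i < k) (small_part i (center c) (center c') x + small_part i (center c') (center c) x) +
   \sum_(i < k) \sum_(j < k) equal_part i j (center c) (center c') x).
Proof.
rewrite /U /cell_corr expr2 big_distrl /=; apply: ler_sum => c _.
rewrite big_distrr /=; apply: ler_sum => c' _.
set t := center c; set t' := center c'.
rewrite big_distrl /= big_mkcond /=.
apply: (@le_trans _ _ (\sum_(z : {ffun 'I_k -> 'I_N.+1}) \sum_(z' : {ffun 'I_k -> 'I_N.+1})
   ((good_pair z z')%:R + \sum_(i < k) ((z i < M)%:R + (z' i < M)%:R)
    + \sum_(i < k) \sum_(j < k) (z' j == z i)%:R) * (hitK z t x * hitK z' t' x))).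
  apply: ler_sum => z _.
  have wge0 (z' : {ffun 'I_k -> 'I_N.+1}) :
     0 <= ((good_pair z z')%:R + \sum_(i < k) ((z i < M)%:R + (z' i < M)%:R)
    + \sum_(i < k) \sum_(j < k) (z' j == z i)%:R) :> R.
    rewrite !addr_ge0//; first by apply: sumr_ge0 => i _; rewrite addr_ge0.
    by apply: sumr_ge0 => i _; apply: sumr_ge0.
  have h0 (z' : {ffun 'I_k -> 'I_N.+1}) : 0 <= hitK z t x * hitK z' t' x.
    by rewrite mulr_ge0 ?hit_ge0.
  have [zD|_] := boolP (z \in good_maps k N 1); last by apply: sumr_ge0 => z' _; rewrite mulr_ge0.
  rewrite big_distrr /= big_mkcond /=; apply: ler_sum => z' _.
  have [zD'|_] := boolP (z' \in good_maps k N 1); last by rewrite mulr_ge0.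
  by rewrite ler_peMl// weights.
rewrite le_eqVlt; apply/orP; left; apply/eqP.
rewrite (sum_weights (fun z z' => (good_pair z z')%:R)
  (fun z z' => hitK z t x * hitK z' t' x) (fun (i : 'I_k) z z' => (z i < M)%:R + (z' i < M)%:R)
  (fun (i j : 'I_k) z z' => (z' j == z i)%:R)).
congr (_ + _ + _); apply: eq_bigr => i _.
  rewrite /small_part -small_weight -small_weight' -big_split; apply: eq_bigr => z _.
  by rewrite -big_split; apply: eq_bigr => z' _; rewrite mulrDl.
by apply: eq_bigr => j _; rewrite /equal_part -equal_weight.
Qed.

Let continuous_small_part i t t' : continuous (small_part i t t').
Proof.
move=> x; apply: cvgM; first by apply: continuous_sum => n; exact: continuous_T.
by apply: cvgM; [exact: continuous_rest|exact: continuous_full].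
Qed.

Let continuous_equal_part i j t t' : continuous (equal_part i j t t').
Proof.
apply: continuous_sum => n x; apply: cvgM; first by apply: cvgM; exact: continuous_T.
by apply: cvgM; exact: continuous_rest.
Qed.

Let continuous_good_part t t' : continuous (good_part t t').
Proof.
apply: continuous_sum => z; apply: continuous_sum => z' x.
by apply: cvgM; [exact: cvg_cst|apply: cvgM; exact: continuous_hit].
Qed.

Let err_ge0 m : 0 <= err m.
Proof. by rewrite /err !mulr_ge0// exprn_ge0// mulr_ge0// (le_trans ler01). Qed.

Let sum_Rintegral_T n y : \sum_(c < K) \int[mu]_(x in `[a, b]) T n (center c + y) x = b - a.
Proof.
rewrite -Rintegral_itv_sum; last by move=> c; exact: continuous_T.
under eq_Rintegral do rewrite sum_T_center.
by rewrite Rintegral_cst// fine_lebesgue_itvcc// mul1r.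
Qed.

(** The sum over [c] is absorbed by the partition of unity at the exceptional index, so only the
    free sum over [c'] costs a factor [K]. *)
Let sum_Rintegral_small_part i :
  \sum_(c < K) \sum_(c' < K) \int[mu]_(x in `[a, b]) small_part i (center c) (center c') x <=
  K%:R * (M%:R * (Cm ^+ (k + k).-1 * (b - a) + K%:R * err (k + k).-1)).
Proof.
have Cmp m : 0 <= Cm ^+ m by rewrite exprn_ge0// (le_trans ler01).
apply: (@le_trans _ _ (\sum_(c < K) \sum_(c' < K) \sum_(n < N.+1 | (n < M)%N)
    (Cm ^+ (k + k).-1 * \int[mu]_(x in `[a, b]) T n (center c + v i) x + err (k + k).-1))).
  by apply: ler_sum => c _; apply: ler_sum => c' _; exact: small_sum.
rewrite exchange_big /= sumr_const card_ord -[leLHS]mulr_natl ler_wpM2l//.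
rewrite exchange_big /=.
rewrite (eq_bigr (fun=> Cm ^+ (k + k).-1 * (b - a) + K%:R * err (k + k).-1)); last first.
  move=> n _; rewrite big_split /= -big_distrr /= sum_Rintegral_T sumr_const card_ord.
  by rewrite mulr_natl.
rewrite sumr_const -[leLHS]mulr_natl ler_wpM2r//.
  by rewrite addr_ge0// mulr_ge0// subr_ge0.
rewrite ler_nat -sum1_card big_mkcond /=.
apply: leq_trans (sum_ltn_le N.+1 M); apply: leq_sum => n _.
case: ifP => // h; have -> : (n < M)%N by exact: h.
by [].
Qed.

(** Both base cells are absorbed by the partition of unity, at the same power of [x]; what remains
    is the sum over the common index. *)
Let sum_Rintegral_equal_part i j :
  \sum_(c < K) \sum_(c' < K) \int[mu]_(x in `[a, b]) equal_part i j (center c) (center c') x <=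
  N.+1%:R * (Cm ^+ (k + k).-2 * (b - a) + K%:R ^+ 2 * err (k + k).-2).
Proof.
apply: (@le_trans _ _ (\sum_(c < K) \sum_(c' < K) \sum_(n < N.+1)
    (Cm ^+ (k + k).-2 * \int[mu]_(x in `[a, b]) (T n (center c + v i) x * T n (center c' + v j) x)
     + err (k + k).-2))).
  by apply: ler_sum => c _; apply: ler_sum => c' _; exact: equal_sum.
under eq_bigr do rewrite exchange_big /=.
rewrite exchange_big /=.
rewrite (eq_bigr (fun=> Cm ^+ (k + k).-2 * (b - a) + K%:R ^+ 2 * err (k + k).-2)); last first.
  move=> n _; under eq_bigr do rewrite big_split /= sumr_const card_ord -big_distrr /=.
  rewrite big_split /= sumr_const card_ord -big_distrr /=; congr (_ * _ + _); last first.
    by rewrite expr2 -mulrA !mulr_natl.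
  have cTT (c c' : 'I_K) : continuous (fun x => T n (center c + v i) x * T n (center c' + v j) x).
    by move=> x; apply: cvgM; exact: continuous_T.
  under eq_bigr do (rewrite -Rintegral_itv_sum; last by move=> c'; exact: cTT).
  rewrite -Rintegral_itv_sum; last by move=> c; apply: continuous_sum => c'; exact: cTT.
  have E x : \sum_(c < K) \sum_(c' < K) T n (center c + v i) x * T n (center c' + v j) x = 1.
    under eq_bigr do rewrite -big_distrr /= sum_T_center mulr1.
    exact: sum_T_center.
  under eq_Rintegral do rewrite E.
  by rewrite Rintegral_cst// fine_lebesgue_itvcc// mul1r.
by rewrite sumr_const card_ord -[leLHS]mulr_natl.
Qed.

Let Rintegral_good_part t t' :
  \int[mu]_(x in `[a, b]) good_part t t' x <=
  (N%:R ^+ k) ^+ 2 * ((b - a) * K%:R ^- (k + k) + (k + k)%:R * w).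
Proof.
set e := (_ * _ + _ * w).
have e0 : 0 <= e.
  by rewrite addr_ge0// mulr_ge0// ?subr_ge0// invr_ge0 exprn_ge0.
rewrite Rintegral_itv_sum; last first.
  move=> z; apply: continuous_sum => z' x.
  by apply: cvgM; [exact: cvg_cst|apply: cvgM; exact: continuous_hit].
apply: (@le_trans _ _ (\sum_(z : {ffun 'I_k -> 'I_N.+1}) \sum_(z' : {ffun 'I_k -> 'I_N.+1})
    ((z \in good_maps k N M)%:R * (z' \in good_maps k N M)%:R) * e)).
  apply: ler_sum => z _; rewrite Rintegral_itv_sum; last first.
    by move=> z' x; apply: cvgM; [exact: cvg_cst|apply: cvgM; exact: continuous_hit].
  apply: ler_sum => z' _; rewrite Rintegral_itvZ; last first.
    by move=> x; apply: cvgM; exact: continuous_hit.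
  have [gz|_] := boolP (good_pair z z'); last by rewrite mul0r !mulr_ge0.
  have := Rintegral_hit_pair t t' gz; case/and3P: gz => -> -> _.
  by rewrite !mul1r ler_distl => /andP[].
under eq_bigr do rewrite -big_distrl /= -big_distrr /=.
rewrite -!big_distrl /= ler_wpM2r//.
have -> : \sum_(z : {ffun 'I_k -> 'I_N.+1}) (z \in good_maps k N M)%:R =
    #|good_maps k N M|%:R :> R.
  by rewrite -sum1_card natr_sum [RHS]big_mkcond; apply: eq_bigr => z _; case: (_ \in _).
rewrite expr2 -natrX -!natrM ler_nat card_good_maps.
have h : ((N.+1 - M) ^_ k <= N ^ k)%N.
  apply: (leq_trans (ffact_le_expn _ _)); case: (k) => // k'.
  by rewrite leq_exp2r//; lia.
by rewrite leq_mul.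
Qed.

Lemma Rintegral_cell_corr_sqr :
  \int[mu]_(x in `[a, b]) U x ^+ 2 <=
  K%:R ^+ 2 * ((N%:R ^+ k) ^+ 2 * ((b - a) * K%:R ^- (k + k) + (k + k)%:R * w)) +
  2 * k%:R * (K%:R * (M%:R * (Cm ^+ (k + k).-1 * (b - a) + K%:R * err (k + k).-1))) +
  k%:R ^+ 2 * (N.+1%:R * (Cm ^+ (k + k).-2 * (b - a) + K%:R ^+ 2 * err (k + k).-2)).
Proof.
have cU : continuous (fun x => U x ^+ 2).
  by move=> x; apply: cvgM; exact: continuous_cell_corr.
have cs (c c' : 'I_K) : continuous (fun x =>
   \sum_(i < k) (small_part i (center c) (center c') x + small_part i (center c') (center c) x)).
  by apply: continuous_sum => i x; apply: cvgD; exact: continuous_small_part.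
have ce (c c' : 'I_K) : continuous (fun x =>
   \sum_(i < k) \sum_(j < k) equal_part i j (center c) (center c') x).
  by apply: continuous_sum => i; apply: continuous_sum => j; exact: continuous_equal_part.
have cgs (c c' : 'I_K) : continuous (fun x => good_part (center c) (center c') x +
   \sum_(i < k) (small_part i (center c) (center c') x + small_part i (center c') (center c) x)).
  by move=> x; apply: cvgD; [exact: continuous_good_part|exact: cs].
have call (c c' : 'I_K) : continuous (fun x => good_part (center c) (center c') x +
   \sum_(i < k) (small_part i (center c) (center c') x + small_part i (center c') (center c) x)
   + \sum_(i < k) \sum_(j < k) equal_part i j (center c) (center c') x).
  by move=> x; apply: cvgD; [exact: cgs|exact: ce].
apply: (le_trans (le_Rintegral_itv cU _ (fun x _ => sqr_corr_le x))).
  by apply: continuous_sum => c; apply: continuous_sum => c'.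
rewrite Rintegral_itv_sum; last by move=> c; apply: continuous_sum => c'.
under eq_bigr do (rewrite Rintegral_itv_sum; last by move=> c'; exact: call).
have E (c c' : 'I_K) : \int[mu]_(x in `[a, b]) (good_part (center c) (center c') x +
   \sum_(i < k) (small_part i (center c) (center c') x + small_part i (center c') (center c) x)
   + \sum_(i < k) \sum_(j < k) equal_part i j (center c) (center c') x) =
  \int[mu]_(x in `[a, b]) good_part (center c) (center c') x +
  \sum_(i < k) (\int[mu]_(x in `[a, b]) small_part i (center c) (center c') x +
     \int[mu]_(x in `[a, b]) small_part i (center c') (center c) x) +
  \sum_(i < k) \sum_(j < k) \int[mu]_(x in `[a, b]) equal_part i j (center c) (center c') x.
  rewrite (Rintegral_itvD _ _ (cgs c c') (ce c c')).
  rewrite (Rintegral_itvD _ _ (@continuous_good_part (center c) (center c')) (cs c c')).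
  congr (_ + _ + _).
    rewrite Rintegral_itv_sum; last by move=> i x; apply: cvgD; exact: continuous_small_part.
    by apply: eq_bigr => i _; rewrite Rintegral_itvD.
  rewrite Rintegral_itv_sum; last by move=> i; apply: continuous_sum.
  by apply: eq_bigr => i _; rewrite Rintegral_itv_sum.
rewrite (eq_bigr (fun c => \sum_(c' < K) (\int[mu]_(x in `[a, b]) good_part (center c) (center c') x +
  \sum_(i < k) (\int[mu]_(x in `[a, b]) small_part i (center c) (center c') x +
     \int[mu]_(x in `[a, b]) small_part i (center c') (center c) x) +
  \sum_(i < k) \sum_(j < k) \int[mu]_(x in `[a, b]) equal_part i j (center c) (center c') x)));
  last by move=> c _; apply: eq_bigr => c' _; exact: E.
have swap (J : finType) (F : J -> 'I_K -> 'I_K -> R) :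
    \sum_(c < K) \sum_(c' < K) \sum_j F j c c' = \sum_j \sum_(c < K) \sum_(c' < K) F j c c'.
  transitivity (\sum_(c < K) \sum_j \sum_(c' < K) F j c c'); last exact: exchange_big.
  by apply: eq_bigr => c _; exact: exchange_big.
under eq_bigr do rewrite !big_split /=.
rewrite !big_split /= !swap; apply: lerD; first apply: lerD.
- apply: (@le_trans _ _ (\sum_(c < K) \sum_(c' < K)
    ((N%:R ^+ k) ^+ 2 * ((b - a) * K%:R ^- (k + k) + (k + k)%:R * w)))).
    by apply: ler_sum => c _; apply: ler_sum => c' _; exact: Rintegral_good_part.
  by rewrite !sumr_const card_ord -mulrnA -[leLHS]mulr_natl natrM -expr2.
- apply: (@le_trans _ _ (\sum_(i < k)
     2 * (K%:R * (M%:R * (Cm ^+ (k + k).-1 * (b - a) + K%:R * err (k + k).-1))))); last first.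
    by rewrite sumr_const card_ord -[leLHS]mulr_natl mulrA [k%:R * 2]mulrC.
  apply: ler_sum => i _; under eq_bigr do rewrite big_split /=.
  rewrite big_split /= (_ : forall y : R, 2 * y = y + y); last by move=> y; ring.
  apply: lerD; first exact: sum_Rintegral_small_part.
  by rewrite exchange_big; exact: sum_Rintegral_small_part.
apply: (@le_trans _ _ (\sum_(i < k) \sum_(j < k)
   (N.+1%:R * (Cm ^+ (k + k).-2 * (b - a) + K%:R ^+ 2 * err (k + k).-2)))); last first.
  by rewrite !sumr_const card_ord -mulrnA -[leLHS]mulr_natl natrM -expr2.
apply: ler_sum => i _; rewrite swap; apply: ler_sum => j _.
exact: sum_Rintegral_equal_part.
Qed.

(** A lower bound suffices, since the first moment enters the variance with a negative sign; tuples
    with an index below [M] are dropped. *)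
Lemma Rintegral_cell_corr_ge :
  K%:R * (#|good_maps k N M|%:R * ((b - a) * K%:R ^- k - k%:R * w)) <=
  \int[mu]_(x in `[a, b]) U x.
Proof.
have ch c : continuous (fun x => \sum_(z in good_maps k N 1) hit K v z c x).
  by apply: continuous_sum => z; exact: continuous_hit.
rewrite /U /cell_corr Rintegral_itv_sum//.
apply: (@le_trans _ _ (\sum_(c < K) (#|good_maps k N M|%:R * ((b - a) * K%:R ^- k - k%:R * w)))).
  by rewrite sumr_const card_ord mulr_natl.
apply: ler_sum => c _; rewrite Rintegral_itv_sum; last by move=> z; exact: continuous_hit.
apply: (@le_trans _ _ (\sum_(z in good_maps k N M) ((b - a) * K%:R ^- k - k%:R * w))).
  by rewrite sumr_const mulr_natl.
rewrite [leLHS]big_mkcond [leRHS]big_mkcond; apply: ler_sum => z _ /=.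
have [zM|zM] := boolP (z \in good_maps k N M).
  rewrite (_ : z \in good_maps k N 1); last first.
    case/good_mapsP: zM => zM zi; apply/good_mapsP; split=> // i.
    exact: leq_trans (zM i).
  by have := Rintegral_hit (c%:R / K%:R) zM; rewrite ler_distl => /andP[].
case: ifP => // _; apply: Rintegral_ge0 => x _; exact: hit_ge0.
Qed.

(** The centre is the value expected for independent uniform points: [K] base cells, about [N ^ k]
    tuples, probability [K ^- k] each. For [N] comparable to [K] its square has order [K ^ 2],
    against a main error of order [K * Cm ^ (2 k)]. *)
Lemma cell_corr_variance : (0 < k)%N -> (N <= K)%N ->
  \int[mu]_(x in `[a, b]) (U x - K%:R * (N%:R / K%:R) ^+ k) ^+ 2 <=
  8 * k%:R ^+ 2 * (b - a) * K%:R * Cm ^+ (k + k) +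
  12 * k%:R ^+ 3 * (2 * K%:R * Cm) ^+ (k + k + 3) * w.
Proof.
move=> k_gt0 NK; set m := K%:R * _.
have cU : continuous U by exact: continuous_cell_corr.
have cU2 : continuous (fun x => U x ^+ 2) by move=> x; apply: cvgM; exact: cU.
have E x : (U x - m) ^+ 2 = U x ^+ 2 + (- (2 * m) * U x + m ^+ 2) by ring.
under eq_Rintegral do rewrite E.
have cmU : continuous (fun x => - (2 * m) * U x).
  by move=> x; apply: cvgM; [exact: cvg_cst|exact: cU].
have cm2 : continuous (fun _ : R => m ^+ 2) by move=> x; exact: cvg_cst.
have cmU2 : continuous (fun x => - (2 * m) * U x + m ^+ 2).
  by move=> x; apply: cvgD; [exact: cmU|exact: cvg_cst].
rewrite (Rintegral_itvD _ _ cU2 cmU2) (Rintegral_itvD _ _ cmU cm2) Rintegral_itvZ//.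
rewrite (_ : \int[mu]_(x in `[a, b]) m ^+ 2 = m ^+ 2 * (b - a)); last first.
  by rewrite Rintegral_cst// fine_lebesgue_itvcc.
have := Rintegral_cell_corr_sqr; have := Rintegral_cell_corr_ge.
move: (\int[mu]_(x in _) U x) (\int[mu]_(x in _) (U x ^+ 2)) => I1 I2.
move=> hI1 hI2.
have ba0 : 0 <= b - a by rewrite subr_ge0.
have K2R : 2 <= K%:R :> R by rewrite (ler_nat _ 2).
have kR : 1 <= k%:R :> R by rewrite ler1n.
have N1R : N.+1%:R <= 2 * K%:R :> R by rewrite -(natrM _ 2) ler_nat; lia.
have NKR : N%:R <= K%:R :> R by rewrite ler_nat.
have CmM : M%:R + 2 * k%:R <= Cm.
  apply: le_trans CmE; rewrite natrD -addrA ler_wpDl ?divr_ge0//.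
  by rewrite lerD2l mulr_natl mulr2n.
have Cm0 : 0 <= Cm by exact: le_trans Cm1.
have KC0 : 0 <= 2 * K%:R * Cm by rewrite !mulr_ge0.
have CK : K%:R <= 2 * K%:R * Cm.
  by rewrite mulrAC ler_peMl ?(ltW K0)//; apply: mulr_ege1 => //; rewrite ler1n.
have KC1 : 1 <= 2 * K%:R * Cm by apply: le_trans CK; rewrite ler1n ltnW.
pose E0 := (2 * K%:R * Cm) ^+ (k + k).
have errE p : (p <= k + k)%N -> err p <= 2 * k%:R * E0 * w.
  move=> pk; rewrite /err ler_wpM2r//; apply: ler_pM => //.
  - by rewrite exprn_ge0// mulr_ge0.
  - by rewrite -(natrM _ 2) ler_nat mul2n -addnn.
  apply: (@le_trans _ _ ((2 * K%:R * Cm) ^+ p)); last by rewrite ler_weXn2l.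
  by rewrite lerXn2r// ?nnegrE ?mulr_ge0//; apply: ler_wpM2r.
rewrite (_ : (2 * K%:R * Cm) ^+ (k + k + 3) = E0 * (8 * K%:R ^+ 3 * Cm ^+ 3)); last first.
  by rewrite exprD -/E0; ring.
have mE : m = K%:R * (N%:R ^+ k * K%:R ^- k) by rewrite /m expr_div_n.
rewrite mE.
have nE0 : (N%:R ^+ k) ^+ 2 <= E0.
  rewrite /E0 -exprM muln2 -addnn lerXn2r// ?nnegrE//.
  exact: (le_trans NKR).
apply: (@variance_arith R K%:R N.+1%:R M%:R k%:R Cm (b - a) w I1 I2 (N%:R ^+ k) (K%:R ^- k)
   #|good_maps k N M|%:R (N%:R ^+ k.-1) (Cm ^+ (k + k)) (Cm ^+ (k + k).-1) (Cm ^+ (k + k).-2)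
   (err (k + k).-1) (err (k + k).-2) E0) => //.
- rewrite -natrX ler_nat card_good_maps.
  apply: (leq_trans (ffact_le_expn _ _)); rewrite leq_exp2r//.
  by rewrite -(prednK M0) subSS leq_subr.
- by rewrite ler_pdivrMr ?exprn_gt0// mul1r lerXn2r// ?nnegrE.
- rewrite -{1}(prednK k_gt0) exprS invfM mulrA divff ?(gt_eqF K0)// mul1r mulrC.
  by rewrite ler_pdivrMr ?exprn_gt0// mul1r lerXn2r// ?nnegrE.
- rewrite -!natrX -!natrD -!natrM -natrD ler_nat card_good_maps.
  apply: (leq_trans (expn_le_ffact N M.-1 k)).
  rewrite (_ : (N.+1 - M = N - M.-1)%N); last by rewrite -{1}(prednK M0) subSS.
  rewrite leq_add2l leq_mul2l leq_mul2r leq_add2r leq_pred.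
  by rewrite !orbT.
- by rewrite exprn_ge0.
- by rewrite -[leLHS]expr1 ler_weXn2l// addn_gt0 k_gt0.
- rewrite -[X in _ <= _ ^+ X](@prednK (k + k)) ?addn_gt0 ?k_gt0// exprS.
  rewrite ler_wpM2r ?exprn_ge0//; apply: le_trans CmM; rewrite lerDl.
  by rewrite mulr_ge0.
- by rewrite ler_weXn2l// (leq_trans (leq_pred _))// leq_pred.
- by apply: errE; exact: leq_pred.
- by apply: errE; apply: (leq_trans (leq_pred _)); exact: leq_pred.
- apply: (le_trans _ nE0); rewrite -!natrX ler_nat; case: (N ^ k)%N => // n.
  by rewrite expnS expn1 leq_pmulr.
- move: hI2; rewrite (exprD K%:R) invfM -expr2.
  by rewrite (_ : (k + k)%:R = 2 * k%:R :> R)// natrD mulr_natl mulr2n.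
Qed.

End correlation_variance.

(** * Almost everywhere convergence along a sparse sequence of lengths *)

Section error_terms.
Context {R : realType}.
Notation mu := (@lebesgue_measure R).
Implicit Types (a b : R) (j k r : nat).

Lemma expn_le_exponential a p : 1 < a ->
  exists2 c : R, 0 <= c & forall j, j%:R ^+ p * a ^- j <= c.
Proof.
move=> a1; have a0 : 0 < a by exact: lt_trans a1.
have l0 : 0 < ln a by rewrite ln_gt0.
exists (1 + (p`!)%:R / ln a ^+ p).
  by rewrite addr_ge0// divr_ge0// exprn_ge0// ltW.
move=> j; rewrite ler_pdivrMr ?exprn_gt0//.
have -> : a ^+ j = expR (j%:R * ln a) by rewrite expRM_natl lnK.
case: p => [|p].
  rewrite expr0 fact0 expr0 divr1; have := @expR_ge1Dx R (j%:R * ln a).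
  have : 0 <= j%:R * ln a by rewrite mulr_ge0// ltW.
  by move=> *; lra.
have x0 : 0 <= j%:R * ln a by rewrite mulr_ge0// ltW.
have := expR_ge1Dxn p x0.
rewrite exprMn => h; have e0 := expR_ge0 (j%:R * ln a).
have f0 : 0 < (p.+1`!)%:R :> R by rewrite ltr0n fact_gt0.
have lp0 : 0 < ln a ^+ p.+1 by rewrite exprn_gt0.
apply: (@le_trans _ _ ((p.+1`!)%:R / ln a ^+ p.+1 * expR (j%:R * ln a))); last first.
  by rewrite ler_wpM2r// lerDr.
rewrite mulrAC ler_pdivlMr// -ler_pdivrMl// mulrC.
by apply: le_trans h; rewrite lerDr.
Qed.

Definition decoupled a b (w : R) K N M q := forall n u (B : seq (nat * R)),
  (M <= n)%N -> (n <= N)%N -> n \notin map fst B ->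
  all (fun m => m <= N)%N (map fst B) -> (size B < q)%N ->
  `|\int[mu]_(x in `[a, b]) (soft_cell K (x ^+ n - u) * cell_prod K B x) -
    K%:R^-1 * \int[mu]_(x in `[a, b]) cell_prod K B x| <= w.

Lemma decoupled_explicit a b eta K N N' M q : 1 <= a -> a <= b -> 0 < eta -> eta <= 1 ->
  (1 < K)%N -> (0 < M)%N -> (N <= N')%N ->
  decoupled a b (2 ^+ q * ((2 * b + (b - a) * (N'%:R ^+ 3 * (K ^ 3 * q)%:R * b ^+ 2)) *
    (N'%:R * b / eta) ^+ (2 * q) * a ^- M + 2 * eta) * (K * K ^ 3)%:R ^+ q) K N M q.
Proof.
move=> a1 ab eta0 eta1 K1 M0 NN' n u B Mn nN nB aB sB.
set W := 2 ^+ q * _.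
have W0 : 0 <= W.
  rewrite /W mulr_ge0 ?exprn_ge0// addr_ge0//; last by rewrite mulr_ge0// ltW.
  have b0 : 0 <= b by lra.
  rewrite !mulr_ge0//.
  - by rewrite addr_ge0 ?mulr_ge0// ?subr_ge0// ?exprn_ge0.
  - by rewrite exprn_ge0// divr_ge0 ?mulr_ge0// ltW.
  - by rewrite invr_ge0 exprn_ge0// (le_trans ler01).
have K41 : 1 <= (K * K ^ 3)%:R :> R by rewrite ler1n muln_gt0 expn_gt0 ltnW.
apply: (@le_trans _ _ (W * (K * K ^ 3)%:R ^+ (size B).+1)); last first.
  by rewrite ler_wpM2l// ler_weXn2l.
apply: (@cell_decoupling R a b W (K ^ 3 * q)%:R K M (n :: map fst B)) => //.
- move=> P beta supp Pint Pc ex.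
  rewrite /W.
  apply: (@phase_integral_le R a b eta (K ^ 3 * q)%:R M q N' (n :: map fst B) P beta) => //.
    by rewrite /= size_map.
  move=> i; rewrite in_cons => /orP[/eqP ->|/(allP aB) iN]; first exact: leq_trans NN'.
  exact: leq_trans NN'.
- by rewrite mem_head.
- by move=> i iB; rewrite in_cons iB orbT.
by rewrite ler_nat leq_mul2l sB orbT.
Qed.

(** With [M = j] and all other parameters polynomial in [j], the factor [a ^- j] leaves room to take
    [eta] a large negative power of [j]. *)
Lemma decoupled_polynomial a b q L r A : 1 < a -> a <= b -> (0 < L)%N ->
  exists2 c : R, 0 <= c & forall j N, (1 < j)%N -> (N <= j ^ r)%N -> (1 < L * j ^ r)%N ->
    exists2 w : R, 0 <= w <= c * j%:R ^- A & decoupled a b w (L * j ^ r) N j q.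
Proof.
move=> a1 ab L0.
have b1 : 1 <= b by lra.
(* The surplus [r * (4 * q)] compensates the factor [(K * K ^ 3) ^ q] of [decoupled_explicit]. *)
pose A' := (A + r * (4 * q))%N.
(* The power of [j] that [a ^- j] has to beat: from [N' ^ 3] and [K ^ 3], from
   [(N' / eta) ^ (2 * q)], from [(K * K ^ 3) ^ q], and the desired decay [A]. *)
pose p := (r * 3 + r * 3 + (r + A') * (2 * q) + r * (4 * q) + A)%N.
have [c0 c00 c0P] := expn_le_exponential p a1.
pose c1 := 2 * b + (b - a) * (L%:R ^+ 3 * q%:R * b ^+ 2).
have c10 : 0 <= c1.
  by rewrite addr_ge0 ?mulr_ge0 ?exprn_ge0 ?subr_ge0//; lra.
pose cL : R := L%:R ^+ (4 * q).
exists (2 ^+ q * (c1 * b ^+ (2 * q) * c0 + 2) * cL).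
  by rewrite !mulr_ge0 ?addr_ge0 ?mulr_ge0 ?exprn_ge0//; lra.
move=> j N j1 Nj K1; pose J : R := j%:R.
have J0 : 0 < J by rewrite ltr0n ltnW.
have J1 : 1 <= J by rewrite ler1n ltnW.
pose eta := J ^- A'.
have eta0 : 0 < eta by rewrite invr_gt0 exprn_gt0.
have eta1 : eta <= 1 by rewrite invf_le1 ?exprn_gt0// exprn_ege1.
eexists; last exact: (decoupled_explicit (ltW a1) ab eta0 eta1 K1 (ltnW j1) Nj).
set K := (L * j ^ r)%N.
have a0 : 0 < a by lra.
have aj0 : 0 <= a ^- j by rewrite invr_ge0 exprn_ge0// ltW.
have e1 : 2 * b + (b - a) * ((j ^ r)%:R ^+ 3 * (K ^ 3 * q)%:R * b ^+ 2) <=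
    c1 * J ^+ (r * 3 + r * 3).
  rewrite /c1 [leRHS]mulrDl; apply: lerD.
    by rewrite ler_peMr ?exprn_ege1// mulr_ge0//; lra.
  rewrite /K !(natrM, natrX) -/J exprD !exprM; move: (J ^+ r) => z.
  by rewrite le_eqVlt; apply/orP; left; apply/eqP; ring.
have e1_ge0 : 0 <= 2 * b + (b - a) * ((j ^ r)%:R ^+ 3 * (K ^ 3 * q)%:R * b ^+ 2).
  by rewrite addr_ge0 ?mulr_ge0 ?exprn_ge0 ?subr_ge0//; lra.
have e2 : ((j ^ r)%:R * b / eta) ^+ (2 * q) = b ^+ (2 * q) * J ^+ ((r + A') * (2 * q)).
  rewrite /eta invrK natrX -/J mulrAC -exprD mulrC exprMn; congr (_ * _).
  by rewrite -exprM.
have e3 : (K * K ^ 3)%:R ^+ q = cL * J ^+ (r * (4 * q)).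
  by rewrite -expnS natrX /K natrM natrX -/J -exprM exprMn -exprM.
have b2q : 0 <= b ^+ (2 * q) by rewrite exprn_ge0//; lra.
have cL0 : 0 <= cL by rewrite exprn_ge0.
have Jp n : 0 <= J ^+ n by rewrite exprn_ge0// ltW.
rewrite e2 e3; move: (2 * b + _) e1 e1_ge0 => X1 e1 e1_ge0; apply/andP; split.
  rewrite mulr_ge0 ?(mulr_ge0 cL0)// mulr_ge0 ?exprn_ge0// addr_ge0//.
    by rewrite !mulr_ge0.
  by rewrite mulr_ge0// ltW.
rewrite -!mulrA ler_wpM2l ?exprn_ge0//.
have JA : J ^+ (r * (4 * q)) * eta = J ^- A.
  rewrite /eta /A' exprD invfM mulrCA divff ?mulr1//.
  by rewrite expf_neq0// gt_eqF.
have JA2 : J ^+ (r * 3 + r * 3) * J ^+ ((r + A') * (2 * q)) * J ^+ (r * (4 * q)) * a ^- j <= c0 * J ^- A.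
  rewrite ler_pdivlMr ?exprn_gt0//; apply: le_trans (c0P j).
  by rewrite /p !exprD -/J mulrAC le_eqVlt eqxx.
rewrite mulrCA [leRHS]mulrCA ler_wpM2l// mulrDl [leRHS]mulrDl lerD//; last first.
  by rewrite -mulrA (mulrC eta) JA.
apply: (@le_trans _ _ ((c1 * b ^+ (2 * q)) * (J ^+ (r * 3 + r * 3) *
    J ^+ ((r + A') * (2 * q)) * J ^+ (r * (4 * q)) * a ^- j))); last first.
  rewrite [leRHS](_ : _ = (c1 * b ^+ (2 * q)) * (c0 * J ^- A)); last by ring.
  by rewrite ler_wpM2l// mulr_ge0.
rewrite (_ : c1 * _ * _ = (c1 * J ^+ (r * 3 + r * 3)) *
   (b ^+ (2 * q) * J ^+ ((r + A') * (2 * q)) * (a ^- j * J ^+ (r * (4 * q))))); last by ring.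
rewrite [leLHS](_ : _ = X1 *
   (b ^+ (2 * q) * J ^+ ((r + A') * (2 * q)) * (a ^- j * J ^+ (r * (4 * q))))); last by ring.
by rewrite ler_wpM2r// !mulr_ge0.
Qed.

End error_terms.

Section variance_along_scale.
Context {R : realType}.
Notation mu := (@lebesgue_measure R).
Implicit Types (a b : R) (j k r : nat).

(* With this growth the relative variance of the cell counts is [O(j ^ -2)], while
   consecutive lengths have ratio tending to 1. *)
Definition scale k j : nat := (j ^ (k + k + 2))%N.

(** [Cm] has order [j] and [K] has order [j ^ (2 k + 2)], so the main error [K * Cm ^ (2 k)] divided
    by the square of the scale has order [j ^- 2]. *)
Lemma corr_variance_le a b k L : 1 < a -> a <= b -> (0 < k)%N -> (0 < L)%N ->
  exists2 c : R, 0 <= c & forall j N (v : 'I_k -> R), (1 < j)%N -> (N <= scale k j)%N ->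
    \int[mu]_(x in `[a, b]) (cell_corr (L * scale k j) v N x / (scale k j)%:R -
      L%:R * (N%:R / (L * scale k j)%:R) ^+ k) ^+ 2 <= c * j%:R ^- 2.
Proof.
(* [A] absorbs [(2 * K * Cm) ^ (2 k + 3)], where [K * Cm] has order [j ^ (r + 1)]; below,
   [kap = 2 k + 3] makes [kap * j] dominate [2 + j + 2 k]. *)
move=> a1 ab k0 L0; pose r := (k + k + 2)%N; pose A := (r.+1 * (k + k + 3))%N.
have [c c0 cP] := @decoupled_polynomial R a b (k + k) L r A a1 ab L0.
pose kap : R := (k + k + 3)%:R.
pose c1 := 8 * k%:R ^+ 2 * (b - a) * L%:R * kap ^+ (k + k).
pose c2 := 12 * k%:R ^+ 3 * (2 * L%:R * kap) ^+ (k + k + 3) * c.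
have c10 : 0 <= c1 by rewrite !mulr_ge0 ?exprn_ge0// subr_ge0.
have c20 : 0 <= c2 by rewrite !mulr_ge0 ?exprn_ge0// !mulr_ge0.
exists (c1 + c2); first exact: addr_ge0.
move=> j N v j1 Nj; rewrite /scale -/r; set K := (L * j ^ r)%N; pose J : R := j%:R.
have J0 : 0 < J by rewrite ltr0n ltnW.
have J1 : 1 <= J by rewrite ler1n ltnW.
have jr1 : (1 < j ^ r)%N.
  by apply: (leq_trans j1); rewrite -[X in (X <= _)%N]expn1 leq_exp2l// /r; lia.
have K1 : (1 < K)%N by apply: (leq_trans jr1); rewrite leq_pmull.
have KE : K%:R = L%:R * J ^+ r by rewrite /K natrM natrX.
have [w /andP[w0 wc] dec] := cP j N j1 Nj K1.
have NK : (N <= K)%N by apply: (leq_trans Nj); rewrite leq_pmull.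
have Cm1 : 1 <= kap * J by rewrite mulr_ege1// ler1n; lia.
have CmE : N.+1%:R / K%:R + j%:R + (k + k)%:R <= kap * J.
  apply: (@le_trans _ _ (2 + J + (k + k)%:R)).
    rewrite !lerD2r ler_pdivrMr ?ltr0n ?(ltnW K1)//.
    by rewrite -(natrM _ 2) ler_nat; lia.
  rewrite (_ : kap = (k + k)%:R + 3) ?mulrDl; last by rewrite /kap natrD.
  have : (k + k)%:R <= (k + k)%:R * J by rewrite ler_peMr.
  by lra.
have hI := cell_corr_variance v ab K1 (ltnW j1) w0 Cm1 CmE dec k0 NK.
have Jr0 : 0 < J ^+ r by rewrite exprn_gt0.
have E x : (cell_corr K v N x / (j ^ r)%:R - L%:R * (N%:R / K%:R) ^+ k) ^+ 2 =
    J ^- (r * 2) * (cell_corr K v N x - K%:R * (N%:R / K%:R) ^+ k) ^+ 2.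
  rewrite exprM -exprVn -exprMn; congr (_ ^+ 2).
  by rewrite KE natrX -/J; move: (J ^+ r) Jr0 => z z0; field; rewrite gt_eqF.
under eq_Rintegral do rewrite E.
rewrite Rintegral_itvZ; last first.
  have cU := @continuous_cell_corr R K k v N.
  by move=> x; apply: cvgM; apply: cvgB; [exact: cU|exact: cvg_cst|exact: cU|exact: cvg_cst].
move: hI; move: (\int[mu]_(x in _) _) => I hI.
have r2E : (r * 2 = r + (k + k) + 2)%N by rewrite muln2 -addnn -[in RHS]addnA.
rewrite ler_pdivlMr ?exprn_gt0// mulrC mulrA mulrC.
rewrite (_ : J ^+ 2 * J ^- (r * 2) = J ^- (r + (k + k))); last first.
  by rewrite r2E (exprD J _ 2) invfM mulrCA divff ?mulr1// expf_neq0// gt_eqF.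
rewrite ler_pdivrMr ?exprn_gt0//; apply: (le_trans hI); rewrite [leRHS]mulrDl; apply: lerD.
  rewrite /c1 KE (exprMn (k + k) kap) (exprD J r).
  by rewrite le_eqVlt; apply/orP; left; apply/eqP; ring.
have Jp1 : 1 <= J ^+ (r + (k + k)) by exact: exprn_ege1.
apply: (@le_trans _ _ c2); last by rewrite ler_peMr.
have -> : 2 * K%:R * (kap * J) = (2 * L%:R * kap) * J ^+ r.+1.
  by rewrite (exprS J r) KE; move: (J ^+ r) => z; ring.
rewrite exprMn -exprM -/A /c2 -!mulrA !ler_wpM2l ?exprn_ge0// ?mulr_ge0//.
by rewrite mulrC -ler_pdivlMr// exprn_gt0.
Qed.

(** The series of the [f j] has a finite integral, so it is finite almost everywhere and its terms
    tend to 0. *)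
Lemma ae_cvg0_summable a b (f : nat -> R -> R) (c : R) : (forall j, continuous (f j)) ->
  (forall j x, 0 <= f j x) ->
  (forall j, \int[mu]_(x in `[a, b]) f j x <= c * j.+1%:R ^- 2) ->
  {ae mu, forall x, a <= x <= b -> f j x @[j --> \oo] --> 0}.
Proof.
move=> cf f0 fc.
have c0 : 0 <= c.
  have := fc 0%N; rewrite expr1n invr1 mulr1; apply: le_trans.
  by apply: Rintegral_ge0 => x _; exact: f0.
have mf j : measurable_fun `[a, b] (EFin \o f j).
  by apply: (measurable_int mu); exact: continuous_integrable.
have I_fin j : (\int[mu]_(x in `[a, b]) (f j x)%:E)%E = (\int[mu]_(x in `[a, b]) f j x)%:E.
  rewrite /Rintegral fineK//.
  by apply: integrable_fin_num => //; exact: continuous_integrable.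
have mS : measurable_fun `[a, b] (fun x => \sum_(j <oo) (f j x)%:E)%E.
  apply: (@ge0_emeasurable_sum _ _ _ _ (fun j => EFin \o f j) xpredT) => //.
  by move=> j x _ _; rewrite lee_fin f0.
(* Compares [(y + 1) ^- 2] with the telescoping [1 / y - 1 / (y + 1)]. *)
have part n : \sum_(j < n) j.+1%:R ^- 2 <= 2 :> R.
  case: n => [|n]; first by rewrite big_ord0.
  apply: (@le_trans _ _ (2 - n.+1%:R^-1)); last by rewrite gerBl invr_ge0.
  elim: n => [|n IH].
    by rewrite big_ord_recl big_ord0 /= expr1n invr1; lra.
  rewrite big_ord_recr /=; apply: (le_trans (lerD IH (lexx _))).
  have n0 : 0 < n.+1%:R :> R by [].
  rewrite -(natr1 n.+1); move: (n.+1%:R) n0 => y y0.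
  have -> : 2 - (y + 1)^-1 = 2 - y^-1 + (y * (y + 1))^-1.
    by field; rewrite !gt_eqF//; lra.
  rewrite lerD2l lef_pV2 ?posrE ?exprn_gt0 ?mulr_gt0//; last by lra.
  - by rewrite expr2 ler_wpM2r//; lra.
  - by lra.
have integrable_sum : mu.-integrable `[a, b] (fun x => \sum_(j <oo) (f j x)%:E)%E.
  apply/integrableP; split=> //.
  have -> : (\int[mu]_(x in `[a, b]) `| \sum_(j <oo) (f j x)%:E | =
      \int[mu]_(x in `[a, b]) \sum_(j <oo) (f j x)%:E)%E.
    apply: eq_integral => x _; rewrite gee0_abs//.
    by apply: nneseries_ge0 => j _ _; rewrite lee_fin.
  rewrite integral_nneseries//; last by move=> j x _; rewrite lee_fin.
  apply: (@le_lt_trans _ _ (c * 2)%:E); last exact: ltry.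
  apply: lime_le.
    by apply: is_cvg_nneseries => j _ _; apply: integral_ge0 => x _; rewrite lee_fin.
  near=> n; rewrite big_mkord; under eq_bigr do rewrite I_fin.
  rewrite sumEFin lee_fin; apply: (@le_trans _ _ (\sum_(j < n) c * j.+1%:R ^- 2)).
    by apply: ler_sum => j _; exact: fc.
  by rewrite -big_distrr /= ler_wpM2l//; exact: part.
have := integrable_ae _ integrable_sum => /(_ (measurable_itv _)).
apply: filterS => x xP xab.
have {xP} := xP; rewrite /= in_itv/= => /(_ xab) xfin.
apply: cvg_series_cvg_0; apply: nondecreasing_is_cvgn.
  apply/nondecreasing_seqP => n; rewrite /series /= big_nat_recr //= lerDl.
  exact: f0.
exists (fine (\sum_(j <oo) (f j x)%:E)%E) => _ [n _ <-].
rewrite -lee_fin fineK// /series/= -sumEFin.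
by apply: nneseries_lim_ge => j _ _; rewrite lee_fin.
Unshelve. all: by end_near.
Qed.

End variance_along_scale.

Section cell_corr_convergence.
Context {R : realType}.
Notation mu := (@lebesgue_measure R).
Implicit Types (a b : R) (j k r : nat).

Lemma cvg_exprn (u : nat -> R) (l : R) n :
  u j @[j --> \oo] --> l -> u j ^+ n @[j --> \oo] --> l ^+ n.
Proof.
move=> ul; elim: n => [|n IH]; first exact: cvg_cst.
rewrite exprS; under eq_fun do rewrite exprS.
by apply: cvgM.
Qed.

Lemma cvg_scale_ratio k (nu : nat -> nat) :
  (forall j, scale k j.-1 <= nu j <= scale k j)%N ->
  (nu j)%:R / (scale k j)%:R @[j --> \oo] --> (1 : R).
Proof.
move=> nuP; rewrite -(cvg_shiftn 1) /=.
pose r := (k + k + 2)%N.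
have lim1 : (1 - (@harmonic R) j) ^+ r @[j --> \oo] --> (1 : R).
  rewrite -[X in _ --> X](expr1n R r).
  apply: cvg_exprn.
  rewrite -[X in _ --> X](subr0 (1 : R)); apply: cvgB; first exact: cvg_cst.
  exact: cvg_harmonic.
apply: (squeeze_cvgr _ lim1 (cvg_cst (1 : R))); near=> j.
have j0 : 0 < (j + 1)%:R :> R by rewrite ltr0n addn1.
have s0 : 0 < (scale k (j + 1))%:R :> R by rewrite ltr0n expn_gt0 addn1.
have /andP[lo hi] := nuP (j + 1)%N.
rewrite ler_pdivrMr// mul1r ler_nat hi andbT ler_pdivlMr//.
apply: le_trans (_ : (scale k (j + 1).-1)%:R <= _); last by rewrite ler_nat.
rewrite /scale !natrX -/r -exprMn lerXn2r ?nnegrE//.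
  rewrite mulr_ge0// subr_ge0 /harmonic /= invf_le1// ler1n //.
rewrite /harmonic /= -(addn1 j) mulrBl mulVf ?gt_eqF// mul1r addn1 /= -natr1.
by rewrite addrK.
Unshelve. all: by end_near. Qed.

Lemma cvg0_sqr (u : nat -> R) : u j ^+ 2 @[j --> \oo] --> (0 : R) -> u j @[j --> \oo] --> (0 : R).
Proof.
move=> u2; apply/norm_cvg0P.
have -> : (fun j => `|u j|) = (fun j => Num.sqrt (u j ^+ 2)).
  by apply/funext => j; rewrite sqrtr_sqr.
rewrite -[X in _ --> X](sqrtr0 R).
by apply: (@continuous_cvg _ _ _ _ _ (fun j => u j ^+ 2) (@Num.sqrt R) 0 _ u2); exact: sqrt_continuous.
Qed.

(** The variance bound is uniform in the offsets and in the length, so both may depend on [j]: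
    offsets are measured in cells that shrink with [j], and [nu] will be either end of a gap between
    consecutive lengths. *)
Lemma corr_ae_cvg a b k L (nu : nat -> nat) (v : nat -> 'I_k -> R) :
  1 < a -> a <= b -> (0 < k)%N -> (0 < L)%N ->
  (forall j, scale k j.-1 <= nu j <= scale k j)%N ->
  {ae mu, forall x, a <= x <= b ->
    cell_corr (L * scale k j) (v j) (nu j) x / (scale k j)%:R @[j --> \oo] -->
    (L%:R * L%:R^-1 ^+ k : R)}.
Proof.
move=> a1 ab k0 L0 nuP.
have [c c0 cP] := @corr_variance_le R a b k L a1 ab k0 L0.
pose V j x : R := cell_corr (L * scale k j) (v j) (nu j) x / (scale k j)%:R.
pose m j : R := L%:R * ((nu j)%:R / (L * scale k j)%:R) ^+ k.
have mcvg : m j @[j --> \oo] --> (L%:R * L%:R^-1 ^+ k : R).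
  apply: cvgM; first exact: cvg_cst.
  apply: cvg_exprn.
  have -> : (fun j => (nu j)%:R / (L * scale k j)%:R) =
      (fun j => L%:R^-1 * ((nu j)%:R / (scale k j)%:R)) :> (nat -> R).
    by apply/funext => j; rewrite natrM invfM mulrCA.
  rewrite -[X in _ --> X]mulr1; apply: cvgM; first exact: cvg_cst.
  exact: cvg_scale_ratio.
have cV j : continuous (V j).
  by move=> x; apply: cvgM; [exact: continuous_cell_corr|exact: cvg_cst].
(* The shift by 2 meets the requirement [1 < j] of the variance bound. *)
have := @ae_cvg0_summable R a b (fun j x => (V (j + 2)%N x - m (j + 2)%N) ^+ 2) c.
have H1 j : continuous (fun x => (V (j + 2)%N x - m (j + 2)%N) ^+ 2).
  by move=> x; apply: cvgM; apply: cvgB; [exact: cV|exact: cvg_cst|exact: cV|exact: cvg_cst].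
move=> /(_ H1 (fun j x => sqr_ge0 _)) H2.
have {}H2 := H2 _.
have {H2} : {ae mu, forall x, a <= x <= b ->
    (V (j + 2)%N x - m (j + 2)%N) ^+ 2 @[j --> \oo] --> (0 : R)}.
  apply: H2 => j; have /andP[_ hi] := nuP (j + 2)%N.
  apply: (le_trans (cP (j + 2)%N (nu (j + 2)%N) (v (j + 2)%N) _ hi)); first by rewrite addn2.
  rewrite ler_wpM2l// lef_pV2 ?posrE ?exprn_gt0 ?ltr0n ?addn2//.
  by rewrite lerXn2r ?nnegrE// ler_nat.
apply: (@filterS _ _ (ae_filter_ringOfSetsType mu)) => x H xab.
have {}H := cvg0_sqr (H xab).
rewrite -(cvg_shiftn 2) /=.
have -> : (fun n => V (n + 2)%N x) = (fun n => (V (n + 2)%N x - m (n + 2)%N) + m (n + 2)%N).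
  by apply/funext => n; rewrite subrK.
rewrite -(add0r (L%:R * L%:R^-1 ^+ k)); apply: cvgD; first exact: H.
by rewrite (cvg_shiftn 2 m).
Qed.

End cell_corr_convergence.

(** * Riemann sums of test functions *)

Section test_functions.
Context {R : realType} {n : nat}.
Variable f : 'rV[R]_n -> R.
Hypothesis cf : continuous f.
Hypothesis suppf : compactly_supported f.

Let S := closure [set x | f x != 0].

Let Sneq x : f x != 0 -> S x.
Proof. by move=> fx; apply: subset_closure. Qed.

Lemma test_support_bounded :
  exists2 rho : nat, (0 < rho)%N & forall (x : 'rV[R]_n) i, f x != 0 -> `|x 0 i| < rho%:R.
Proof.
have [M [Mreal HM]] := compact_bounded suppf.
pose rho := (Num.truncn `|M + 1|).+2.
exists rho => // x i fx.
have /= Mx := HM (M + 1) _ x (Sneq fx).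
have {}Mx : `|x| <= M + 1 by apply: Mx; rewrite ltrDl.
apply: (@le_lt_trans _ _ `|x|).
  rewrite [leRHS]mx_normrE.
  by apply: (@le_bigmax_seq _ _ _ _ _ (0, i) _ (fun j => `|x j.1 j.2|)) => //; rewrite mem_index_enum.
apply: (le_lt_trans Mx); apply: (le_lt_trans (ler_norm _)).
have /andP[_ h] := truncn_itv (normr_ge0 (M + 1)).
by apply: (lt_trans h); rewrite ltr_nat.
Qed.

Lemma test_bounded : exists2 B : R, 0 <= B & forall x, `|f x| <= B.
Proof.
have cS : compact (f @` S).
  by apply: continuous_compact => //; exact: continuous_subspaceT.
have [M [Mreal HM]] := compact_bounded cS.
exists `|M + 1| => // x; have [->|fx] := eqVneq (f x) 0; first by rewrite normr0.
apply: le_trans (ler_norm _).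
by apply: (HM (M + 1)); [rewrite ltrDl|exists x => //; exact: Sneq].
Qed.

(** Compactness gives one radius for all base points in the support; a pair of points has such a
    base point unless [f] vanishes at both. *)
Lemma test_uniformly_continuous (e : R) : 0 < e ->
  exists2 d : R, 0 < d & forall x y : 'rV[R]_n, (forall i, `|x 0 i - y 0 i| < d) -> `|f x - f y| <= e.
Proof.
move=> e0.
have /compact_near_coveringP ncS := suppf.
have := ncS R (0^'+) (fun d x => forall y, ball x d y -> `|f x - f y| < e).
have H : forall x, S x -> \forall x' \near x & d \near 0^'+,
    forall y, ball x' d y -> `|f x' - f y| < e.
  move=> x _.
  have fx : f y @[y --> x] --> f x by exact: cf.
  have e20 : 0 < e / 2 by rewrite divr_gt0.
  move/cvgrPdist_lt : fx => /(_ _ e20) /nbhs_ballP; case=> r /= r0 Hr.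
  exists (ball x (r / 2), [set d | d < r / 2]) => /=.
    split; first by apply: nbhsx_ballx; rewrite divr_gt0.
    by apply: nbhs_right_lt; rewrite divr_gt0.
  move=> [x' d] /= [xx' dr] y x'y.
  have h1 : `|f x - f x'| < e / 2.
    by apply: Hr; apply: le_ball xx'; rewrite ler_pdivrMr//; lra.
  have h2 : `|f x - f y| < e / 2.
    apply: Hr; rewrite (splitr r); apply: ball_triangle xx' _.
    by apply: le_ball x'y; exact: ltW.
  have -> : f x' - f y = (f x - f y) - (f x - f x') by ring.
  by apply: (le_lt_trans (ler_normB _ _)); lra.
move=> /(_ _ H) {}H.
have [d [d0 Hd]] : exists d, 0 < d /\ S `<=` (fun x => forall y, ball x d y -> `|f x - f y| < e).
  near (0 : R)^'+ => d; exists d; split => //.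
  by near: d; exact: H.
exists d => // x y xy.
have bxy : ball x d y by split => // i j; rewrite (ord1 i) /ball/=; exact: xy.
have [fx|fx] := eqVneq (f x) 0; last by apply/ltW/Hd => //; exact: Sneq.
have [fy|fy] := eqVneq (f y) 0; first by rewrite fx fy subrr normr0 ltW.
by rewrite distrC; apply/ltW/Hd; [exact: Sneq|exact: ball_sym].
Unshelve. all: by end_near. Qed.

End test_functions.

Section riemann_sum.
Context {R : realType} {n : nat}.
Notation mu := (@lebesgue_measure_tuple R n).
Notation T := (n.-tuple (measurableTypeR R)).
Variable f : 'rV[R]_n -> R.
Variable rho : nat.
Hypothesis suppf : forall (x : 'rV[R]_n) i, f x != 0 -> `|x 0 i| < rho%:R.

Definition grid_point L (d : {ffun 'I_n -> 'I_(rho * L + rho * L)}) : 'rV[R]_n :=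
  \row_i (((d i)%:R - (rho * L)%:R) / L%:R).

Definition grid_box L (d : {ffun 'I_n -> 'I_(rho * L + rho * L)}) : set T :=
  [set t | forall i, `[grid_point d 0 i, grid_point d 0 i + L%:R^-1[%classic (tnth t i)].

Definition grid_step L (c : {ffun 'I_n -> 'I_(rho * L + rho * L)} -> R) (t : T) : R :=
  \sum_d c d * \1_(grid_box d) t.

Definition row_of (t : T) : 'rV[R]_n := \row_i tnth t i.

Lemma measurable_grid_box L (d : {ffun 'I_n -> 'I_(rho * L + rho * L)}) :
  measurable (grid_box d).
Proof.
rewrite (_ : grid_box d = \bigcap_(i in [set: 'I_n])
   ((@tnth _ _)^~ i @^-1` `[grid_point d 0 i, grid_point d 0 i + L%:R^-1[%classic)).
  apply: fin_bigcap_measurable; first exact: finite_finset.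
  move=> i _; rewrite -[X in measurable X]setTI.
  by apply: measurable_tnth => //; exact: measurableT.
by apply/seteqP; split=> t /= tA i; [move=> _|]; exact: tA.
Qed.

Lemma grid_box_measure L (d : {ffun 'I_n -> 'I_(rho * L + rho * L)}) : (0 < L)%N ->
  mu (grid_box d) = (L%:R^-1 ^+ n)%:E.
Proof.
move=> L0.
rewrite (@lebesgue_measure_tuple_box R n
  (fun i => `[grid_point d 0 i, grid_point d 0 i + L%:R^-1[%classic)); last first.
  by move=> i; exact: measurable_itv.
transitivity (\prod_(i < n) (L%:R^-1 : R)%:E)%E.
  apply: eq_bigr => i _.
  by rewrite lebesgue_measure_itv/= lte_fin ltrDl invr_gt0 ltr0n L0 -EFinB addrAC subrr add0r.
by rewrite prodEFin prodr_const card_ord.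
Qed.

Lemma grid_indic_integrable L (d : {ffun 'I_n -> 'I_(rho * L + rho * L)}) c : (0 < L)%N ->
  mu.-integrable setT (EFin \o (fun t => c * \1_(grid_box d) t)).
Proof.
move=> L0.
have h : mu.-integrable setT (EFin \o \1_(grid_box d)).
  apply/integrableP; split.
    by apply/measurable_EFinP; apply: measurable_indic; exact: measurable_grid_box.
  under eq_integral => t _ do rewrite /= ger0_norm//.
  rewrite (integral_indic _ measurableT (measurable_grid_box d)) setIT.
  by rewrite [X in (X < _)%E](grid_box_measure _ L0) ltry.
rewrite (_ : _ \o _ = (fun t => c%:E * (EFin \o \1_(grid_box d)) t)%E) //.
exact: integrableZl.
Qed.

Lemma grid_indic_integral L (d : {ffun 'I_n -> 'I_(rho * L + rho * L)}) c : (0 < L)%N ->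
  \int[mu]_t (c * \1_(grid_box d) t) = c * L%:R^-1 ^+ n.
Proof.
move=> L0; rewrite RintegralZl//; last first.
  have := @grid_indic_integrable L d 1 L0.
  by congr (mu.-integrable _ _); apply/funext => t /=; rewrite mul1r.
congr (_ * _); rewrite /Rintegral (integral_indic _ measurableT (measurable_grid_box d)) setIT.
by rewrite [X in fine X](grid_box_measure _ L0).
Qed.

Lemma grid_step_integrable L (c : {ffun 'I_n -> 'I_(rho * L + rho * L)} -> R) : (0 < L)%N ->
  mu.-integrable setT (EFin \o grid_step c).
Proof.
move=> L0.
rewrite (_ : _ \o _ = (fun t => \sum_d (c d * \1_(grid_box d) t)%:E)%E).
  by apply: integrable_sum => // d _; exact: grid_indic_integrable.
by apply/funext => t; rewrite /= /grid_step sumEFin.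
Qed.

Lemma grid_step_integral L (c : {ffun 'I_n -> 'I_(rho * L + rho * L)} -> R) : (0 < L)%N ->
  \int[mu]_t grid_step c t = (\sum_d c d) * L%:R^-1 ^+ n.
Proof.
move=> L0; rewrite mulr_suml /Rintegral.
transitivity (fine (\sum_d \int[mu]_t (c d * \1_(grid_box d) t)%:E)%E).
  rewrite -integral_sum//=; last by move=> d; exact: grid_indic_integrable.
  by congr fine; apply: eq_integral => t _; rewrite sumEFin.
transitivity (fine (\sum_d (c d * L%:R^-1 ^+ n)%:E)%E); last by rewrite sumEFin.
congr fine; apply: eq_bigr => d _; rewrite -(grid_indic_integral d (c d) L0) /Rintegral fineK//.
by apply: integrable_fin_num => //; exact: grid_indic_integrable.
Qed.

Lemma grid_box_disjoint L (d d' : {ffun 'I_n -> 'I_(rho * L + rho * L)}) t : (0 < L)%N ->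
  grid_box d t -> grid_box d' t -> d = d'.
Proof.
move=> L0 h h'; apply/ffunP => i; apply/val_inj => /=.
have LR : 0 < L%:R :> R by rewrite ltr0n.
move: (h i) (h' i); rewrite /= !in_itv/= !mxE => /andP[h1 h2] /andP[h3 h4].
have a1 := le_lt_trans h1 h4; have a2 := le_lt_trans h3 h2.
have shift (x : R) : x / L%:R + L%:R^-1 = (x + 1) / L%:R by rewrite mulrDl mul1r.
rewrite shift ltr_pM2r ?invr_gt0// in a1.
rewrite shift ltr_pM2r ?invr_gt0// in a2.
have : (d i)%:R < (d' i).+1%:R :> R by rewrite -natr1; lra.
have : (d' i)%:R < (d i).+1%:R :> R by rewrite -natr1; lra.
by rewrite !ltr_nat; lia.
Qed.

Lemma grid_box_cover L t : (0 < L)%N -> f (row_of t) != 0 ->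
  exists d : {ffun 'I_n -> 'I_(rho * L + rho * L)}, grid_box d t.
Proof.
move=> L0 ft; have LR : 0 < L%:R :> R by rewrite ltr0n.
have tr i : `|tnth t i : R| < rho%:R by have := suppf i ft; rewrite mxE.
have bd i : 0 <= (tnth t i + rho%:R : R) * L%:R.
  by apply: mulr_ge0; [have := tr i; rewrite ltr_norml; lra|exact: ltW].
have lt i : (Num.truncn ((tnth t i + rho%:R : R) * L%:R) < rho * L + rho * L)%N.
  have /andP[h _] := truncn_itv (bd i).
  rewrite -(ltr_nat R) (le_lt_trans h)// -mulnDl natrM ltr_pM2r// natrD.
  by have := tr i; rewrite ltr_norml; lra.
exists [ffun i => Ordinal (lt i)] => i /=.
have /andP[h1 h2] := truncn_itv (bd i).
have shift (x : R) : x / L%:R + L%:R^-1 = (x + 1) / L%:R by rewrite mulrDl mul1r.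
rewrite in_itv/= mxE ffunE /= shift ler_pdivrMr// ltr_pdivlMr//.
by rewrite natrM; rewrite -natr1 in h2; apply/andP; split; nra.
Qed.

Lemma grid_stepE L (c : {ffun 'I_n -> 'I_(rho * L + rho * L)} -> R) d t : (0 < L)%N ->
  grid_box d t -> grid_step c t = c d.
Proof.
move=> L0 dt; rewrite /grid_step (bigD1 d) //= big1; last first.
  move=> d' /eqP dd'; rewrite indicE memNset ?mulr0// => d't.
  by apply: dd'; exact: (grid_box_disjoint L0 d't dt).
by rewrite addr0 indicE mem_set// mulr1.
Qed.

Lemma grid_step0 L (c : {ffun 'I_n -> 'I_(rho * L + rho * L)} -> R) t :
  (forall d : {ffun 'I_n -> 'I_(rho * L + rho * L)}, ~ grid_box d t) -> grid_step c t = 0.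
Proof.
by move=> nd; rewrite /grid_step big1// => d _; rewrite indicE memNset ?mulr0//; exact: nd.
Qed.

Lemma grid_step_approx L (e : R) t : (0 < L)%N ->
  (forall x y : 'rV[R]_n, (forall i, `|x 0 i - y 0 i| <= L%:R^-1) -> `|f x - f y| <= e) ->
  `|f (row_of t) - grid_step (f \o @grid_point L) t| <= @grid_step L (fun=> e) t.
Proof.
move=> L0 fe.
have [[d dt]|nd] := pselect (exists d : {ffun 'I_n -> 'I_(rho * L + rho * L)}, grid_box d t).
  rewrite !(grid_stepE _ L0 dt); apply: fe => i.
  have := dt i; rewrite /= in_itv /= [row_of _ _ _]mxE ler_norml => /andP[h1 h2].
  have LV : 0 <= L%:R^-1 :> R by rewrite invr_ge0.
  by lra.
have {}nd d : ~ @grid_box L d t by move=> dt; apply: nd; exists d.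
rewrite !grid_step0// subr0.
have [->|ft] := eqVneq (f (row_of t)) 0; first by rewrite normr0.
by have [d /nd] := grid_box_cover L0 ft.
Qed.

Hypothesis uc : forall e : R, 0 < e -> exists2 d : R, 0 < d &
  forall x y : 'rV[R]_n, (forall i, `|x 0 i - y 0 i| < d) -> `|f x - f y| <= e.

Let uc_grid e : 0 < e -> exists L0 : nat, forall L, (L0 < L)%N ->
  forall x y : 'rV[R]_n, (forall i, `|x 0 i - y 0 i| <= L%:R^-1) -> `|f x - f y| <= e.
Proof.
move=> /uc[d d0 fd]; exists (Num.truncn d^-1) => L Ld x y xy; apply: fd => i.
apply: (le_lt_trans (xy i)).
have dV : 0 < d^-1 by rewrite invr_gt0.
have /andP[_ h] := truncn_itv (ltW dV).
rewrite -[ltRHS]invrK ltf_pV2 ?posrE ?invr_gt0// ?ltr0n; last by apply: leq_trans Ld.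
by apply: (lt_le_trans h); rewrite ler_nat.
Qed.

(** A pointwise limit of step functions on boxes, which are measurable for the product sigma-algebra
    on tuples. *)
Lemma test_row_measurable : measurable_fun setT (f \o row_of).
Proof.
apply: (@measurable_fun_cvg _ _ R setT
  (fun m => grid_step (f \o @grid_point m.+1))) => [m|t _].
  have /integrableP[h _] := grid_step_integrable (f \o @grid_point m.+1) (ltn0Sn m).
  exact/measurable_EFinP.
apply/cvgrPdist_le => e e0; have [L0 fe] := uc_grid e0.
near=> m; apply: (le_trans (grid_step_approx t (ltn0Sn m) _)).
  by apply: fe; near: m; exact: nbhs_infty_ge.
have [[d dt]|nd] := pselect (exists d : {ffun 'I_n -> 'I_(rho * m.+1 + rho * m.+1)}, grid_box d t).
  by rewrite (grid_stepE _ _ dt).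
by rewrite grid_step0 ?ltW// => d dt; apply: nd; exists d.
Unshelve. all: by end_near. Qed.

Lemma test_row_integrable : mu.-integrable setT (EFin \o (f \o row_of)).
Proof.
have [L fe] := uc_grid ltr01.
apply: (le_integrable measurableT (g := EFin \o
  (fun t => grid_step (fun d => `|f (@grid_point L.+1 d)| + 1) t))).
- by apply/measurable_EFinP; exact: test_row_measurable.
- move=> t _; rewrite /= lee_fin.
  have h := grid_step_approx t (ltn0Sn L) (fe _ (ltnSn L)).
  have [[d dt]|nd] := pselect (exists d : {ffun 'I_n -> 'I_(rho * L.+1 + rho * L.+1)}, grid_box d t).
    rewrite (grid_stepE _ _ dt)// [leRHS]ger0_norm ?addr_ge0//.
    rewrite !(grid_stepE _ _ dt)//= in h.
    by have := ler_normD (f (row_of t) - f (grid_point d)) (f (grid_point d)); rewrite subrK; lra.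
  have {}nd d : ~ @grid_box L.+1 d t by move=> dt; apply: nd; exists d.
  by move: h; rewrite !grid_step0// subr0 normr0.
- exact: grid_step_integrable.
Qed.

(** The boxes fill a cube of side [2 rho], whose volume multiplies the pointwise error [e]. *)
Lemma riemann_sum_le L (e : R) : (0 < L)%N ->
  (forall x y : 'rV[R]_n, (forall i, `|x 0 i - y 0 i| <= L%:R^-1) -> `|f x - f y| <= e) ->
  `|integral_Rn f - (\sum_d f (@grid_point L d)) * L%:R^-1 ^+ n| <= e * (rho + rho)%:R ^+ n.
Proof.
move=> L0 fe.
have i1 := test_row_integrable.
have i2 := grid_step_integrable (f \o @grid_point L) L0.
have i3 := grid_step_integrable (fun=> e : R) L0.
rewrite -(grid_step_integral _ L0) /integral_Rn.
have -> : \int[mu]_t f (\row_(i < n) tnth t i) - \int[mu]_t grid_step (fun d => f (@grid_point L d)) t =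
   \int[mu]_t (f (row_of t) - grid_step (f \o @grid_point L) t) by rewrite RintegralB.
have i4 : mu.-integrable setT (EFin \o (fun t => f (row_of t) - grid_step (f \o @grid_point L) t)).
  rewrite (_ : _ \o _ = (EFin \o (f \o row_of)) \-
    (EFin \o (grid_step (f \o @grid_point L))))%E //.
  exact: integrableB.
apply: (le_trans (le_normr_Rintegral measurableT i4)).
apply: (le_trans (le_Rintegral measurableT (integrable_norm i4) i3 (fun t _ => grid_step_approx t L0 fe))).
rewrite grid_step_integral// sumr_const card_ffun !card_ord.
rewrite -[e *+ _]mulr_natr natrX -mulrA -exprMn -mulnDl natrM -mulrA mulfV ?mulr1//.
by rewrite pnatr_eq0 -lt0n.
Qed.

End riemann_sum.

Section lattice_offsets.
Context {R : realType} {n : nat}.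
Implicit Types (W L rho m : nat).

(* [e] lists the offsets of positions [1 .. n], shifted by [W] to be natural
   numbers; position 0 has offset [W], that is 0 after recentering. *)
Definition ffun_nat W p (e : {ffun 'I_n -> 'I_p}) m : nat :=
  if m is m'.+1 then oapp (fun i : 'I_n => e i : nat) 0%N (insub m') else W.

Lemma ffun_natS W p (e : {ffun 'I_n -> 'I_p}) (i : 'I_n) : ffun_nat W e i.+1 = e i.
Proof. by rewrite /ffun_nat valK. Qed.

Lemma ffun_nat_lt W p (e : {ffun 'I_n -> 'I_p.+1}) m : (ffun_nat W e m.+1 <= p)%N.
Proof. by rewrite /=; case: insub => //= i; rewrite -ltnS. Qed.

Definition offset_row W L (e : {ffun 'I_n -> 'I_(W + W).+1}) : 'rV[R]_n :=
  \row_(i < n) (((ffun_nat W e i)%:R - (ffun_nat W e i.+1)%:R) / L%:R).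

(** A grid point lists consecutive differences, a pattern [e] lists positions; partial sums pass
    from the former to the latter, and [n * (rho * L) <= W] keeps them inside the window. Patterns
    without a counterpart have a difference beyond the support of [f]. *)
Lemma sum_offset_grid W L rho (f : 'rV[R]_n -> R) : (0 < L)%N -> (0 < rho)%N ->
  (n * (rho * L) <= W)%N ->
  (forall (x : 'rV[R]_n) i, f x != 0 -> `|x 0 i| < rho%:R) ->
  \sum_e f (@offset_row W L e) = \sum_d f (@grid_point R n rho L d).
Proof.
move=> L0 rho0 nW suppf; set q := (rho * L)%N in nW *.
have q0 : (0 < q)%N by rewrite muln_gt0 rho0 L0.
have qq0 : (0 < q + q)%N by lia.
have LR : 0 < L%:R :> R by rewrite ltr0n.
pose D (d : {ffun 'I_n -> 'I_(q + q)}) m := (\sum_(i < m) ffun_nat 0 d i.+1)%N.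
have D_le d m : (D d m <= m * (q + q))%N.
  rewrite -[X in (_ <= X * _)%N]card_ord -sum_nat_const; apply: leq_sum => i _ /=.
  by case: insub => //= j; apply: ltnW.
(* The digit [d i] stands for the difference [d i - q], so position [m] is [W + m * q - D d m]. *)
pose g (d : {ffun 'I_n -> 'I_(q + q)}) : {ffun 'I_n -> 'I_(W + W).+1} :=
  [ffun j : 'I_n => inord (W + j.+1 * q - D d j.+1)].
have gE d m : (m <= n)%N -> (ffun_nat W (g d) m + D d m)%N = (W + m * q)%N.
  case: m => [|m] mn; first by rewrite /D big_ord0 /= mul0n.
  have a1 : (m.+1 * q <= W)%N by apply: leq_trans nW; rewrite leq_mul2r mn orbT.
  have a2 := D_le d m.+1; rewrite mulnDr in a2.
  rewrite (ffun_natS W (g d) (Ordinal mn)) ffunE inordK/=; last by rewrite ltnS; lia.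
  by rewrite subnK//; lia.
(* The default value of [insubd] is reached only if a difference is out of range, and then [f]
   vanishes at the pattern. *)
pose h (e : {ffun 'I_n -> 'I_(W + W).+1}) : {ffun 'I_n -> 'I_(q + q)} :=
  [ffun i : 'I_n => insubd (Ordinal qq0) (ffun_nat W e i + q - ffun_nat W e i.+1)%N].
have fg d : offset_row L (g d) = grid_point d.
  apply/rowP => i; rewrite !mxE; congr (_ / _).
  have /(congr1 (GRing.natmul (1 : R))) := gE d i (ltnW (ltn_ord i)).
  have /(congr1 (GRing.natmul (1 : R))) := gE d i.+1 (ltn_ord i).
  rewrite /D big_ord_recr/= (valK i) /= -/(D d i) mulSn !natrD.
  rewrite -/q; move: (ffun_nat W (g d) i) (D d i) (i * q)%N => A B C.
  by move: (g d i : nat) (d i : nat) => e1 e2; clear; lra.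
have hg d : h (g d) = d.
  apply/ffunP => i; apply/val_inj; rewrite ffunE /=.
  have := gE d i (ltnW (ltn_ord i)); have := gE d i.+1 (ltn_ord i).
  rewrite /D big_ord_recr/= (valK i) /= -/(D d i) mulSn.
  move: (ffun_nat W (g d) i) (D d i) (i * q)%N => A B C E1 E2.
  have -> : (A + q - g d i = d i)%N by lia.
  by rewrite val_insubd /= ltn_ord.
have gh e : f (offset_row L e) != 0 -> g (h e) = e.
  move=> fe.
  have he (i : 'I_n) : (ffun_nat W e i.+1 + ffun_nat 0 (h e) i.+1 = ffun_nat W e i + q)%N.
    rewrite (ffun_natS 0 (h e)) ffunE val_insubd.
    have := suppf _ i fe; rewrite mxE normrM normfV (ger0_norm (ltW LR)) ltr_pdivrMr//.
    rewrite -natrM -/q ltr_norml => /andP[h1 h2].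
    have k1 : (ffun_nat W e i.+1 < ffun_nat W e i + q)%N by rewrite -(ltr_nat R) natrD; lra.
    have k2 : (ffun_nat W e i < ffun_nat W e i.+1 + q)%N by rewrite -(ltr_nat R) natrD; lra.
    by rewrite ifT; lia.
  have E m : (m <= n)%N -> (ffun_nat W e m + D (h e) m)%N = (W + m * q)%N.
    elim: m => [|m IH] mn; first by rewrite /D big_ord0 mul0n /= addn0.
    rewrite /D big_ord_recr -/(D (h e) m) [nat_of_ord _]/=.
    have := he (Ordinal mn); rewrite [nat_of_ord _]/=.
    have := IH (ltnW mn); rewrite mulSn.
    move: (ffun_nat W e m.+1) (ffun_nat 0 (h e) m.+1) => A B.
    by move: (ffun_nat W e m) (D (h e) m) (m * q)%N => ? ? ?; clear; simpl; lia.
  apply/ffunP => i; apply/val_inj; rewrite /= -(ffun_natS W (g (h e)) i) -(ffun_natS W e i).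
  by have := E i.+1 (ltn_ord i); rewrite -(gE (h e) i.+1 (ltn_ord i)) => /addIn.
rewrite (bigID (fun e => f (offset_row L e) != 0)) /= [X in _ + X]big1 ?addr0; last first.
  by move=> e /negPn/eqP.
rewrite (reindex_onto g h) /=; last exact: gh.
rewrite [RHS](bigID (fun d => f (grid_point d) != 0)) /= [X in _ = _ + X]big1 ?addr0; last first.
  by move=> e /negPn/eqP.
by apply: eq_big => [d|d _]; rewrite ?hg ?eqxx ?andbT fg.
Qed.

End lattice_offsets.

(** * Correlation sums as combinations of cell counts *)

Section nearest_integer.
Context {R : realType}.
Implicit Types t : R.

Definition nearest_int t : int := Num.floor (t + 2^-1).

Definition int_offset t : R := t - (nearest_int t)%:~R.

Lemma int_offset_le t : `|int_offset t| <= 2^-1.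
Proof.
have /andP[h1 h2] := floor_itv (t + 2^-1).
by rewrite /int_offset /nearest_int ler_norml; rewrite intrD in h2; lra.
Qed.

Lemma nearest_int_unique t (w : int) : `|t - w%:~R| < 2^-1 -> nearest_int t = w.
Proof.
move=> h; apply: floor_def; rewrite intrD; move: h; rewrite ltr_norml => /andP[h1 h2].
by apply/andP; split; lra.
Qed.

End nearest_integer.

Section unfold.
Context {R : realType} {n : nat}.
Variables (f : 'rV[R]_n -> R) (rho N : nat) (y : nat -> R).
Hypothesis suppf : forall (x : 'rV[R]_n) i, f x != 0 -> `|x 0 i| < rho%:R.
Hypothesis rhoN : (2 * (n * rho) < N)%N.

Definition offset_at m : R := int_offset (y m - y 0%N).

Definition gap_row : 'rV[R]_n :=
  \row_(i < n) (N%:R * (offset_at i - offset_at i.+1)).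

Let N0 : 0 < N%:R :> R. Proof. by rewrite ltr0n; lia. Qed.

Lemma offset_at0 : offset_at 0 = 0.
Proof.
rewrite /offset_at subrr /int_offset (@nearest_int_unique _ 0 0) ?subrr//.
by rewrite normr0 invr_gt0.
Qed.

Lemma chain_small (a : nat -> R) : a 0%N = 0 ->
  (forall i : 'I_n, `|N%:R * (a i - a i.+1)| < rho%:R) ->
  forall m, (m <= n)%N -> `|a m| <= (n * rho)%:R / N%:R.
Proof.
move=> a0 small m mn; apply: (@le_trans _ _ ((m * rho)%:R / N%:R)); last first.
  by rewrite ler_pM2r ?invr_gt0// ler_nat leq_mul2r mn orbT.
elim: m mn => [|m IH] mn; first by rewrite a0 normr0 mul0n mul0r.
have := small (Ordinal mn); rewrite /= normrM (ger0_norm (ltW N0)) mulrC -ltr_pdivlMr// => h.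
have -> : a m.+1 = a m - (a m - a m.+1) by ring.
rewrite mulSn natrD mulrDl [leRHS]addrC; apply: (le_trans (ler_normB _ _)).
by apply: lerD; [exact: IH (ltnW mn)|exact: ltW].
Qed.

Let small_half : (n * rho)%:R / N%:R < 2^-1 :> R.
Proof. by rewrite ltr_pdivrMr// mulrC ltr_pdivlMr// mulrC -natrM ltr_nat. Qed.

Lemma gap_row_small m : f gap_row != 0 -> (m <= n)%N ->
  `|offset_at m| <= (n * rho)%:R / N%:R.
Proof.
move=> fG; apply: (chain_small offset_at0) => i.
by have := suppf i fG; rewrite mxE.
Qed.

(** If a term is nonzero, the chosen integer translates of the points lie within
    [n * rho / N < 1 / 2] of point 0, so they are the nearest ones. At most one [m] survives, and
    its term is [f gap_row]. *)
Lemma correlation_term_unfold :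
  \sum_(m \in [set: 'rV[int]_n])
    f (N%:R *: (\row_(i < n) (y i - y i.+1) - map_mx intr m)) = f gap_row.
Proof.
pose z m := nearest_int (y m - y 0%N).
pose m0 : 'rV[int]_n := \row_(i < n) (z i - z i.+1).
have -> : gap_row = N%:R *: (\row_(i < n) (y i - y i.+1) - map_mx intr m0).
  apply/rowP => i; rewrite !mxE intrB /offset_at /int_offset -/(z i) -/(z i.+1).
  by congr (_ * _); ring.
rewrite -(fsbig_widen [set m0])//= ?fsbig_set1// => m [_ /= mm0].
apply: contra_notP mm0 => /eqP fm; apply/rowP => i.
(* Partial sums of [- m] turn integer translates of the differences into translates of the points,
   with point 0 fixed. *)
pose w j : int := - \sum_(l < n | (l < j)%N) m 0 l.
have wS (j : 'I_n) : w j - w j.+1 = m 0 j.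
  rewrite /w opprK addrC (bigD1 j)//= (eq_bigl (fun l : 'I_n => (l < j)%N)) ?addrK//.
  by move=> l; rewrite -val_eqE /=; lia.
have w0 : w 0%N = 0 by rewrite /w big_pred0 ?oppr0.
have small j : (j <= n)%N -> `|y j - y 0%N - (w j)%:~R| <= (n * rho)%:R / N%:R.
  apply: (chain_small (a := fun j => y j - y 0%N - (w j)%:~R)) => [|l].
    by rewrite w0 mulr0z subrr subr0.
  have := suppf l fm; rewrite !mxE -(wS l) intrB; congr (`|_ * _| < _); ring.
have zw j : (j <= n)%N -> z j = w j.
  by move=> /small h; apply: nearest_int_unique; exact: le_lt_trans small_half.
by rewrite mxE (zw i (ltnW (ltn_ord i))) (zw i.+1 (ltn_ord i)) wS.
Qed.

End unfold.

Definition cell_offset {R : realType} {n} W k (e : {ffun 'I_n -> 'I_(W + W).+1}) (j : 'I_n.+1) : R :=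
  ((ffun_nat W e j)%:R - W%:R) / k%:R.

(** The bound of [soft_cell_tail]. *)
Definition cell_tail {R : realType} k : R := (k * k ^ 3)%:R * expR (- k%:R).

Section cells.
Context {R : realType} {n : nat}.
Variables (f : 'rV[R]_n -> R) (rho N N' L W : nat) (B eps : R) (y : nat -> R).
Hypothesis suppf : forall (x : 'rV[R]_n) i, f x != 0 -> `|x 0 i| < rho%:R.
Hypothesis fB : forall x, `|f x| <= B.
Hypothesis fe : forall x y : 'rV[R]_n,
  (forall i, `|x 0 i - y 0 i| < 9 / L%:R) -> `|f x - f y| <= eps.
Hypothesis rhoN : (2 * (n * rho) < N)%N.
Hypothesis L0 : (0 < L)%N.
Hypothesis NN' : (N <= N')%N.
Hypothesis N'N : (N' <= 2 * N)%N.
(** Points of a tuple seen by [f] lie within [n * rho / N <= 2 * (n * (rho * L)) / K] of point 0,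
    that is, [2 * (n * (rho * L))] cells; the 4 allows for the blur [2 / K] of two soft cells.
    [slow] makes the passage from [N] to [N'] cost at most [1 / L], and [WK] keeps offsets below
    [1 / 4], so that they are unambiguous modulo 1. *)
Hypothesis WE : W = (4 + 2 * (n * (rho * L)))%N.
Hypothesis slow : (2 * W * (N' - N) <= N')%N.
Hypothesis WK : (4 * W <= L * N')%N.

Notation K := (L * N')%N.
Notation T := (soft_cell K : R -> R).

Definition cell_pattern (e : {ffun 'I_n -> 'I_(W + W).+1}) (t : R) : R :=
  \prod_(j < n.+1) T (y j - (t + cell_offset K e j)).

Let N0 : 0 < N%:R :> R. Proof. by rewrite ltr0n; lia. Qed.
Let K0 : 0 < K%:R :> R. Proof. by rewrite ltr0n; lia. Qed.
Let LR : 0 < L%:R :> R. Proof. by rewrite ltr0n. Qed.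
Let N'0 : 0 < N'%:R :> R. Proof. by rewrite ltr0n; lia. Qed.
Let K1 : (1 < K)%N. Proof. by lia. Qed.
Let tail0 : 0 <= cell_tail K :> R. Proof. by rewrite mulr_ge0// expR_ge0. Qed.

Let far_or_near t : T t <= cell_tail K \/ exists z : int, `|t - z%:~R| < 2 / K%:R.
Proof.
have [h|h] := pselect (exists z : int, `|t - z%:~R| < 2 / K%:R); [by right|left].
by apply: soft_cell_tail => // z; rewrite leNgt; apply/negP => hz; apply: h; exists z.
Qed.

Lemma cell_pattern_ge0 e t : 0 <= cell_pattern e t.
Proof. by apply: prodr_ge0 => j _; exact: soft_cell_ge0. Qed.

Lemma cell_pattern_tail e t (j : 'I_n.+1) :
  T (y j - (t + cell_offset K e j)) <= cell_tail K -> cell_pattern e t <= cell_tail K.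
Proof.
move=> h; rewrite /cell_pattern (bigD1 j)//=; apply: (le_trans _ h).
rewrite ler_piMr ?soft_cell_ge0//; apply: prodr_ile1 => i _.
by rewrite soft_cell_ge0 soft_cell_le1.
Qed.

Lemma int_small (z : int) : `|z%:~R| < 1 :> R -> z = 0.
Proof. by rewrite -intr_norm -[1]/(1%:~R) ltr_int; lia. Qed.

(** The constant is [9 = 4 + 4 + 1]: two offsets known up to [4 / K] each, and the replacement of
    the scaling factor [N] by [q]. *)
Lemma near_arith (q d d' o o' : R) : 0 < q -> `|d - o / (L%:R * q)| < 4 / (L%:R * q) ->
   `|d' - o' / (L%:R * q)| < 4 / (L%:R * q) ->
   N%:R <= q -> `|o - o'| * (q - N%:R) <= q ->
  `|N%:R * (d - d') - (o - o') / L%:R| < 9 / L%:R.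
Proof.
move=> q0 h1 h2 Nq oo.
have Lq : 0 < L%:R * q by rewrite mulr_gt0.
have -> : N%:R * (d - d') - (o - o') / L%:R =
   N%:R * (d - o / (L%:R * q)) - N%:R * (d' - o' / (L%:R * q)) - (o - o') * (q - N%:R) / q / L%:R.
  by field; rewrite !gt_eqF.
have t1 (s : R) : `|s| < 4 / (L%:R * q) -> `|N%:R * s| < 4 / L%:R.
  move=> hs; rewrite normrM (ger0_norm (ltW N0)).
  apply: (@lt_le_trans _ _ (N%:R * (4 / (L%:R * q)))); first by rewrite ltr_pM2l.
  rewrite (_ : N%:R * (4 / (L%:R * q)) = N%:R / q * (4 / L%:R)); last by field; rewrite !gt_eqF.
  by apply: ler_piMl; [exact: divr_ge0|rewrite ler_pdivrMr ?mul1r].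
have t3 : `|(o - o') * (q - N%:R) / q / L%:R| <= 1 / L%:R.
  rewrite !normrM !normfV (gtr0_norm q0) (gtr0_norm LR) (ger0_norm (_ : 0 <= q - N%:R)) ?subr_ge0//.
  by rewrite ler_pM2r ?invr_gt0// ler_pdivrMr ?mul1r.
apply: (le_lt_trans (ler_normB _ _)).
have := ler_normB (N%:R * (d - o / (L%:R * q))) (N%:R * (d' - o' / (L%:R * q))).
have := t1 _ h1; have := t1 _ h2.
have -> : 9 / L%:R = 4 / L%:R + 4 / L%:R + 1 / L%:R :> R by field; rewrite gt_eqF.
by lra.
Qed.

(** Either some factor is in its tail, and then so is the product, or all points are near their
    cells and the two arguments of [f] differ by less than [9 / L]. *)
Lemma cell_pattern_approx e t :
  cell_pattern e t * `|f (gap_row N y) - f (offset_row L e)| <=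
  eps * cell_pattern e t + 2 * B * cell_tail K.
Proof.
have P0 := cell_pattern_ge0 e t.
have B0 : 0 <= B by exact: le_trans (fB 0).
have e0 : 0 <= eps by apply: le_trans (fe (x := 0) (y := 0) _) => // i; rewrite subrr normr0 divr_gt0.
have [[j hj]|near] := pselect (exists j : 'I_n.+1, T (y j - (t + cell_offset K e j)) <= cell_tail K).
  have Pt := cell_pattern_tail hj.
  have fd : `|f (gap_row N y) - f (offset_row L e)| <= 2 * B.
    apply: (le_trans (ler_normB _ _)); have := fB (gap_row N y); have := fB (offset_row L e); lra.
  apply: (@le_trans _ _ (2 * B * cell_tail K)); last by rewrite lerDr mulr_ge0.
  rewrite [leRHS]mulrC; exact: ler_pM.
apply: (@le_trans _ _ (eps * cell_pattern e t)); last by rewrite lerDl !mulr_ge0.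
rewrite mulrC ler_wpM2r//; apply: fe => i.
have {}near (j : 'I_n.+1) : exists z : int, `|y j - (t + cell_offset K e j) - z%:~R| < 2 / K%:R.
  by have [h|//] := far_or_near (y j - (t + cell_offset K e j)); case: near; exists j.
have K4 : 4 / K%:R <= 4^-1 :> R.
  by rewrite ler_pdivrMr// mulrC ler_pdivlMr// -natrM ler_nat; lia.
have off_le m : (m <= n)%N -> `|(ffun_nat W e m)%:R - W%:R| <= W%:R :> R.
  case: m => [|m] _; first by rewrite subrr normr0.
  have := ffun_nat_lt W e m; rewrite -(ler_nat R) natrD => h.
  by rewrite ler_norml; have : 0 <= (ffun_nat W e m.+1)%:R :> R by []; lra.
(* The [4 / K] adds the blur at positions [m] and 0. The integer ambiguity [z] vanishes because
   [|z| < 1 / 2 + 1 / 4 + 1 / 4]. *)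
have off m : (m <= n)%N -> `|offset_at y m - ((ffun_nat W e m)%:R - W%:R) / K%:R| < 4 / K%:R.
  move=> mn; have [z0 h0] := near ord0; have [z1 h1] := near (inord m).
  rewrite /cell_offset inordK//= in h1; rewrite /cell_offset/= subrr mul0r addr0 in h0.
  have ol := off_le _ mn.
  pose z : int := nearest_int (y m - y 0%N) - (z1 - z0).
  have h2 : `|offset_at y m - ((ffun_nat W e m)%:R - W%:R) / K%:R + z%:~R| < 4 / K%:R.
    rewrite /offset_at /int_offset /z !intrB.
    set o := (_ - _) / K%:R in h1 *.
    rewrite (_ : _ - _ + _ = (y m - (t + o) - z1%:~R) - (y 0%N - t - z0%:~R)); last by ring.
    apply: (le_lt_trans (ler_normB _ _)).
    have -> : 4 / K%:R = 2 / K%:R + 2 / K%:R :> R by rewrite -mulrDl -natrD.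
    exact: ltrD.
  suff zE : z = 0 by move: h2; rewrite zE mulr0z addr0.
  apply: int_small.
  have od : `|((ffun_nat W e m)%:R - W%:R) / K%:R| <= 4^-1 :> R.
    rewrite normrM normfV (gtr0_norm K0) ler_pdivrMr//; apply: (le_trans ol).
    by rewrite mulrC ler_pdivlMr// -natrM ler_nat mulnC.
  have := int_offset_le (y m - y 0%N); rewrite -/(offset_at y m).
  move: h2 od; set o := (_ - _) / K%:R; move: K4.
  by rewrite !(ltr_norml, ler_norml); move: (4 / K%:R) => q; lra.
have := off i (ltnW (ltn_ord i)); have := off i.+1 (ltn_ord i).
rewrite natrM => h1 h2.
have := near_arith N'0 h2 h1; rewrite !mxE => na.
rewrite (_ : (ffun_nat W e i)%:R - (ffun_nat W e i.+1)%:R =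
   (ffun_nat W e i)%:R - W%:R - ((ffun_nat W e i.+1)%:R - W%:R)) ?ler_nat; last by ring.
apply: na; first by rewrite ler_nat.
have := off_le i (ltnW (ltn_ord i)); have := off_le i.+1 (ltn_ord i) => k1 k2.
apply: (@le_trans _ _ ((W%:R + W%:R) * (N'%:R - N%:R))).
  by apply: ler_wpM2r; [rewrite subr_ge0 ler_nat|apply: (le_trans (ler_normB _ _)); exact: lerD].
by rewrite -natrB// -natrD -natrM ler_nat addnn -mul2n.
Qed.

Let cell_row (i : nat) (c : nat) : R :=
  \sum_(o < (W + W).+1) T (y i - (c%:R / K%:R + (o%:R - W%:R) / K%:R)).

Lemma sum_cell_pattern c :
  \sum_e cell_pattern e (c%:R / K%:R) =
  T (y 0%N - c%:R / K%:R) * \prod_(i < n) cell_row i.+1 c.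
Proof.
rewrite /cell_row bigA_distr_bigA mulr_sumr; apply: eq_bigr => e _.
rewrite /cell_pattern big_ord_recl; congr (T _ * _).
  by rewrite /cell_offset/= subrr mul0r addr0.
by apply: eq_bigr => i _; rewrite /cell_offset lift0 ffun_natS.
Qed.

Let cell_row_ge0 i c : 0 <= cell_row i c.
Proof. by apply: sumr_ge0 => o _; exact: soft_cell_ge0. Qed.

Let cell_row_split i c :
  cell_row i c + \sum_((W + W).+1 <= o < K) T (y i - (c%:R / K%:R + (o%:R - W%:R) / K%:R)) = 1.
Proof.
rewrite /cell_row -(big_mkord xpredT (fun o => T (y i - (c%:R / K%:R + (o%:R - W%:R) / K%:R)))).
rewrite -big_cat_nat//=; last by clear -WK WE; lia.
rewrite -[RHS](sum_soft_cell (y i - (c%:R / K%:R - W%:R / K%:R)) K1) big_mkord.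
by apply: eq_bigr => o _; congr (T _); rewrite mulrBl; ring.
Qed.

Let cell_row_le1 i c : cell_row i c <= 1.
Proof.
rewrite -(cell_row_split i c) lerDl; apply: sumr_ge0 => o _; exact: soft_cell_ge0.
Qed.

(** The offsets outside the window, which would complete the partition of unity, place point [i] too
    far from point 0 for [f] to be nonzero; each of them contributes a tail only. *)
Let cell_row_lb i c : f (gap_row N y) != 0 -> (i <= n)%N ->
  (exists z : int, `|y 0%N - c%:R / K%:R - z%:~R| < 2 / K%:R) ->
  1 - cell_row i c <= K%:R * cell_tail K.
Proof.
move=> fG i_n [z hz]; rewrite -[X in X - _](cell_row_split i c) addrC addKr.
apply: (@le_trans _ _ (\sum_((W + W).+1 <= o < K) cell_tail K)); last first.
  rewrite sumr_const_nat -[leLHS]mulr_natl; apply: ler_wpM2r; [exact: tail0|by rewrite ler_nat leq_subr].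
apply: ler_sum_nat => o /andP[lo hi].
have [//|[z' hz']] := far_or_near (y i - (c%:R / K%:R + (o%:R - W%:R) / K%:R)).
exfalso.
pose w : int := z' - z - nearest_int (y i - y 0%N).
have dy := gap_row_small suppf rhoN fG i_n.
have h : `|(o%:R - W%:R) / K%:R + w%:~R| < W%:R / K%:R :> R.
  have -> : (o%:R - W%:R) / K%:R + w%:~R =
     offset_at y i - (y i - (c%:R / K%:R + (o%:R - W%:R) / K%:R) - z'%:~R) +
     (y 0%N - c%:R / K%:R - z%:~R) :> R.
    by rewrite /w /offset_at /int_offset !intrB; ring.
  apply: (le_lt_trans (ler_normD _ _)).
  apply: (@lt_le_trans _ _ ((n * rho)%:R / N%:R + 2 / K%:R + 2 / K%:R)).
    apply: ltrD => //; apply: (le_lt_trans (ler_normB _ _)); exact: ler_ltD.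
  rewrite -addrA -mulrDl -natrD; apply: (@le_trans _ _ ((2 * (n * (rho * L)))%:R / K%:R + 4 / K%:R)).
    apply: lerD; last by [].
    rewrite ler_pdivrMr// mulrAC ler_pdivlMr// -!natrM ler_nat.
    have -> : (2 * (n * (rho * L)) * N = n * rho * (L * (2 * N)))%N by clear; lia.
    by rewrite !leq_mul2l N'N !orbT.
  by rewrite -mulrDl -natrD ler_pM2r ?invr_gt0// ler_nat WE addnC.
have {}h : `|o%:R - W%:R + K%:R * w%:~R| < W%:R :> R.
  have -> : o%:R - W%:R + K%:R * w%:~R = ((o%:R - W%:R) / K%:R + w%:~R) * K%:R :> R.
    by rewrite mulrDl divfK ?gt_eqF// [w%:~R * _]mulrC.
  by rewrite normrM (gtr0_norm K0) -ltr_pdivlMr.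
have {}lo : W%:R + W%:R + 1 <= o%:R :> R by rewrite -natrD natr1 ler_nat.
have {}hi : o%:R + 1 <= K%:R :> R by rewrite natr1 ler_nat.
(* Since [2 W < o < K], the number [o - W] has distance more than [W] from every multiple of [K]. *)
have [w0|w0] : (0 <= w \/ w <= -1)%R by clear; lia.
  have {}w0 : 0 <= K%:R * w%:~R :> R by rewrite mulr_ge0 ?ler0z// ltW.
  by move: h; rewrite ltr_norml => /andP[_ h]; lra.
have {}w0 : K%:R * w%:~R <= - K%:R :> R.
  by rewrite -mulrN1 ler_pM2l// -[leRHS]/((-1)%:~R) ler_int.
by move: h; rewrite ltr_norml => /andP[h _]; lra.
Qed.

Let S : R := \sum_(c < K) \sum_e cell_pattern e (c%:R / K%:R).

Let T0_sum : \sum_(c < K) T (y 0%N - c%:R / K%:R) = 1.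
Proof. exact: sum_soft_cell. Qed.

Let rows_ge0 c : 0 <= \prod_(i < n) cell_row i.+1 c.
Proof. by apply: prodr_ge0 => i _. Qed.

Let rows_le1 c : \prod_(i < n) cell_row i.+1 c <= 1.
Proof. by apply: prodr_ile1 => i _; rewrite cell_row_ge0 cell_row_le1. Qed.

Lemma one_sub_prod_le m (a : 'I_m -> R) (d : R) : (forall i, 0 <= a i <= 1) ->
  (forall i, 1 - a i <= d) -> 1 - \prod_i a i <= m%:R * d.
Proof.
elim: m a => [|m IH] a a01 ad; first by rewrite big_ord0 subrr mul0r.
rewrite big_ord_recl mulrSr.
have p1 : \prod_(i < m) a (lift ord0 i) <= 1 by apply: prodr_ile1 => i _.
have := IH (a \o lift ord0) (fun i => a01 _) (fun i => ad _) => /= h.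
have := a01 ord0; have := ad ord0 => h0 /andP[h1 h2].
rewrite mulrDl mul1r.
set p := \prod_(i < m) _ in p1 h *.
have -> : 1 - a ord0 * p = (1 - a ord0) + a ord0 * (1 - p) by ring.
rewrite addrC; apply: lerD => //; apply: (le_trans _ h).
by rewrite ler_piMl ?subr_ge0.
Qed.

(** [S] is a partition of unity truncated to the window. A base cell near point 0 loses at most
    [n * K] tails times its weight, and these weights sum to at most 1; each of the at most [K] far
    cells loses one more tail. *)
Lemma sum_cell_pattern_defect :
  `|f (gap_row N y)| * `|1 - S| <= B * (n.+1%:R * K%:R * cell_tail K).
Proof.
have B0 : 0 <= B by exact: le_trans (fB 0).
have [fG|fG] := eqVneq (f (gap_row N y)) 0.
  by rewrite fG normr0 mul0r !mulr_ge0.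
apply: ler_pM => //.
have SE : 1 - S = \sum_(c < K) T (y 0%N - c%:R / K%:R) * (1 - \prod_(i < n) cell_row i.+1 c).
  rewrite -{1}T0_sum /S -sumrB; apply: eq_bigr => c _.
  by rewrite sum_cell_pattern; ring.
rewrite SE ger0_norm; last first.
  by apply: sumr_ge0 => c _; rewrite mulr_ge0 ?soft_cell_ge0// subr_ge0.
apply: (@le_trans _ _ (\sum_(c < K)
   (T (y 0%N - c%:R / K%:R) * (n%:R * (K%:R * cell_tail K)) + cell_tail K))).
  apply: ler_sum => c _.
  have [far|near] := far_or_near (y 0%N - c%:R / K%:R).
    apply: (@le_trans _ _ (cell_tail K)); last first.
      by rewrite lerDr; apply: mulr_ge0; [exact: soft_cell_ge0|apply: mulr_ge0 => //; exact: mulr_ge0].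
    apply: (le_trans _ far); rewrite ler_piMr ?soft_cell_ge0//.
    by rewrite gerBl.
  apply: (@le_trans _ _ (T (y 0%N - c%:R / K%:R) * (n%:R * (K%:R * cell_tail K)))); last first.
    by rewrite lerDl.
  apply: ler_wpM2l; first exact: soft_cell_ge0.
  apply: one_sub_prod_le => i; first by rewrite cell_row_ge0 cell_row_le1.
  by apply: cell_row_lb.
rewrite big_split/= -mulr_suml T0_sum mul1r sumr_const card_ord -[X in _ + X]mulr_natl.
by rewrite mulrSr !mulrDl mul1r mulrA.
Qed.

(** Two errors: the missing mass [1 - S], and the variation of [f] over a pattern. The number of
    patterns is bounded crudely by [K ^ n], which is harmless against the exponential tail. *)
Lemma correlation_term_approx :
  `|f (gap_row N y) -
    \sum_(c < K) \sum_e cell_pattern e (c%:R / K%:R) * f (offset_row L e)| <=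
  eps * S + B * (n%:R + 3) * K%:R ^+ n.+1 * cell_tail K.
Proof.
have B0 : 0 <= B by exact: le_trans (fB 0).
set g := f (gap_row N y).
have -> : g - \sum_(c < K) \sum_e cell_pattern e (c%:R / K%:R) * f (offset_row L e) =
   g * (1 - S) + \sum_(c < K) \sum_e cell_pattern e (c%:R / K%:R) * (g - f (offset_row L e)).
  have -> : \sum_(c < K) \sum_e cell_pattern e (c%:R / K%:R) * (g - f (offset_row L e)) =
     g * S - \sum_(c < K) \sum_e cell_pattern e (c%:R / K%:R) * f (offset_row L e).
    rewrite /S mulr_sumr -sumrB; apply: eq_bigr => c _.
    by rewrite mulr_sumr -sumrB; apply: eq_bigr => e _; ring.
  by ring.
apply: (le_trans (ler_normD _ _)); rewrite normrM.
have h1 := sum_cell_pattern_defect; rewrite -/g in h1.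
have h2 : `|\sum_(c < K) \sum_e cell_pattern e (c%:R / K%:R) * (g - f (offset_row L e))| <=
    eps * S + K%:R * (K%:R ^+ n * (2 * B * cell_tail K)).
  apply: (le_trans (ler_norm_sum _ _ _)).
  apply: (@le_trans _ _ (\sum_(c < K) (eps * (\sum_e cell_pattern e (c%:R / K%:R)) +
      K%:R ^+ n * (2 * B * cell_tail K)))); last first.
    by rewrite big_split/= -mulr_sumr sumr_const card_ord -[X in _ + X]mulr_natl.
  apply: ler_sum => c _; apply: (le_trans (ler_norm_sum _ _ _)).
  apply: (@le_trans _ _ (\sum_e (eps * cell_pattern e (c%:R / K%:R) + 2 * B * cell_tail K))).
    apply: ler_sum => e _; rewrite normrM ger0_norm ?cell_pattern_ge0//.
    exact: cell_pattern_approx.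
  rewrite big_split/= -mulr_sumr lerD2l sumr_const card_ffun !card_ord -[leLHS]mulr_natl.
  apply: ler_wpM2r; first by rewrite !mulr_ge0.
  rewrite -natrX ler_nat; have [->//|n0] := posnP n.
  by rewrite leq_exp2r//; clear -WK WE; lia.
apply: (le_trans (lerD h1 h2)); rewrite addrCA lerD2l.
have Kn : K%:R <= K%:R ^+ n.+1 :> R.
  by rewrite -natrX ler_nat -[leqLHS]expn1 leq_exp2l.
have nn : 0 <= n.+1%:R * (B * cell_tail K) by rewrite mulr_ge0// mulr_ge0.
have := ler_wpM2r nn Kn; rewrite exprS -(natr1 n).
by move: (K%:R) (K%:R ^+ n) (cell_tail K) => k kn t; lra.
Qed.

End cells.

Section correlation_sums.
Context {R : realType} {n : nat}.
Variables (f : 'rV[R]_n -> R) (theta : nat -> R).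

Definition map_values N (z : {ffun 'I_n.+1 -> 'I_N.+1}) (m : nat) : R := theta (z (inord m)).

Lemma correlation_sumE rho N :
  (forall (x : 'rV[R]_n) i, f x != 0 -> `|x 0 i| < rho%:R) -> (2 * (n * rho) < N)%N ->
  @correlation_sum R n.+1 f theta N =
  N%:R^-1 * \sum_(z in good_maps n.+1 N 1) f (gap_row N (map_values z)).
Proof.
move=> suppf rhoN; congr (_ * _).
rewrite (reindex (fun z : {ffun 'I_n.+1 -> 'I_N.+1} => [tuple z i | i < n.+1])) /=; last first.
  exists (fun x : n.+1.-tuple 'I_N.+1 => [ffun i => tnth x i]) => [z _|x _].
    by apply/ffunP => i; rewrite ffunE tnth_mktuple.
  by apply: eq_from_tnth => i; rewrite tnth_mktuple ffunE.
apply: eq_big => [z|z _].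
  rewrite inE; apply/andP/good_mapsP => [[u p]|[p zi]].
    split=> [i|i j zij].
      by move/allP: p; apply; rewrite /= map_f ?mem_enum.
    have /tuple_uniqP uz : uniq [tuple z i | i < n.+1] by exact: u.
    by apply: uz; rewrite !tnth_mktuple.
  split.
    rewrite -/(is_true (uniq [tuple z i | i < n.+1])); apply/tuple_uniqP => i j.
    by rewrite !tnth_mktuple; exact: zi.
  by apply/allP => _ /mapP[i _ ->]; exact: p.
rewrite -(correlation_term_unfold _ suppf rhoN); apply: eq_fsbigr => m _; congr (f (_ *: (_ - _))).
have nthE (i : nat) : (i < n.+1)%N -> nth ord0 [tuple z i | i < n.+1] i = z (inord i).
  by move=> ilt; rewrite -[i in LHS]/(nat_of_ord (Ordinal ilt)) -tnth_nth tnth_mktuple;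
    congr (z _); apply/val_inj; rewrite /= inordK.
by apply/rowP => i; rewrite !mxE /map_values !nthE// ltnS ?ltn_ord// ltnW.
Qed.

Definition sequence_cell_corr K (v : 'I_n.+1 -> R) N : R :=
  \sum_(c < K) \sum_(z in good_maps n.+1 N 1)
     \prod_(i < n.+1) soft_cell K (theta (z i) - (c%:R / K%:R + v i)).

Variables (rho L W : nat) (B eps : R).
Hypothesis suppf : forall (x : 'rV[R]_n) i, f x != 0 -> `|x 0 i| < rho%:R.
Hypothesis fB : forall x, `|f x| <= B.
Hypothesis fe : forall x y : 'rV[R]_n,
  (forall i, `|x 0 i - y 0 i| < 9 / L%:R) -> `|f x - f y| <= eps.
Hypothesis L0 : (0 < L)%N.
Hypothesis WE : W = (4 + 2 * (n * (rho * L)))%N.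

Lemma correlation_sum_approx N N' : (2 * (n * rho) < N)%N -> (N <= N')%N ->
  (N' <= 2 * N)%N -> (2 * W * (N' - N) <= N')%N -> (4 * W <= L * N')%N ->
  `|@correlation_sum R n.+1 f theta N -
    (\sum_(e : {ffun 'I_n -> 'I_(W + W).+1})
      sequence_cell_corr (L * N') (cell_offset (L * N') e) N * f (offset_row L e)) / N%:R| <=
  eps * ((\sum_(e : {ffun 'I_n -> 'I_(W + W).+1})
      sequence_cell_corr (L * N') (cell_offset (L * N') e) N) / N%:R) +
  B * (n%:R + 3) * (L * N')%:R ^+ (n.+1 + n.+1) * cell_tail (L * N').
Proof.
move=> rhoN NN' N'N slow WK; set K := (L * N')%N.
pose U (e : {ffun 'I_n -> 'I_(W + W).+1}) := sequence_cell_corr K (cell_offset K e) N.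
have N0 : (0 < N)%N by lia.
have NR : 0 < N%:R :> R by rewrite ltr0n.
have B0 : 0 <= B by exact: le_trans (fB 0).
have NK : (N <= K)%N by rewrite /K -[leqLHS]mul1n leq_mul.
have t0 : 0 <= cell_tail K :> R by rewrite mulr_ge0// expR_ge0.
pose P (z : {ffun 'I_n.+1 -> 'I_N.+1}) c (e : {ffun 'I_n -> 'I_(W + W).+1}) :=
  cell_pattern N' L (map_values z) e (c%:R / K%:R).
have UE (e : {ffun 'I_n -> 'I_(W + W).+1}) :
    U e = \sum_(z in good_maps n.+1 N 1) \sum_(c < K) P z c e.
  rewrite exchange_big/=; apply: eq_bigr => c _; apply: eq_bigr => z _.
  by apply: eq_bigr => i _; rewrite /map_values inord_val.
have VE (g : {ffun 'I_n -> 'I_(W + W).+1} -> R) : \sum_e U e * g e =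
    \sum_(z in good_maps n.+1 N 1) \sum_(c < K) \sum_e P z c e * g e.
  under eq_bigr do rewrite UE mulr_suml.
  rewrite exchange_big/=; apply: eq_bigr => z _.
  by rewrite exchange_big/=; apply: eq_bigr => e _; rewrite mulr_suml.
have S1 : \sum_e U e = \sum_(z in good_maps n.+1 N 1) \sum_(c < K) \sum_e P z c e.
  transitivity (\sum_e U e * 1); first by apply: eq_bigr => e _; rewrite mulr1.
  rewrite VE; apply: eq_bigr => z _; apply: eq_bigr => c _; apply: eq_bigr => e _.
  by rewrite mulr1.
rewrite (correlation_sumE suppf rhoN) VE S1 [X in _ - X]mulrC -mulrBr -sumrB.
rewrite normrM gtr0_norm ?invr_gt0// mulrCA mulrC mulrA.
pose E : R := B * (n%:R + 3) * K%:R ^+ n.+1 * cell_tail K.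
have E0 : 0 <= E by apply: mulr_ge0 => //; apply: mulr_ge0; rewrite ?exprn_ge0// mulr_ge0// addr_ge0.
apply: (@le_trans _ _ ((eps * (\sum_(z in good_maps n.+1 N 1) \sum_(c < K) \sum_e P z c e) +
    (N ^ n.+1)%:R * E) / N%:R)).
  rewrite ler_pM2r ?invr_gt0//; apply: (le_trans (ler_norm_sum _ _ _)).
  apply: (@le_trans _ _ (\sum_(z in good_maps n.+1 N 1)
     (eps * (\sum_(c < K) \sum_e P z c e) + E))).
    apply: ler_sum => z _.
    exact: (correlation_term_approx (map_values z) suppf fB fe rhoN L0 NN' N'N WE slow WK).
  rewrite big_split/= -mulr_sumr lerD2l sumr_const -[leLHS]mulr_natl ler_wpM2r//.
  by rewrite ler_nat card_good_maps subSS subn0 ffact_le_expn.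
rewrite mulrDl; apply: lerD; first by rewrite [eps * _]mulrC.
rewrite natrX exprS (_ : _ / N%:R = N%:R ^+ n * E); last by field; rewrite gt_eqF.
rewrite exprD (_ : _ * cell_tail K = K%:R ^+ n.+1 * E); last by rewrite /E; ring.
apply: ler_wpM2r => //; rewrite -!natrX ler_nat.
apply: (@leq_trans (K ^ n)); last by rewrite leq_pexp2l//; lia.
by have [->//|n0] := posnP n; rewrite leq_exp2r.
Qed.

End correlation_sums.

Lemma subn_le_ratio (R : realFieldType) (q N W : nat) : (0 < q)%N -> (0 < W)%N ->
  1 - (2 * W%:R)^-1 < N%:R / q%:R :> R -> (2 * W * (q - N) <= q)%N.
Proof.
move=> q0 W0; have qR : 0 < q%:R :> R by rewrite ltr0n.
have WR : 0 < 2 * W%:R :> R by rewrite mulr_gt0// ltr0n.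
rewrite ltr_pdivlMr// -(ltr_pM2l WR).
have -> : 2 * W%:R * ((1 - (2 * W%:R)^-1) * q%:R) = 2 * W%:R * q%:R - q%:R :> R.
  by field; rewrite pnatr_eq0 -lt0n.
rewrite ltrBlDr -!natrM -natrD ltr_nat mulnBr.
by move: (2 * W * q)%N (2 * W * N)%N => a b; clear; lia.
Qed.

Section correlation_limit.
Context {R : realType} {n : nat}.

Lemma cell_tail_pow p : exists2 c : R, 0 <= c &
  forall k, k%:R ^+ p * cell_tail k <= c / k%:R.
Proof.
have e1 : 1 < expR 1 :> R by rewrite -[ltLHS]expR0 ltr_expR.
(* The 5 is the factor [k ^ 4] of the tail and one more power for the decay [c / k]. *)
have [c c0 hc] := expn_le_exponential (p + 5) e1.
exists c => // k; have [->|k0] := posnP k.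
  by rewrite /cell_tail mul0n mul0r mulr0 mulr_ge0// invr0.
have kR : 0 < k%:R :> R by rewrite ltr0n.
rewrite ler_pdivlMr//; apply: le_trans (hc k).
rewrite /cell_tail expRN -[X in expR X]mulr1 expRM_natl.
rewrite (_ : (k * k ^ 3)%N = (k ^ 4)%N); last by rewrite -expnS.
by rewrite natrX exprD; apply: eq_ler; ring.
Qed.

Variables (f : 'rV[R]_n -> R) (theta : nat -> R) (nu : nat -> nat).
Hypothesis cf : continuous f.
Hypothesis suppf : compactly_supported f.
Hypothesis nuN : forall N, (N <= nu N)%N.
Hypothesis nu1 : N%:R / (nu N)%:R @[N --> \oo] --> (1 : R).
Hypothesis cells : forall L W (e : {ffun 'I_n -> 'I_(W + W).+1}), (0 < L)%N ->
  sequence_cell_corr theta (L * nu N) (cell_offset (L * nu N) e) N / (nu N)%:R @[N --> \oo] -->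
  (L%:R * L%:R^-1 ^+ n.+1 : R).

Lemma correlation_sum_cvg :
  @correlation_sum R n.+1 f theta N @[N --> \oo] --> integral_Rn f.
Proof.
have [rho rho0 frho] := test_support_bounded suppf.
have [B B0 fB] := test_bounded cf suppf.
have uc := test_uniformly_continuous cf suppf.
apply/cvgrPdist_lt => eta eta0.
pose C1 : R := (rho + rho)%:R ^+ n.
pose C2 : R := (9 + 4 * (n * rho))%:R ^+ n.
have C10 : 0 <= C1 by rewrite exprn_ge0.
have C20 : 0 <= C2 by rewrite exprn_ge0.
pose eps := eta / (C1 + C2 + 1).
have eps0 : 0 < eps by rewrite divr_gt0// ltr_wpDl// addr_ge0.
have epsC : eps * C1 + eps * C2 < eta.
  rewrite -mulrDr mulrAC ltr_pdivrMr ?ltr_pM2l ?ltrDl// ltr_wpDl// addr_ge0//.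
have [d d0 fd] := uc eps eps0.
pose L := (Num.truncn (9 / d)).+1.
have L0 : (0 < L)%N by [].
have LR : 0 < L%:R :> R by rewrite ltr0n.
have Ld : 9 / L%:R < d.
  rewrite ltr_pdivrMr// mulrC -ltr_pdivrMr//.
  have d9 : 0 <= 9 / d by rewrite divr_ge0// ltW.
  by have /andP[_ ] := truncn_itv d9.
have fe (x y : 'rV[R]_n) : (forall i, `|x 0 i - y 0 i| < 9 / L%:R) -> `|f x - f y| <= eps.
  by move=> xy; apply: fd => i; exact: lt_trans (xy i) Ld.
pose W := (4 + 2 * (n * (rho * L)))%N.
pose U N (e : {ffun 'I_n -> 'I_(W + W).+1}) : R :=
  sequence_cell_corr theta (L * nu N) (cell_offset (L * nu N) e) N.
pose A : R := (\sum_(e : {ffun 'I_n -> 'I_(W + W).+1}) f (offset_row L e)) * L%:R^-1 ^+ n.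
have Ule (e : {ffun 'I_n -> 'I_(W + W).+1}) : U N e / N%:R @[N --> \oo] --> (L%:R^-1 ^+ n : R).
  rewrite (_ : L%:R^-1 ^+ n = (L%:R * L%:R^-1 ^+ n.+1) / 1); last first.
    by rewrite divr1 exprS mulrA mulfV ?mul1r ?gt_eqF.
  apply: (@cvg_trans _ ((fun N => (U N e / (nu N)%:R) / (N%:R / (nu N)%:R)) @ \oo)).
    apply: near_eq_cvg; near=> N.
    have N0 : (0 < N)%N by near: N; exact: nbhs_infty_gt.
    have nuN0 : (0 < nu N)%N by exact: leq_trans (nuN N).
    by field; rewrite !pnatr_eq0 -!lt0n N0 nuN0.
  by apply: cvgM; [exact: cells|apply: cvgV; [exact: oner_neq0|exact: nu1]].
have UA : (\sum_e U N e * f (offset_row L e)) / N%:R @[N --> \oo] --> A.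
  rewrite /A mulr_suml (_ : (fun N => _) =
    (fun N => \sum_e U N e / N%:R * f (offset_row L e))); last first.
    by apply/funext => N; rewrite mulr_suml; apply: eq_bigr => e _; rewrite mulrAC.
  apply: cvg_big => [|e _]; first exact: add_continuous.
  by rewrite [X in _ --> X]mulrC; apply: cvgMl; exact: Ule.
have US : (\sum_e U N e) / N%:R @[N --> \oo] --> (((W + W).+1 ^ n)%:R * L%:R^-1 ^+ n : R).
  rewrite (_ : (fun N => _) = (fun N => \sum_e U N e / N%:R)); last first.
    by apply/funext => N; rewrite mulr_suml.
  rewrite (_ : _ * _ = \sum_(e : {ffun 'I_n -> 'I_(W + W).+1}) (L%:R^-1 ^+ n : R)); last first.
    by rewrite sumr_const card_ffun !card_ord mulr_natl.
  by apply: cvg_big => [|e _]; [exact: add_continuous|exact: Ule].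
have SC2 : ((W + W).+1 ^ n)%:R * L%:R^-1 ^+ n <= C2.
  rewrite natrX -exprMn /C2 lerXn2r ?nnegrE ?mulr_ge0 ?invr_ge0// ler_pdivrMr// -natrM ler_nat.
  by rewrite /W; clear -L0; nia.
have [ct ct0 tailb] := cell_tail_pow (n.+1 + n.+1).
have tail0 : B * (n%:R + 3) * (ct / N%:R) @[N --> \oo] --> (0 : R).
  rewrite -(cvg_shiftn 1).
  have : B * (n%:R + 3) * ct * harmonic N @[N --> \oo] --> B * (n%:R + 3) * ct * 0.
    by apply: cvgM; [exact: cvg_cst|exact: cvg_harmonic].
  rewrite mulr0; apply: cvg_trans; apply: near_eq_cvg; near=> N.
  by rewrite /= addn1 mulrA.
have : eps * ((\sum_e U N e) / N%:R) + B * (n%:R + 3) * (ct / N%:R) +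
    `|(\sum_e U N e * f (offset_row L e)) / N%:R - A| @[N --> \oo] -->
    eps * (((W + W).+1 ^ n)%:R * L%:R^-1 ^+ n) + 0 + `|A - A|.
  apply: cvgD; first by apply: cvgD => //; apply: cvgM => //; exact: cvg_cst.
  by apply: cvg_norm; apply: cvgB => //; exact: cvg_cst.
rewrite subrr normr0 !addr0 => /cvgrPdist_lt lim.
have gap : 0 < eta - eps * C1 - eps * C2 by rewrite -addrA -opprD subr_gt0.
have {}lim := lim _ gap.
have W0 : (4 <= W)%N by exact: leq_addr.
have W1 : 0 < (2 * W%:R)^-1 :> R by rewrite invr_gt0 mulr_gt0// ltr0n; clear -W0; lia.
have rat : \forall N \near \oo, 1 - (2 * W%:R)^-1 < N%:R / (nu N)%:R :> R.
  by apply: (cvgr_gt _ nu1); rewrite gtrBl.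
have LVd : L%:R^-1 < d.
  by apply: le_lt_trans Ld; rewrite ler_peMl// ler1n.
have riem : `|integral_Rn f - A| <= eps * C1.
  rewrite /A (sum_offset_grid L0 rho0 _ frho); last by rewrite /W; clear; lia.
  apply: (riemann_sum_le frho uc L0) => x y xy; apply: fd => i.
  exact: le_lt_trans (xy i) LVd.
near=> N.
have N1 : (2 * (n * rho) + 4 * W < N)%N by near: N; exact: nbhs_infty_gt.
have nuN0 : (0 < nu N)%N by apply: leq_trans (nuN N); clear -N1; lia.
have slow : (2 * W * (nu N - N) <= nu N)%N.
  apply: (@subn_le_ratio R) => //.
  by near: N.
have N'N : (nu N <= 2 * N)%N.
  have : (8 * (nu N - N) <= nu N)%N.
    apply: leq_trans slow; rewrite leq_mul2r; apply/orP; right.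
    by rewrite -[8%N]/(2 * 4)%N leq_mul2l W0.
  by have := nuN N; move: (nu N) => q; clear; lia.
have WK : (4 * W <= L * nu N)%N.
  apply: (@leq_trans (nu N)); last by rewrite leq_pmull.
  by have := nuN N; clear -N1; lia.
have rhoN : (2 * (n * rho) < N)%N by clear -N1; lia.
have h1 := correlation_sum_approx theta frho fB fe L0 (erefl W) rhoN (nuN N) N'N slow WK.
have h2 : B * (n%:R + 3) * (L * nu N)%:R ^+ (n.+1 + n.+1) * cell_tail (L * nu N) <=
    B * (n%:R + 3) * (ct / N%:R).
  rewrite -mulrA; apply: ler_wpM2l; first by rewrite mulr_ge0// addr_ge0.
  apply: (le_trans (tailb _)); apply: ler_wpM2l => //.
  rewrite lef_pV2 ?posrE ?ltr0n ?ler_nat; [|by rewrite muln_gt0 L0|by clear -N1; lia].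
  by apply: (leq_trans (nuN N)); rewrite leq_pmull.
have h3 : `|eps * (((W + W).+1 ^ n)%:R * L%:R^-1 ^+ n) -
   (eps * ((\sum_e U N e) / N%:R) + B * (n%:R + 3) * (ct / N%:R) +
    `|(\sum_e U N e * f (offset_row L e)) / N%:R - A|)| < eta - eps * C1 - eps * C2 by near: N.
rewrite -/(U N) in h1.
have h4 := ler_wpM2l (ltW eps0) SC2.
rewrite ltr_distl in h3; case/andP: h3 => h3 h3'.
set V := (\sum_e U N e * f (offset_row L e)) / N%:R in h1 h3 h3'.
move: h1; set c := @correlation_sum R n.+1 f theta N; set I := integral_Rn f in riem * => h1.
have -> : I - c = (I - A) - (V - A) - (c - V) by ring.
apply: (le_lt_trans (ler_normB _ _)); have := ler_normB (I - A) (V - A).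
by move: riem h1 h2 h3 h3' h4; clear; lra.
Unshelve. all: by end_near. Qed.

End correlation_limit.

(** * Interpolation between the lengths of the sparse sequence *)

Section scale_index.
Implicit Types (k j N : nat).

Lemma leq_scale k j : (j <= scale k j)%N.
Proof. by rewrite /scale -[leqLHS]expn1; case: j => // j; rewrite leq_pexp2l//; lia. Qed.

Definition scale_index k N : nat := ex_minn (ex_intro (fun j => N <= scale k j)%N N (leq_scale k N)).

Lemma scale_indexP k N :
  (scale k (scale_index k N).-1 <= N <= scale k (scale_index k N))%N.
Proof.
rewrite /scale_index; case: ex_minnP => j -> jmin; rewrite andbT.
(* For index 0 the predecessor is again 0, and [scale k 0 = 0]. *)
case: j jmin => [|j] jmin; first by rewrite /scale exp0n// addnS.
by rewrite leqNgt; apply/negP => /ltnW /jmin; rewrite ltnn.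
Qed.

Lemma cvg_scale_index k : scale_index k N @[N --> \oo] --> \oo.
Proof.
apply/cvgnyPge => m; near=> N.
rewrite leqNgt; apply/negP => jm.
have /andP[_ h] := scale_indexP k N.
have : (scale k m < N)%N by near: N; exact: nbhs_infty_gt.
rewrite ltnNge => /negP; apply; apply: (leq_trans h).
by rewrite /scale leq_exp2r; [exact: ltnW|rewrite addn2].
Unshelve. all: by end_near. Qed.

End scale_index.

Section poissonian_almost_everywhere.
Context {R : realType}.
Notation mu := (@lebesgue_measure R).

Lemma good_maps_sum_le k N1 N2 (F : forall N, {ffun 'I_k -> 'I_N.+1} -> R) :
  (N1 <= N2)%N -> (forall z, 0 <= F N2 z) ->
  (forall (z1 : {ffun 'I_k -> 'I_N1.+1}) (z2 : {ffun 'I_k -> 'I_N2.+1}),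
    (forall i, z1 i = z2 i :> nat) -> F N1 z1 = F N2 z2) ->
  \sum_(z in good_maps k N1 1) F N1 z <= \sum_(z in good_maps k N2 1) F N2 z.
Proof.
move=> N12 F0 F12.
have N12S : (N1.+1 <= N2.+1)%N by [].
pose h (z : {ffun 'I_k -> 'I_N1.+1}) : {ffun 'I_k -> 'I_N2.+1} := [ffun i => widen_ord N12S (z i)].
have hE z i : h z i = z i :> nat by rewrite ffunE.
have hinj : injective h.
  move=> z z' /ffunP zz'; apply/ffunP => i; apply/val_inj.
  by rewrite /= -!hE zz'.
rewrite (eq_bigr (fun z => F N2 (h z))); last by move=> z _; apply: F12 => i; rewrite hE.
rewrite -(big_imset (F N2)) /=; last by move=> z z' _ _; exact: hinj.
rewrite [leRHS](big_setID (h @: good_maps k N1 1)) /=.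
rewrite (finset.setIidPr _); last first.
  apply/fintype.subsetP => _ /imsetP[z /good_mapsP[z1 zi] ->]; apply/good_mapsP; split => [i|i j].
    by rewrite hE.
  by move=> /(congr1 val) /=; rewrite !hE => /val_inj/zi.
by rewrite lerDl; apply: sumr_ge0.
Qed.

Lemma cell_corr_le K k (v : 'I_k -> R) N1 N2 x : (N1 <= N2)%N ->
  cell_corr K v N1 x <= cell_corr K v N2 x.
Proof.
move=> N12; apply: ler_sum => c _.
apply: (@good_maps_sum_le k N1 N2 (fun N z => hit K v z (c%:R / K%:R) x)) => // [z|z1 z2 z12].
  exact: hit_ge0.
by apply: eq_bigr => i _; rewrite z12.
Qed.

(** Soft cells have period 1, so they do not see the integer part. *)
Lemma sequence_cell_corr_frac n K (v : 'I_n.+1 -> R) N x :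
  sequence_cell_corr (fun m => frac_part (x ^+ m)) K v N = cell_corr K v N x.
Proof.
apply: eq_bigr => c _; apply: eq_bigr => z _; apply: eq_bigr => i _.
by rewrite /frac_part -[LHS](soft_cellDint _ _ (Num.floor (x ^+ z i))); congr (soft_cell K); ring.
Qed.

(** Between two consecutive lengths the cells and offsets stay those of the larger one, so the count
    is monotone in [N] and squeezed between its values at both ends, which have the same limit. *)
Lemma poissonian_of_cells n (x : R) :
  (forall L W (e : {ffun 'I_n -> 'I_(W + W).+1}) (nu : nat -> nat), (0 < L)%N ->
    nu = scale n.+1 \/ nu = scale n.+1 \o predn ->
    cell_corr (L * scale n.+1 j) (cell_offset (L * scale n.+1 j) e) (nu j) x /
      (scale n.+1 j)%:R @[j --> \oo] --> (L%:R * L%:R^-1 ^+ n.+1 : R)) ->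
  poissonian_correlation n.+1 (fun m => frac_part (x ^+ m)).
Proof.
move=> cells f sf suppf.
have cf : continuous f by have [] := sf [::].
pose J := scale_index n.+1.
have J_oo := cvg_scale_index n.+1.
apply: (@correlation_sum_cvg R n f (fun m => frac_part (x ^+ m)) (fun N => scale n.+1 (J N))) => //.
- by move=> N; have /andP[] := scale_indexP n.+1 N.
- apply: (@squeeze_cvgr _ _ _ _ (fun N => (scale n.+1 (J N).-1)%:R / (scale n.+1 (J N))%:R) (cst 1)).
  + near=> N; have /andP[h1 h2] := scale_indexP n.+1 N.
    have N0 : (0 < N)%N by near: N; exact: nbhs_infty_gt.
    have S0 : 0 < (scale n.+1 (J N))%:R :> R by rewrite ltr0n (leq_trans N0).
    by rewrite ler_pM2r ?invr_gt0// ler_nat h1 ler_pdivrMr// mul1r ler_nat.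
  + apply: (cvg_comp _ _ J_oo (@cvg_scale_ratio R n.+1 (fun j => scale n.+1 j.-1) _)) => j.
    by rewrite leqnn /scale leq_exp2r ?leq_pred// addn2.
  + exact: cvg_cst.
- move=> L W e L0.
  have lo := cells L W e _ L0 (or_intror erefl).
  have hi := cells L W e _ L0 (or_introl erefl).
  apply: (squeeze_cvgr _ (cvg_comp _ _ J_oo lo) (cvg_comp _ _ J_oo hi)).
  near=> N; have /andP[h1 h2] := scale_indexP n.+1 N.
  by rewrite sequence_cell_corr_frac /=; apply/andP; split;
    rewrite ler_wpM2r ?invr_ge0// cell_corr_le.
Unshelve. all: by end_near. Qed.

Lemma ae_forall_countable (I : countType) (P : I -> R -> Prop) :
  (forall i, {ae mu, forall x, P i x}) -> {ae mu, forall x, forall i, P i x}.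
Proof.
move=> H.
have : {ae mu, forall x, forall c : nat, forall i : I, unpickle c = Some i -> P i x}.
  apply: ae_foralln => c; case E : (unpickle c) => [i|].
    apply: (@filterS _ _ (ae_filter_ringOfSetsType mu) _ _ _ (H i)) => x Pix j [<-].
    exact: Pix.
  by apply: aeW.
apply: (@filterS _ _ (ae_filter_ringOfSetsType mu)) => x Px i.
by apply: (Px (pickle i)); rewrite pickleK.
Qed.

End poissonian_almost_everywhere.

Unset Implicit Arguments.

Theorem theorem1p1 (R : realType) :
  {ae @lebesgue_measure R, forall alpha : R, 1 < alpha ->
    forall k : nat, (2 <= k)%N ->
      poissonian_correlation k (fun n : nat => frac_part (alpha ^+ n))}.
Proof.
(* The intervals [[1 + 1 / (p + 1), p + 2]] exhaust the reals above 1, and all parameters range over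
   countable types, so the exceptional sets together are null. The number [L] of cells per unit is
   written [L.+1] to be positive. *)
have : {ae @lebesgue_measure R, forall alpha : R, forall p n L W : nat,
    forall e : {ffun 'I_n -> 'I_(W + W).+1}, forall low : bool,
    1 + p.+1%:R^-1 <= alpha <= p.+2%:R ->
    cell_corr (L.+1 * scale n.+1 j) (cell_offset (L.+1 * scale n.+1 j) e)
      (if low then scale n.+1 j.-1 else scale n.+1 j) alpha / (scale n.+1 j)%:R
      @[j --> \oo] --> (L.+1%:R * L.+1%:R^-1 ^+ n.+1 : R)}.
  apply: ae_foralln => p; apply: ae_foralln => n; apply: ae_foralln => L; apply: ae_foralln => W.
  apply: ae_forall_countable => e; apply: ae_forall_countable => low.
  have p0 : 0 < p.+1%:R^-1 :> R by rewrite invr_gt0.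
  apply: (corr_ae_cvg (nu := fun j => if low then scale n.+1 j.-1 else scale n.+1 j)) => //.
  - by rewrite ltrDl.
  - apply: (@le_trans _ _ 2%:R); last by rewrite ler_nat.
    by rewrite -[leRHS]/(1 + 1 : R) lerD2l invf_le1// ler1n.
  - move=> j; have h : (scale n.+1 j.-1 <= scale n.+1 j)%N.
      by rewrite /scale leq_exp2r ?leq_pred// addn2.
    by case: low; rewrite h leqnn.
apply: (@filterS _ _ (ae_filter_ringOfSetsType (@lebesgue_measure R))) => alpha H a1 [|n]// _.
have d0 : 0 < alpha - 1 by rewrite subr_gt0.
have dV : 0 < (alpha - 1)^-1 by rewrite invr_gt0.
(* The first summand takes care of the left end of the interval, the second of the right end. *)
pose p := (Num.truncn (alpha - 1)^-1 + Num.truncn alpha)%N.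
have ap : 1 + p.+1%:R^-1 <= alpha <= p.+2%:R.
  apply/andP; split.
    rewrite -lerBrDl -[leRHS]invrK lef_pV2 ?posrE//.
    have /andP[_ /ltW h] := truncn_itv (ltW dV).
    by apply: (le_trans h); rewrite ler_nat ltnS leq_addr.
  have /andP[_ /ltW h] := truncn_itv (ltW (lt_trans ltr01 a1)).
  by apply: (le_trans h); rewrite ler_nat /p; lia.
apply: poissonian_of_cells => -[//|L] W e nu _ [->|->].
- exact: (H p n L W e false ap).
- exact: (H p n L W e true ap).
Qed.
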